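(* Let $\Bbbk\supseteq\mathbb{Q}$ be a field with a non-trivial norm $|\cdot|$, and let $x=(x_1,\dots,x_n)$. Let $R$ be a (not necessarily Noetherian) differential $\Bbbk$-algebra, $\Bbbk[x]\subset R\subset\Bbbk[\![x]\!]$, satisfying: (a) ($R$ is closed under majorization) if $\tilde f\in R$ and $f\preceq\tilde f$, then $f\in R$; (b) ($R$ admits the implicit function theorem in two variables) if $f(x,y)\in R$ (a power series in two single variables $x,y$) satisfies $f(0,0)=0$ and $\partial_yf|_{(0,0)}\neq0$, then the unique formal solution $y(x)\in(x)\subset\Bbbk[\![x]\!]$ of $f(x,y(x))=0$ belongs to $R$. Then $e^\xi$ acts on $R$ for any $\xi\in \mathrm{Der}^{nilp}_\Bbbk(R)$.
   Context: For a multi-index $m$ put $|m|=\sum_i m_i$. For power series $f=\sum c_m x^m$, $\tilde f=\sum\tilde c_m x^m$ write $f\preceq\tilde f$ if $\sum_{|m|=d}|c_m|\le\sum_{|m|=d}|\tilde c_m|$ for all sufficiently large $d\in\mathbb{N}$. This comparison makes sense also for power series in different (numbers of) variables. Accordingly, in (b), for power series $g$ in one or two single variables, ''$g\in R$'' means that $g\preceq\tilde g$ for some $\tilde g\in R$; by (a), when these variables are among $x_1,\dots,x_n$ this is the same as membership in $R$. ''Differential'' means closed under $\partial_{x_1},\dots,\partial_{x_n}$. $\mathrm{Der}^{nilp}_\Bbbk(R)$ is the set of $x$-adically nilpotent derivations: $\xi=\sum_i a_i\partial_{x_i}$, $a_i\in R$, with $\xi^N(x)\subseteq(x)^2$ for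 $N\gg1$, where $(x)=(x_1,\dots,x_n)$. For such $\xi$ the operator $e^\xi=\sum_{j\ge0}\frac{\xi^j}{j!}$ is a well-defined automorphism of $\Bbbk[\![x]\!]$. ''$e^\xi$ acts on $R$'' means that it restricts to $R$, i.e. $e^\xi(R)\subseteq R$. *)

(* Defs.v *)
From HB Require Import structures.
From mathcomp Require Export all_boot all_order all_algebra.
From mathcomp Require Export boolp classical_sets functions reals.
From mathcomp Require Export mpoly.

Set Implicit Arguments.
Unset Strict Implicit.
Unset Printing Implicit Defensive.

Import Order.TTheory GRing.Theory Num.Theory.
Local Open Scope ring_scope.

(* Formal power series K[[x_1, ..., x_n]]: [f m] is the coefficient of x^m.
   The module structure is the pointwise one of the function type, but the
   product is the Cauchy product, not the pointwise one. *)
Definition fps (K : Type) (n : nat) : Type := 'X_{1..n} -> K.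

Section FpsRing.
Variables (K : comNzRingType) (n : nat).
Implicit Types f g h : fps K n.

HB.instance Definition _ := GRing.Lmodule.copy (fps K n) ('X_{1..n} -> K^o).

Definition fps_one : fps K n := fun m => (m == 0%MM)%:R.

Definition fps_mul f g : fps K n := fun m =>
  \sum_(k : 'X_{1..n < (mdeg m).+1, (mdeg m).+1} | m == (k.1 + k.2)%MM)
     f k.1 * g k.2.

Definition fps_var (i : 'I_n) : fps K n := fun m => (m == U_(i)%MM)%:R.

Let tr d f : {mpoly K[n]} := \sum_(m : 'X_{1..n < d}) f m *: 'X_[m].

Let trE d f m : (mdeg m < d)%N -> (tr d f)@_m = f m.
Proof. exact: mcoeff_mpoly. Qed.

Let mulE_gen (P Q : {mpoly K[n]}) f g d m : (mdeg m < d)%N ->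
  (forall k, (mdeg k < d)%N -> P@_k = f k) ->
  (forall k, (mdeg k < d)%N -> Q@_k = g k) ->
  fps_mul f g m = (P * Q)@_m.
Proof.
move=> lt_md eqP eqQ; rewrite mcoeffM; apply: eq_bigr => k _.
by rewrite eqP ?eqQ //; apply: leq_trans (bmdeg _) _.
Qed.

Let mulE f g d m : (mdeg m < d)%N -> fps_mul f g m = (tr d f * tr d g)@_m.
Proof. by move=> lt_md; apply: (mulE_gen lt_md) => k; exact: trE. Qed.

Fact fps_mulC : commutative fps_mul.
Proof.
by move=> f g; apply/funext => m; rewrite !(mulE _ _ (ltnSn (mdeg m))) mulrC.
Qed.

Fact fps_mulA : associative fps_mul.
Proof.
move=> f g h; apply/funext => m; pose d := (mdeg m).+1.
have lt_md : (mdeg m < d)%N by [].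
rewrite (@mulE_gen (tr d f) (tr d g * tr d h) _ _ d) //; first last.
- by move=> k lt_kd; rewrite (mulE _ _ lt_kd).
- by move=> k; exact: trE.
rewrite (@mulE_gen (tr d f * tr d g) (tr d h) _ _ d) ?mulrA //.
- by move=> k lt_kd; rewrite (mulE _ _ lt_kd).
- by move=> k; exact: trE.
Qed.

Fact fps_mul1 : left_id fps_one fps_mul.
Proof.
move=> f; apply/funext => m; pose d := (mdeg m).+1.
rewrite (@mulE_gen 1 (tr d f) _ _ d) ?mul1r ?trE // => k lt_kd.
- by rewrite mcoeff1.
- exact: trE.
Qed.

Fact fps_mulDl : left_distributive fps_mul +%R.
Proof.
move=> f g h; apply/funext => m; pose d := (mdeg m).+1.
have lt_md : (mdeg m < d)%N by [].
have -> : (fps_mul f h + fps_mul g h) m = fps_mul f h m + fps_mul g h m by [].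
rewrite (@mulE_gen (tr d f + tr d g) (tr d h) _ _ d) //.
- by rewrite mulrDl mcoeffD -!mulE.
- by move=> k lt_kd; rewrite mcoeffD !trE.
- by move=> k; exact: trE.
Qed.

Fact fps_oner_neq0 : fps_one != 0.
Proof.
apply/eqP => /(congr1 (fun f : fps K n => f 0%MM)).
by rewrite /fps_one eqxx => /eqP; rewrite oner_eq0.
Qed.

HB.instance Definition _ := GRing.Zmodule_isComNzRing.Build (fps K n)
  fps_mulA fps_mulC fps_mul1 fps_mulDl fps_oner_neq0.

Fact fps_scaleAl (c : K) f g : c *: (f * g) = c *: f * g.
Proof.
apply/funext => m; rewrite [LHS]mulr_sumr.
by apply: eq_bigr => k _; rewrite mulrA.
Qed.

HB.instance Definition _ :=
  GRing.Lmodule_isLalgebra.Build K (fps K n) fps_scaleAl.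

End FpsRing.

HB.instance Definition _ (K : comNzRingType) (n : nat) :=
  GRing.Lalgebra_isComAlgebra.Build K (fps K n).

Section Calculus.
Variables (K : fieldType) (n : nat).
Implicit Types f g : fps K n.

Definition fps_of_mpoly (p : {mpoly K[n]}) : fps K n := fun m => p@_m.

Definition fps_deriv (i : 'I_n) f : fps K n :=
  fun m => f (m + U_(i))%MM *+ (m i).+1.

(* membership in the ideals (x) and (x)^2 of K[[x]] *)
Definition in_x f : Prop :=
  exists g : 'I_n -> fps K n, f = \sum_i fps_var K i * g i.

Definition in_x2 f : Prop :=
  exists g : 'I_n -> 'I_n -> fps K n,
    f = \sum_i \sum_j fps_var K i * fps_var K j * g i j.

Definition fps_derivation (a : 'I_n -> fps K n) f : fps K n :=
  \sum_i a i * fps_deriv i f.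

Definition x_nilpotent (xi : fps K n -> fps K n) : Prop :=
  exists N0, forall N, (N0 <= N)%N -> forall f, in_x f -> in_x2 (iter N xi f).

(* [g] is the x-adic sum of the series [u]. There are finitely many monomials
   in each degree, so x-adic convergence is stabilization of each coefficient. *)
Definition fps_series_sum (u : nat -> fps K n) g : Prop :=
  forall m, exists J, forall j, (J <= j)%N -> (\sum_(i < j) u i) m = g m.

Definition exp_acts (xi : fps K n -> fps K n) (A : {pred fps K n}) : Prop :=
  forall f, f \in A ->
    exists2 g, fps_series_sum (fun j => (j`!%:R : K)^-1 *: iter j xi f) g
             & g \in A.

End Calculus.

(* f(g_1, ..., g_p) for g_1, ..., g_p in (x): monomials of f of degree greater
   than [mdeg d] do not contribute to the coefficient of x^d. Without the
   assumption on the g_i this is not the substitution. *)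
Definition fps_comp (K : fieldType) (p n : nat)
    (f : fps K p) (g : 'I_p -> fps K n) : fps K n :=
  fun d => \sum_(m : 'X_{1..p < (mdeg d).+1})
             f m * (\prod_(i < p) g i ^+ m i) d.

Section Norm.
Variables (R : realType) (K : fieldType).

Record nontrivial_norm (nrm : K -> R) : Prop := NontrivialNorm {
  norm_ge0 : forall a, 0 <= nrm a;
  norm_eq0 : forall a, nrm a = 0 <-> a = 0;
  norm_mul : forall a b, nrm (a * b) = nrm a * nrm b;
  norm_add : forall a b, nrm (a + b) <= nrm a + nrm b;
  norm_nontrivial : exists2 a, a != 0 & nrm a != 1 }.

Variable nrm : K -> R.

Definition degree_norm (p : nat) (f : fps K p) (d : nat) : R :=
  \sum_(m : 'X_{1..p < d.+1} | mdeg m == d) nrm (f m).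

Definition majorized (p q : nat) (f : fps K p) (g : fps K q) : Prop :=
  exists D, forall d, (D <= d)%N -> degree_norm f d <= degree_norm g d.

Variables (n : nat) (A : {pred fps K n}).

(* "f \in A" for a series f in variables unrelated to those of A *)
Definition in_up_to_maj (p : nat) (f : fps K p) : Prop :=
  exists2 g, g \in A & majorized f g.

Definition majorization_closed : Prop :=
  forall f g : fps K n, g \in A -> majorized f g -> f \in A.

(* In [fps K 2] the variables x and y have indices [ord0] and [ord_max]. *)
Definition implicit_function_closed : Prop :=
  forall (f : fps K 2) (y : fps K 1),
    in_up_to_maj f -> f 0%MM = 0 -> fps_deriv ord_max f 0%MM != 0 ->
    in_x y ->
    fps_comp f (fun i => if i == ord0 then fps_var K ord0 else y) = 0 ->
    in_up_to_maj y.

End Norm.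

(* Main.v *)
(* Membership in A only depends on the growth of the degree norms, so A is a set
   of growth rates. The implicit function theorem makes this set closed under
   division, exponentials and geometric rescaling. The key point is that every
   rate |al|^(e d) in it is dominated by a rate V in it with V i V j <= V (i + j).
   Parts d of a sum D that are at least about D^(2/3) are handled by the
   exponential of sum_d al^(e d) b_d x^d for generic b_d, whose D-th coefficient
   is about as large as its largest term; iterating reaches parts of size about
   D^(1/3). Among the smaller parts, only copies of the one of largest rate
   e d / d matter, and these powers are all obtained at once from one logarithmic
   derivative theta v / v.
   With V at hand, sum_D Phi_D r^D / V (D - l), where Phi_D(f) is the weighted sum
   over j of the norms of the degree D parts of xi^j f / j!, is submultiplicative
   in f, because xi is a derivation. As xi^N x_i has order at least 2, it is
   bounded on the x_i for small r, by a contraction argument, hence on A, and so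
   exp(xi) f has growth at most a rescaling of V. *)

Require Import Defs.
From mathcomp Require Import zify ring lra.

Set Implicit Arguments.
Unset Strict Implicit.
Unset Printing Implicit Defensive.

Import Order.TTheory GRing.Theory Num.Theory.
Local Open Scope ring_scope.

(** * Norms on fields of characteristic zero *)

(** This shapes the constructions: sums are cut to disjoint supports, coefficients are chosen
    recursively between two values, exponentials are taken generic, and the product over record
    rates is lacunary. Superadditive exponents are needed because the coefficients of xi^j f are
    sums of products of arbitrarily many coefficients of the a_i with one of f; a rate with V i V j
    <= V (i + j) bounds each such product by a single value. The norm may be small on some integers.
    Then 1 / n and 1 / j! grow at most geometrically in norm: rescalings absorb the former, and the
    weights in Phi_D compensate for the latter. *)

Lemma bernoulli_ge (R : realType) (x : R) m : 0 <= x ->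
  1 + m%:R * (x - 1) <= x ^+ m.
Proof.
move=> x0; elim: m => [|m IH]; first by rewrite mul0r addr0.
rewrite exprS; apply: le_trans (ler_wpM2l x0 IH).
rewrite -addn1 natrD -subr_ge0.
suff -> : x * (1 + m%:R * (x - 1)) - (1 + (m%:R + 1) * (x - 1)) = m%:R * (x - 1) ^+ 2.
  by rewrite mulr_ge0 ?sqr_ge0.
by ring.
Qed.

Section NormTheory.
Variables (R : realType) (K : fieldType) (nrm : K -> R).
Hypothesis nrmP : nontrivial_norm nrm.
Implicit Types a b : K.

Lemma nrm_ge0 a : 0 <= nrm a. Proof. exact: norm_ge0. Qed.
Lemma nrmM a b : nrm (a * b) = nrm a * nrm b. Proof. exact: norm_mul. Qed.
Lemma nrmD a b : nrm (a + b) <= nrm a + nrm b. Proof. exact: norm_add. Qed.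

Lemma nrm0 : nrm 0 = 0.
Proof. by apply/(norm_eq0 nrmP). Qed.

Lemma nrm_eq0 a : (nrm a == 0) = (a == 0).
Proof. by apply/eqP/eqP => /(norm_eq0 nrmP). Qed.

Lemma nrm_gt0 a : (0 < nrm a) = (a != 0).
Proof. by rewrite lt0r nrm_ge0 nrm_eq0 andbT. Qed.

Lemma nrm1 : nrm 1 = 1.
Proof.
have /eqP := nrmM 1 1; rewrite mul1r -subr_eq0 -{1}[nrm 1]mulr1 -mulrBr mulf_eq0.
by rewrite nrm_eq0 oner_eq0 /= subr_eq0 => /eqP <-.
Qed.

Lemma nrmX a n : nrm (a ^+ n) = nrm a ^+ n.
Proof. by elim: n => [|n IH]; rewrite ?nrm1 // !exprS nrmM IH. Qed.

Lemma nrmN a : nrm (- a) = nrm a.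
Proof.
suff n1 : nrm (-1) = 1 by rewrite -mulN1r nrmM n1 mul1r.
have : nrm (-1) ^+ 2 = 1 by rewrite -nrmX sqrrN expr1n nrm1.
by move/eqP; rewrite sqrp_eq1 ?nrm_ge0 // => /eqP.
Qed.

Lemma nrmB a b : nrm (a - b) <= nrm a + nrm b.
Proof. by rewrite -(nrmN b) nrmD. Qed.

Lemma nrm_subl a b : nrm a - nrm b <= nrm (a + b).
Proof. by rewrite lerBlDr -{1}[a](addrK b) (le_trans (nrmB _ _)). Qed.

Lemma nrmV a : nrm a^-1 = (nrm a)^-1.
Proof.
have [->|a0] := eqVneq a 0; first by rewrite invr0 nrm0 invr0.
by apply: (mulIf (x := nrm a)); rewrite ?nrm_eq0 // -nrmM !mulVf ?nrm1 ?nrm_eq0.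
Qed.

Lemma nrm_sum I (r : seq I) (P : pred I) (F : I -> K) :
  nrm (\sum_(i <- r | P i) F i) <= \sum_(i <- r | P i) nrm (F i).
Proof.
elim/big_rec2: _ => [|i x y _ le_yx]; first by rewrite nrm0.
by rewrite (le_trans (nrmD _ _)) // lerD2l.
Qed.

Lemma nrm_nat_le n : nrm n%:R <= n%:R.
Proof.
elim: n => [|n IH]; first by rewrite nrm0.
by rewrite -addn1 !natrD (le_trans (nrmD _ _)) // nrm1 lerD2r.
Qed.

Lemma nrm_large (B : R) : exists2 a, a != 0 & B <= nrm a.
Proof.
have [b b1] : exists b, 1 < nrm b.
  have [a a0 a1] := norm_nontrivial nrmP.
  have [lt1|le1] := ltP 1 (nrm a); first by exists a.
  exists a^-1; rewrite nrmV -invr1 ltf_pV2 ?posrE ?nrm_gt0 //.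
  by rewrite lt_neqAle a1.
pose n := Num.bound (`|B| / (nrm b - 1)).
exists (b ^+ n).
  by rewrite -nrm_gt0 nrmX exprn_gt0 // (lt_trans ltr01).
rewrite nrmX; have b1' : 0 < nrm b - 1 by rewrite subr_gt0.
have : `|B| / (nrm b - 1) < n%:R by rewrite archi_boundP // divr_ge0 // ltW.
rewrite ltr_pdivrMr // => lt_B.
by have := bernoulli_ge n (nrm_ge0 b); have := ler_norm B; lra.
Qed.

End NormTheory.

(** * The norm on the integers, after Ostrowski *)

Section IntegerNorms.
Variables (R : realType) (K : fieldType) (nrm : K -> R).
Hypothesis nrmP : nontrivial_norm nrm.
Hypothesis K_char0 : [pchar K] =i pred0.

Lemma natK_neq0 n : (n%:R == 0 :> K) = (n == 0)%N.
Proof. by move/pcharf0P: K_char0; apply. Qed.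

Lemma le1_of_bounded_powers (x B : R) :
  0 <= x -> (forall n, x ^+ n <= B) -> x <= 1.
Proof.
move=> x0 bnd; rewrite leNgt; apply/negP => x1.
have x1' : 0 < x - 1 by rewrite subr_gt0.
have B0 : 0 <= B by rewrite (le_trans _ (bnd 0%N)).
have := archi_boundP (divr_ge0 B0 (ltW x1')).
set n := Num.bound _; rewrite ltr_pdivrMr // => lt_B.
by have := bnd n; have := bernoulli_ge n x0; lra.
Qed.

(** Division by [q] with remainder bounds all integers by the fixed point [B] of B = |q| B + q.
    Powers of integers are integers, so the bound improves to 1. *)
Lemma small_nat_bounded q : (1 < q)%N -> nrm q%:R < 1 ->
  forall n, nrm n%:R <= 1.
Proof.
move=> q1 nq1; have nq0 := nrm_ge0 nrmP q%:R.
have q1' : 0 < 1 - nrm q%:R by rewrite subr_gt0.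
pose B := q%:R / (1 - nrm q%:R).
have B0 : 0 <= B by rewrite divr_ge0 // ltW.
have defB : nrm q%:R * B + q%:R = B by rewrite /B; field; rewrite gt_eqF.
have bnd : forall n, nrm n%:R <= B.
  elim/ltn_ind => n IH; have [->|n0] := posnP n; first by rewrite nrm0.
  rewrite (divn_eq n q) natrD natrM mulrC -defB (le_trans (nrmD nrmP _ _)) //.
  apply: lerD; first by rewrite (nrmM nrmP) // ler_wpM2l // IH // ltn_Pdiv.
  rewrite (le_trans (nrm_nat_le nrmP _)) // ler_nat ltnW // ltn_mod.
  exact: ltnW.
move=> n; apply: (@le1_of_bounded_powers _ B) => [|k]; first exact: nrm_ge0.
by rewrite -(nrmX nrmP) // -natrX.
Qed.

(** By Bezout, 1 is a combination of [m] and [q ^ k] with integer coefficients, which have norm at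
    most 1; hence 1 <= |m| + |q|^k for every [k]. *)
Lemma coprime_nat_norm q m : (1 < q)%N -> nrm q%:R < 1 -> coprime m q ->
  nrm m%:R = 1.
Proof.
move=> q1 nq1 cmq; have le1 := small_nat_bounded q1 nq1.
apply/eqP; rewrite eq_le le1 /= -subr_le0.
have nq0 := nrm_ge0 nrmP q%:R.
suff key k : 1 - nrm m%:R <= nrm q%:R ^+ k.
  rewrite leNgt; apply/negP => h0.
  have [q0|q0] := eqVneq (nrm q%:R) 0.
    by have := key 1%N; rewrite expr1 q0 leNgt h0.
  have q0' : 0 < nrm q%:R by rewrite lt0r q0.
  suff : (nrm q%:R)^-1 <= 1 by rewrite invf_le1 // leNgt nq1.
  apply: (@le1_of_bounded_powers _ (1 - nrm m%:R)^-1) => [|k].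
    by rewrite invr_ge0.
  by rewrite exprVn lef_pV2 ?posrE ?exprn_gt0.
have m0 : (0 < m)%N.
  by case: m cmq => //; rewrite /coprime gcd0n => /eqP e; rewrite e in q1.
have ck : coprime m (q ^ k) by rewrite coprimeXr.
have [km kn def1 _] := egcdnP (q ^ k) m0.
have e1 : 1 = (km * m)%:R - (kn * q ^ k)%:R :> K.
  by rewrite def1 natrD (eqP ck) addrAC subrr add0r.
have := nrmB nrmP (km * m)%:R (kn * q ^ k)%:R.
rewrite -e1 (nrm1 nrmP) !natrM natrX !(nrmM nrmP) (nrmX nrmP) lerBlDr => le_1.
rewrite (le_trans le_1) // addrC.
by rewrite lerD // ler_piMl ?le1 ?exprn_ge0 // nrm_ge0.
Qed.

Lemma logn_fact_le p n : prime p -> (logn p n`! <= n)%N.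
Proof.
move=> p_pr; have p1 := prime_gt1 p_pr.
rewrite logn_fact //.
suff H m : (\sum_(1 <= k < m.+1) n %/ p ^ k + n %/ p ^ m <= n)%N.
  exact: leq_trans (leq_addr _ _) (H n).
elim: m => [|m IH]; first by rewrite big_geq // expn0 divn1.
rewrite big_nat_recr //= -addnA; apply: leq_trans IH; rewrite leq_add2l.
rewrite expnSr divnMA; set x := (n %/ p ^ m)%N.
have := leq_divM x p; nia.
Qed.

Lemma nat_norm_dichotomy :
  (forall n, (0 < n)%N -> 1 <= nrm n%:R) \/
  exists2 q, prime q & nrm q%:R < 1.
Proof.
have [all1|] := pselect (forall n, (0 < n)%N -> 1 <= nrm n%:R); first by left.
move=> /existsNP [n /not_implyP [n0 /negP]]; rewrite -ltNge => lt1; right.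
elim/ltn_ind: n n0 lt1 => n IH n0 lt1.
have n1 : (1 < n)%N.
  by case: n n0 lt1 {IH} => [//|[|//]] _; rewrite (nrm1 nrmP) // ltxx.
have p_pr := pdiv_prime n1; have p1 := prime_gt1 p_pr.
have [|le1] := ltP (nrm (pdiv n)%:R) 1; first by exists (pdiv n).
have def_n := divnK (pdiv_dvd n).
apply: (IH (n %/ pdiv n)%N); first exact: ltn_Pdiv.
  by rewrite divn_gt0 ?pdiv_gt0 // dvdn_leq ?pdiv_dvd.
apply: le_lt_trans lt1.
have -> : n%:R = (n %/ pdiv n)%:R * (pdiv n)%:R :> K by rewrite -natrM def_n.
by rewrite (nrmM nrmP) ler_peMr // nrm_ge0.
Qed.

Lemma nrm_pfactor q n : prime q -> nrm q%:R < 1 -> (0 < n)%N ->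
  nrm n%:R = nrm q%:R ^+ logn q n.
Proof.
move=> q_pr nq1 n0; have [m cmq def_n] := pfactor_coprime q_pr n0.
rewrite {1}def_n natrM (nrmM nrmP) // natrX (nrmX nrmP) // (@coprime_nat_norm q) ?mul1r //.
  exact: prime_gt1.
by rewrite coprime_sym.
Qed.

(** If |q| < 1 then |n| = |q|^(v_q n) with v_q n <= n. Division by [n], in the logarithm or after
    differentiation, thus costs at most a rescaling. *)
Lemma inv_nat_norm_geometric :
  exists2 C : R, 1 <= C & forall n, (0 < n)%N -> (nrm n%:R)^-1 <= C ^+ n.
Proof.
case: nat_norm_dichotomy => [ge1|[q q_pr nq1]].
  exists 1 => // n n0; rewrite expr1n invf_le1 ?ge1 //.
  by rewrite (nrm_gt0 nrmP) // natK_neq0 -lt0n.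
have q0 : 0 < nrm q%:R by rewrite (nrm_gt0 nrmP) // natK_neq0 -lt0n prime_gt0.
have C1 : 1 <= (nrm q%:R)^-1 by rewrite invf_ge1 // ltW.
exists (nrm q%:R)^-1 => // n n0; rewrite (nrm_pfactor q_pr) // -exprVn.
rewrite ler_weXn2l // ltnW // (leq_trans (ltn_expl _ (prime_gt1 q_pr))) //.
by rewrite dvdn_leq // pfactor_dvdnn.
Qed.

(** The weights absorb the factorials of xi^j / j!. If |q| < 1, the choice |j!| C^j turns the last
    inequality into an equality; it is submultiplicative because binomial coefficients have norm at
    most 1, and at least 1 because v_q(j!) <= j. *)
Lemma divided_power_weights :
  exists (w : nat -> R) (C : R), [/\ 1 <= C, forall j, 1 <= w j,
    forall i j, w (i + j)%N <= w i * w j &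
    forall j, w j.+1 * (nrm j.+1%:R)^-1 <= C * w j].
Proof.
case: nat_norm_dichotomy => [ge1|[q q_pr nq1]].
  exists (fun=> 1), 1; split=> // [i j|j]; first by rewrite mulr1.
  by rewrite !mul1r invf_le1 ?ge1 // (nrm_gt0 nrmP) natK_neq0.
have q0 : 0 < nrm q%:R by rewrite (nrm_gt0 nrmP) // natK_neq0 -lt0n prime_gt0.
set C := (nrm q%:R)^-1; have C1 : 1 <= C by rewrite invf_ge1 // ltW.
have C0 : 0 < C by rewrite invr_gt0.
have le1 := small_nat_bounded (prime_gt1 q_pr) nq1.
exists (fun j => nrm j`!%:R * C ^+ j), C; split=> // [j|i j|j].
- rewrite (nrm_pfactor q_pr nq1) ?fact_gt0 // /C exprVn ler_pdivlMr ?exprn_gt0 //.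
  by rewrite mul1r ler_wiXn2l ?(ltW q0) ?(ltW nq1) // logn_fact_le.
- rewrite exprD mulrACA ler_wpM2r ?mulr_ge0 ?exprn_ge0 ?(ltW C0) //.
  rewrite -(bin_fact (leq_addr j i)) addKn !natrM !(nrmM nrmP).
  by rewrite ler_piMl ?mulr_ge0 ?nrm_ge0.
- rewrite factS natrM (nrmM nrmP) exprS le_eqVlt.
  set x := nrm j.+1%:R; have x0 : x != 0 by rewrite (nrm_eq0 nrmP) natK_neq0.
  by apply/orP; left; apply/eqP; clearbody C; field.
Qed.

End IntegerNorms.

(** * Polynomials that are small at separated points *)

Section Interpolation.
Variables (R : realType) (K : fieldType) (nrm : K -> R).
Hypothesis nrmP : nontrivial_norm nrm.

(** Newton interpolation: after division by X - c the quotient has values below 2 e at the other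
    points, which are at distance at least 1 from [c]. Multiplying back costs the factor 2 + 2 B +
    1. *)
Lemma poly_small_values (B : R) m (Q : {poly K}) (s : seq K) (e : R) :
  0 <= B -> (size Q <= m.+1)%N -> size s = m.+1 -> uniq s ->
  {in s, forall x, nrm x <= B} ->
  {in s &, forall x y, x != y -> 1 <= nrm (x - y)} ->
  {in s, forall x, nrm Q.[x] < e} ->
  forall i, nrm Q`_i < e * (3 + 2 * B) ^+ m.
Proof.
move=> B0; elim: m => [|m IH] in Q s e *.
  case: s => [|c [|//]] //= szQ _ _ _ _ /(_ c (mem_head _ _)) + i.
  rewrite (size1_polyC szQ) hornerC coefC mulr1 => lt_e.
  by case: (i == _) => //; rewrite (nrm0 nrmP) (le_lt_trans (nrm_ge0 nrmP _) lt_e).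
case: s => [//|c s] /= szQ [sz_s] /andP[c_s uniq_s] leB sepB lt_e.
have : root (Q - Q.[c]%:P) c by rewrite /root !hornerE subrr.
case/factor_theorem => T defT.
have defQ : Q = T * ('X - c%:P) + Q.[c]%:P by rewrite -defT subrK.
have lec : nrm Q.[c] < e by rewrite lt_e ?mem_head.
have szT : (size T <= m.+1)%N.
  have [->|T0] := eqVneq T 0; first by rewrite size_poly0.
  have : (size (T * ('X - c%:P))%R <= m.+2)%N.
    rewrite -defT (leq_trans (size_polyD _ _)) // geq_max szQ size_polyN.
    by rewrite (leq_trans (size_polyC_leq1 _)).
  by rewrite (size_Mmonic T0 (monicXsubC c)) size_XsubC addn2.
have e0 : 0 < e by rewrite (le_lt_trans (nrm_ge0 nrmP _) lec).
have ltT : {in s, forall x, nrm T.[x] < 2 * e}.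
  move=> x xs; have xc : x != c by apply: contraNneq c_s => <-.
  have : Q.[x] - Q.[c] = T.[x] * (x - c).
    by rewrite {1}defQ !hornerE addrK.
  move/(congr1 nrm); rewrite (nrmM nrmP) => eqT.
  have sx := sepB x c; rewrite !inE xs eqxx orbT /= in sx.
  have {}sx := sx isT isT xc.
  apply: le_lt_trans (_ : nrm (Q.[x] - Q.[c]) < _).
    by rewrite eqT ler_peMr ?nrm_ge0.
  rewrite (le_lt_trans (nrmB nrmP _ _)) // mulr_natl mulr2n ltrD //.
  by rewrite lt_e // inE xs orbT.
have {}IH := IH T s (2 * e) szT sz_s uniq_s.
have leB' : {in s, forall x, nrm x <= B} by move=> x xs; rewrite leB // inE xs orbT.
have sepB' : {in s &, forall x y, x != y -> 1 <= nrm (x - y)}.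
  by move=> x y xs ys; apply: sepB; rewrite inE ?xs ?ys orbT.
have {}IH := IH leB' sepB' ltT => i.
set P := (3 + 2 * B) ^+ m in IH *.
have P1 : 1 <= P by rewrite exprn_ege1 //; lra.
have P0 : 0 < P by rewrite (lt_le_trans ltr01).
rewrite exprS -/P defQ coefD mulrBr coefB coefMX coefMC coefC.
have h1 : nrm (if (i == 0)%N then 0 else T`_i.-1) < 2 * e * P.
  by case: ifP => _ //; rewrite (nrm0 nrmP) !mulr_gt0.
have h2 : nrm (T`_i * c) <= 2 * e * P * B.
  rewrite (nrmM nrmP) ler_pM ?nrm_ge0 //; first exact/ltW/IH.
  by rewrite leB ?mem_head.
have h3 : nrm (if (i == 0)%N then Q.[c] else 0) < e * P.
  case: ifP => _; last by rewrite (nrm0 nrmP) mulr_gt0.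
  by rewrite (lt_le_trans lec) // ler_peMr // ltW.
have := nrmD nrmP ((if (i == 0)%N then 0 else T`_i.-1) - T`_i * c)
  (if (i == 0)%N then Q.[c] else 0).
have := nrmB nrmP (if (i == 0)%N then 0 else T`_i.-1) (T`_i * c).
by move: h1 h2 h3; lra.
Qed.

Lemma few_small_values (B : R) m (Q : {poly K}) (s : seq K) i :
  0 <= B -> (size Q <= m.+1)%N -> uniq s ->
  {in s, forall x, nrm x <= B} ->
  {in s &, forall x y, x != y -> 1 <= nrm (x - y)} ->
  {in s, forall x, nrm Q.[x] * (3 + 2 * B) ^+ m < nrm Q`_i} ->
  (size s <= m)%N.
Proof.
move=> B0 szQ uniq_s leB sepB bad; rewrite leqNgt; apply/negP => lt_m.
have P0 : 0 < (3 + 2 * B) ^+ m by rewrite exprn_gt0 //; lra.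
have sub x : x \in take m.+1 s -> x \in s by apply: mem_take.
have := @poly_small_values B m Q (take m.+1 s) (nrm Q`_i / (3 + 2 * B) ^+ m)
  B0 szQ _ (take_uniq _ uniq_s) _ _ _ i.
rewrite divfK ?gt_eqF // ltxx => H; suff : false by [].
apply: H => [|x /sub|x y /sub xs /sub|x /sub xs].
- by rewrite size_takel.
- exact: leB.
- exact: sepB.
- by rewrite ltr_pdivlMr // bad.
Qed.

(** Numbers in base [al] with digits 0 and 1. Integers need not be separated for [nrm], for instance
    p-adically; these 2^m points are at mutual distance at least 1 as soon as |al| >= 2. *)
Fixpoint binary_point (al : K) m t : K :=
  if m is m'.+1 then (t %% 2)%N%:R + al * binary_point al m' (t %/ 2)%N else 0.

Lemma binary_point_le al m t : 2 <= nrm al ->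
  nrm (binary_point al m t) <= nrm al ^+ m - 1.
Proof.
move=> al2; elim: m t => [|m IH] t /=; first by rewrite (nrm0 nrmP) subrr.
have b1 : nrm (t %% 2)%N%:R <= 1.
  by rewrite (le_trans (nrm_nat_le nrmP _)) // lern1 -ltnS ltn_mod.
have := nrmD nrmP (t %% 2)%N%:R (al * binary_point al m (t %/ 2)%N).
rewrite (nrmM nrmP) exprS; have := IH (t %/ 2)%N; nra.
Qed.

Lemma binary_point_sep al m t u : 2 <= nrm al ->
  (t < 2 ^ m)%N -> (u < 2 ^ m)%N -> t != u ->
  1 <= nrm (binary_point al m t - binary_point al m u).
Proof.
move=> al2; elim: m t u => [|m IH] t u /=.
  by rewrite expn0 !ltnS !leqn0 => /eqP -> /eqP ->.
rewrite expnS => lt_t lt_u tu.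
have lt2 x : (x < 2 * 2 ^ m)%N -> (x %/ 2 < 2 ^ m)%N by lia.
have al0 : 0 <= nrm al := nrm_ge0 nrmP al.
set bt := binary_point al m (t %/ 2)%N; set bu := binary_point al m (u %/ 2)%N.
have -> : (t %% 2)%N%:R + al * bt - ((u %% 2)%N%:R + al * bu) =
          ((t %% 2)%N%:R - (u %% 2)%N%:R) + al * (bt - bu) by ring.
have [e2|n2] := eqVneq (t %/ 2)%N (u %/ 2)%N.
  rewrite /bt /bu e2 subrr mulr0 addr0.
  have [] : ((t %% 2 = 0 /\ u %% 2 = 1) \/ (t %% 2 = 1 /\ u %% 2 = 0))%N by lia.
    by move=> [-> ->]; rewrite sub0r (nrmN nrmP) (nrm1 nrmP).
  by move=> [-> ->]; rewrite subr0 (nrm1 nrmP).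
have := IH _ _ (lt2 _ lt_t) (lt2 _ lt_u) n2; rewrite -/bt -/bu => sep.
have b1 : nrm ((t %% 2)%N%:R - (u %% 2)%N%:R) <= 1.
  have [] : ((t %% 2 = u %% 2) \/ (t %% 2 = 0 /\ u %% 2 = 1) \/
     (t %% 2 = 1 /\ u %% 2 = 0))%N by lia.
    by move=> ->; rewrite subrr (nrm0 nrmP).
  case=> [[-> ->]|[-> ->]]; last by rewrite subr0 (nrm1 nrmP).
  by rewrite sub0r (nrmN nrmP) (nrm1 nrmP).
have := nrm_subl nrmP (al * (bt - bu)) ((t %% 2)%N%:R - (u %% 2)%N%:R).
have h2 : 2 * 1 <= nrm al * nrm (bt - bu) by rewrite ler_pM.
by rewrite [_ + _ * _]addrC (nrmM nrmP); lra.
Qed.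

End Interpolation.

(** * Avoiding infinitely many bad events *)

Section Selection.
Variables (R : realFieldType) (M : nat -> nat).
Hypothesis M_gt0 : forall i, (0 < M i)%N.
Implicit Types (w : nat -> nat) (F : (nat -> nat) -> R).

Definition upd w h t : nat -> nat := fun i => if i == h then t else w i.

Lemma updC w h t i s : h != i -> upd (upd w h t) i s = upd (upd w i s) h t.
Proof.
move=> hi; apply/funext => j; rewrite /upd.
by case: eqP => // ->; rewrite eq_sym (negPf hi).
Qed.

(* expectation over the coordinates h, ..., h + k - 1, chosen uniformly and
   independently with values w i < M i *)
Fixpoint avg k h F w : R :=
  if k is k'.+1 then (M h)%:R^-1 * \sum_(t < M h) avg k' h.+1 F (upd w h t)
  else F w.

Let M0 i : 0 < (M i)%:R :> R. Proof. by rewrite ltr0n. Qed.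

Lemma mean_le h (f : nat -> R) c : (forall t, (t < M h)%N -> f t <= c) ->
  (M h)%:R^-1 * \sum_(t < M h) f t <= c.
Proof.
move=> le_c; rewrite ler_pdivrMl //.
have : \sum_(t < M h) f t <= \sum_(t < M h) c.
  by apply: ler_sum => t _; apply: le_c.
by rewrite sumr_const card_ord mulr_natl.
Qed.

Lemma mean_exists_le h (f : nat -> R) c :
  (M h)%:R^-1 * \sum_(t < M h) f t <= c -> exists2 t, (t < M h)%N & f t <= c.
Proof.
move=> le_c; apply: contrapT => no.
have lt_f t : (t < M h)%N -> c < f t.
  by move=> tM; rewrite ltNge; apply/negP => ftc; apply: no; exists t.
have : \sum_(t < M h) c < \sum_(t < M h) f t.
  apply: ltr_sum => [|t _]; last exact: lt_f.
  by apply/hasP; exists (Ordinal (M_gt0 h)); rewrite ?mem_index_enum.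
rewrite ltNge sumr_const card_ord -[c *+ _]mulr_natl -ler_pdivrMl //.
by rewrite le_c.
Qed.

Lemma avg_fiber_sum k h v F w X :
  (forall u, \sum_(t < M v) F (upd u v t) <= X) -> (v < h)%N ->
  \sum_(t < M v) avg k h F (upd w v t) <= X.
Proof.
move=> leX; elim: k h w => [|k IH] h w lt_vh /=; first exact: leX.
rewrite -mulr_sumr exchange_big /=.
under eq_bigr => s _ do under eq_bigr => t _ do rewrite updC ?ltn_eqF //.
apply: (mean_le (f := fun s => \sum_(t < M v) avg k h.+1 F (upd (upd w h s) v t))).
by move=> s _; apply: IH; apply: ltnW.
Qed.

Lemma avg_fiber k h v F w X :
  (forall u, \sum_(t < M v) F (upd u v t) <= X) -> (h <= v < h + k)%N ->
  avg k h F w <= (M v)%:R^-1 * X.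
Proof.
move=> leX; elim: k h w => [|k IH] h w /andP[le_hv lt_v].
  by rewrite addn0 ltnNge le_hv in lt_v.
move: le_hv; rewrite leq_eqVlt => /predU1P[->|lt_hv] /=.
  by rewrite ler_wpM2l ?invr_ge0 // avg_fiber_sum.
apply: (mean_le (f := fun t => avg k h.+1 F (upd w h t))) => t _.
by apply: IH; rewrite lt_hv addSnnS.
Qed.

Lemma avg_sum k h w (I : Type) (r : seq I) (G : I -> (nat -> nat) -> R) :
  avg k h (fun u => \sum_(i <- r) G i u) w = \sum_(i <- r) avg k h (G i) w.
Proof.
elim: k h w => [//|k IH] h w /=.
by under eq_bigr => t _ do rewrite IH; rewrite exchange_big -mulr_sumr.
Qed.

Variables (F : nat -> (nat -> nat) -> R) (c : R).
Hypothesis F_ge0 : forall D w, 0 <= F D w.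
Hypothesis F_dep : forall D w w', (forall i, (i <= D)%N -> w i = w' i) ->
  F D w = F D w'.

(** Expectation of the sum of the first [N] functions, conditional on the coordinates below [h]. *)
Let pot N h w := \sum_(D < N) avg (D.+1 - h) h (F D) w.

Lemma avg_ge0 k h D w : 0 <= avg k h (F D) w.
Proof.
elim: k h w => [|k IH] h w /=; first exact: F_ge0.
by rewrite mulr_ge0 ?invr_ge0 // sumr_ge0.
Qed.

Lemma mean_pot N h w :
  (M h)%:R^-1 * \sum_(t < M h) pot N h.+1 (upd w h t) = pot N h w.
Proof.
rewrite /pot exchange_big /= mulr_sumr; apply: eq_bigr => D _.
have [le_hD|lt_Dh] := leqP h D.
  by rewrite subSS subSn.
have [e1 e2] : (D.+1 - h = 0)%N /\ (D.+1 - h.+1 = 0)%N.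
  by split; apply/eqP; rewrite subn_eq0 // ltnW.
rewrite e1 e2 /=.
rewrite (eq_bigr (fun=> F D w)) => [|t _].
  by rewrite sumr_const card_ord -[F D w *+ _]mulr_natl mulKf ?gt_eqF.
apply: F_dep => i le_iD; rewrite /upd ifN // neq_ltn.
by rewrite (leq_ltn_trans le_iD).
Qed.

Lemma pot_mono N N' h w : (N <= N')%N -> pot N h w <= pot N' h w.
Proof.
move=> le_N; rewrite /pot (big_ord_widen _ (fun D => avg (D.+1 - h) h (F D) w) le_N).
by rewrite [leRHS](bigID (fun D : 'I_N' => (D < N)%N)) /= lerDl sumr_ge0 // => D _; apply: avg_ge0.
Qed.

(** One [t] must serve all [N]. If each of the finitely many [t] failed at some [N], all would fail
    at the largest of these, since [pot] increases with [N]; this contradicts the mean over [t]. *)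
Lemma pot_step h w : (forall N, pot N h w <= c) ->
  exists2 t, (t < M h)%N & forall N, pot N h.+1 (upd w h t) <= c.
Proof.
move=> le_c; apply: contrapT => no.
have bad t : exists N, (t < M h)%N -> c < pot N h.+1 (upd w h t).
  apply: contrapT => nN; apply: no; exists t => [|N].
    by apply/negP => /negP tM; apply: nN; exists 0%N => tM'; rewrite tM' in tM.
  by rewrite leNgt; apply/negP => ltc; apply: nN; exists N.
have [Nf NfP] := boolp.choice bad.
have [] := @mean_exists_le h (fun t => pot (\max_(s < M h) Nf s) h.+1 (upd w h t)) c.
  by rewrite mean_pot.
move=> t tM; apply/negP; rewrite -ltNge (lt_le_trans (NfP t tM)) //.
apply: pot_mono; exact: (leq_bigmax (F := fun s : 'I_(M h) => Nf s) (Ordinal tM)).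
Qed.

(** Method of conditional expectations: coordinates are fixed one at a time while the potential
    stays at most [c]. Once the finitely many coordinates relevant to [F D] are fixed, [F D] occurs
    unaveraged in the potential. *)
Lemma avoid_bad_events : (forall N, \sum_(D < N) avg D.+1 0 (F D) (fun=> 0%N) <= c) ->
  exists2 w, (forall i, (w i < M i)%N) & forall D, F D w <= c.
Proof.
move=> le_c.
have [g gP] : exists g : nat -> (nat -> nat) -> nat, forall h w,
    (forall N, pot N h w <= c) ->
    (g h w < M h)%N /\ forall N, pot N h.+1 (upd w h (g h w)) <= c.
  have H (p : nat * (nat -> nat)) : exists t, (forall N, pot N p.1 p.2 <= c) ->
      (t < M p.1)%N /\ forall N, pot N p.1.+1 (upd p.2 p.1 t) <= c.
    have [ok|no] := pselect (forall N, pot N p.1 p.2 <= c).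
      by have [t] := pot_step ok; exists t.
    by exists 0%N => ok; case: no.
  have [g gP] := boolp.choice H.
  by exists (fun h w => g (h, w)) => h w; apply: (gP (h, w)).
pose W := fix W h := if h is h'.+1 then upd (W h') h' (g h' (W h')) else fun=> 0%N.
have WP h N : pot N h (W h) <= c.
  elim: h N => [|h IH] N; last by have [_] := gP h (W h) IH.
  by rewrite /pot; under eq_bigr => D _ do rewrite subn0.
pose w i := W i.+1 i.
have wE h i : (i < h)%N -> W h i = w i.
  elim: h => [//|h IH]; rewrite ltnS leq_eqVlt => /predU1P[-> //|lt_ih].
  by rewrite /= /upd ltn_eqF // IH.
exists w => [i|D].
  by rewrite /w /= /upd eqxx; have [] := gP i (W i) (WP i).
have := WP D.+1 D.+1; rewrite /pot big_ord_recr /= subnn /=.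
rewrite (@F_dep D _ w) => [|i le_iD]; last exact: (wE D.+1).
by apply: le_trans; rewrite lerDr sumr_ge0 // => i _; apply: avg_ge0.
Qed.

End Selection.

(** Union bound in which [Bad D d] is estimated by the randomness of coordinate [d] alone, the
    others being frozen. The number of bad [d] for a given [D] is an integer at most c < 1, hence
    0. *)
Lemma selection (R : realFieldType) (M : nat -> nat) (I : nat -> seq nat)
    (Bad : nat -> nat -> (nat -> nat) -> bool) (X : nat -> nat) (c : R) :
  (forall i, (0 < M i)%N) -> (forall D d, d \in I D -> (d <= D)%N) ->
  (forall D d w w', (forall i, (i <= D)%N -> w i = w' i) -> Bad D d w = Bad D d w') ->
  (forall D d w, d \in I D -> (\sum_(t < M d) Bad D d (upd w d t) <= X D)%N) ->
  (forall N, \sum_(D < N) \sum_(d <- I D) (X D)%:R / (M d)%:R <= c) -> c < 1 ->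
  exists2 w, (forall i, (w i < M i)%N) & forall D d, d \in I D -> ~~ Bad D d w.
Proof.
move=> M_gt0 ID depB fibB sum_c c1.
pose G D d w : R := (Bad D d w)%:R.
pose F D w : R := \sum_(d <- I D) G D d w.
have F0 D w : 0 <= F D w by rewrite sumr_ge0.
have Fdep D w w' : (forall i, (i <= D)%N -> w i = w' i) -> F D w = F D w'.
  by move=> e; apply: eq_bigr => d _; rewrite /G (depB D d w w').
have sumF N : \sum_(D < N) avg M D.+1 0 (F D) (fun=> 0%N) <= c.
  apply: le_trans (sum_c N); apply: ler_sum => D _; rewrite /F avg_sum.
  rewrite !big_seq; apply: ler_sum => d dI; rewrite mulrC.
  apply: avg_fiber => [//|u|]; first by rewrite /G -natr_sum ler_nat fibB.
  by rewrite /= add0n ltnS ID.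
have [w wM wF] := avoid_bad_events M_gt0 F0 Fdep sumF.
exists w => // D d dI; apply/negP => bad.
have := le_lt_trans (wF D) c1; rewrite ltNge /F (big_rem d) //= /G bad.
by rewrite lerDl sumr_ge0.
Qed.

(** * Power series *)

Section FpsTheory.
Variables (K : fieldType) (n : nat).
Implicit Types (f g : fps K n) (m k : 'X_{1..n}) (i : 'I_n) (d e : nat).

Lemma fpsDE f g m : (f + g) m = f m + g m. Proof. by []. Qed.
Lemma fpsNE f m : (- f) m = - f m. Proof. by []. Qed.
Lemma fps0E m : (0 : fps K n) m = 0. Proof. by []. Qed.
Lemma fpsZE c f m : (c *: f) m = c * f m. Proof. by []. Qed.
Lemma fps1E m : (1 : fps K n) m = (m == 0%MM)%:R. Proof. by []. Qed.

Lemma fps_sumE I (r : seq I) (P : pred I) (F : I -> fps K n) m :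
  (\sum_(i <- r | P i) F i) m = \sum_(i <- r | P i) F i m.
Proof. by elim/big_rec2: _ => // i x y _ <-. Qed.

Lemma fps_mul_trunc (P Q : {mpoly K[n]}) f g d m : (mdeg m < d)%N ->
  (forall k, (mdeg k < d)%N -> P@_k = f k) ->
  (forall k, (mdeg k < d)%N -> Q@_k = g k) -> (f * g) m = (P * Q)@_m.
Proof.
move=> lt_md eqP eqQ; rewrite mcoeffM; apply: eq_bigr => k _.
by rewrite eqP ?eqQ //; apply: leq_trans (bmdeg _) _.
Qed.

Lemma fps_mulE f g d m : (mdeg m < d)%N ->
  (f * g) m = \sum_(k : 'X_{1..n < d} | (k <= m)%MM) f k * g (m - k)%MM.
Proof.
move=> lt_md.
pose P : {mpoly K[n]} := \sum_(k : 'X_{1..n < d}) f k *: 'X_[k].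
pose Q : {mpoly K[n]} := \sum_(k : 'X_{1..n < d}) g k *: 'X_[k].
rewrite (@fps_mul_trunc P Q _ _ d) // => [|k|k]; try exact: mcoeff_mpoly.
rewrite [LHS](mcoeff_poly_mul_lin _ _ lt_md); apply: eq_bigr => k _.
by rewrite !mcoeff_mpoly ?bmdeg // (leq_ltn_trans (mdegB _ _)).
Qed.

Lemma fps_derivM i f g :
  fps_deriv i (f * g) = fps_deriv i f * g + f * fps_deriv i g.
Proof.
apply/funext => m; rewrite fpsDE /fps_deriv; pose d := (mdeg m).+2.
pose P : {mpoly K[n]} := \sum_(k : 'X_{1..n < d}) f k *: 'X_[k].
pose Q : {mpoly K[n]} := \sum_(k : 'X_{1..n < d}) g k *: 'X_[k].
have PE k : (mdeg k < d)%N -> P@_k = f k by apply: mcoeff_mpoly.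
have QE k : (mdeg k < d)%N -> Q@_k = g k by apply: mcoeff_mpoly.
have dE (h : fps K n) (T : {mpoly K[n]}) :
    (forall k, (mdeg k < d)%N -> T@_k = h k) ->
  forall k, (mdeg k < d.-1)%N -> T^`M(i)@_k = fps_deriv i h k.
  by move=> eT k lt_k; rewrite mcoeff_deriv eT // mdegD mdeg1 addn1.
rewrite (@fps_mul_trunc P Q _ _ d) // ?mdegD ?mdeg1 ?addn1 //.
have dec (h : fps K n) (T : {mpoly K[n]}) :
    (forall k, (mdeg k < d)%N -> T@_k = h k) ->
  forall k, (mdeg k < d.-1)%N -> T@_k = h k.
  by move=> eT k lt_k; apply: eT; rewrite (leq_trans lt_k) // leq_pred.
rewrite (@fps_mul_trunc _ _ _ _ d.-1 m (ltnSn _) (dE _ _ PE) (dec _ _ QE)).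
rewrite (@fps_mul_trunc _ _ _ _ d.-1 m (ltnSn _) (dec _ _ PE) (dE _ _ QE)).
by rewrite -mcoeff_deriv mderivM mcoeffD.
Qed.

Lemma fps_derivD i f g : fps_deriv i (f + g) = fps_deriv i f + fps_deriv i g.
Proof. by apply/funext => m; rewrite fpsDE /fps_deriv fpsDE mulrnDl. Qed.

Lemma fps_derivZ i c f : fps_deriv i (c *: f) = c *: fps_deriv i f.
Proof. by apply/funext => m; rewrite fpsZE /fps_deriv fpsZE mulrnAr. Qed.

Lemma fps_deriv1 i : fps_deriv i (1 : fps K n) = 0.
Proof.
apply/funext => m; rewrite /fps_deriv fps1E -mdeg_eq0 mdegD mdeg1 addn1.
by rewrite mul0rn.
Qed.

Definition ordge d f := forall m, (mdeg m < d)%N -> f m = 0.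

Lemma ordge0 f : ordge 0 f. Proof. by []. Qed.

Lemma ordgeS d e f : (d <= e)%N -> ordge e f -> ordge d f.
Proof. by move=> le_de fO m lt_m; apply: fO; apply: leq_trans le_de. Qed.

Lemma ordgeZ d c f : ordge d f -> ordge d (c *: f).
Proof. by move=> fO m lt_m; rewrite fpsZE fO // mulr0. Qed.

Lemma ordge_sum d I (r : seq I) (P : pred I) (F : I -> fps K n) :
  (forall i : I, P i -> ordge d (F i)) -> ordge d (\sum_(i <- r | P i) F i).
Proof. by move=> FO m lt_m; rewrite fps_sumE big1 // => i Pi; apply: FO. Qed.

Lemma ordgeM d e f g : ordge d f -> ordge e g -> ordge (d + e) (f * g).
Proof.
move=> fO gO m lt_m; rewrite (fps_mulE f g (ltnSn _)) big1 // => k le_km.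
have [lt_kd|le_dk] := ltnP (mdeg k) d; first by rewrite fO // mul0r.
rewrite gO ?mulr0 //; have := congr1 mdeg (submK le_km); rewrite mdegD; lia.
Qed.

Lemma ordge_var i : ordge 1 (fps_var K i).
Proof.
move=> m; rewrite ltnS leqn0 mdeg_eq0 => /eqP ->; rewrite /fps_var.
by case: eqP => // /(congr1 (@mdeg n)); rewrite mdeg0 mdeg1.
Qed.

Lemma fps_varM i f m :
  (fps_var K i * f) m = if m i == 0%N then 0 else f (m - U_(i))%MM.
Proof.
rewrite (fps_mulE _ _ (ltnSn _)); case: ifP => [/eqP mi0|mi].
  rewrite big1 // => k le_km; rewrite /fps_var; case: eqP => [e|]; rewrite ?mul0r //.
  by move: le_km; rewrite e lep1mP mi0.
have le_Um : (U_(i) <= m)%MM by rewrite lep1mP mi.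
have lt1 : (mdeg (U_(i) : 'X_{1..n}) < (mdeg m).+1)%N.
  by have := congr1 mdeg (submK le_Um); rewrite mdegD => <-; rewrite ltnS leq_addl.
rewrite (bigD1 (BMultinom lt1)) //= /fps_var eqxx mul1r big1 ?addr0 //.
move=> k /andP[_ ne_k]; case: eqP => [e|]; last by rewrite mul0r.
by move: ne_k; rewrite bmeqP /= e eqxx.
Qed.

(** Each monomial is assigned to a single variable dividing it. *)
Lemma ordge_decomp d f : ordge d.+1 f ->
  exists2 g : 'I_n -> fps K n, f = \sum_i fps_var K i * g i &
    forall i, ordge d (g i).
Proof.
move=> fO; pose first m := [pick i | m i != 0%N].
exists (fun i m => if first (m + U_(i))%MM == Some i then f (m + U_(i))%MM else 0).
  apply/funext => m; rewrite fps_sumE.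
  case E: (first m) => [i|]; last first.
    have m0 : m = 0%MM.
      apply/mnmP => i; rewrite mnm0E; move: E; rewrite /first.
      by case: pickP => // /(_ i) /negbFE/eqP.
    rewrite fO ?m0 ?mdeg0 // big1 // => i _.
    by rewrite fps_varM mnm0E eqxx.
  have mi : m i != 0%N by move: E; rewrite /first; case: pickP => // j mj [<-].
  have e : (m - U_(i) + U_(i))%MM = m by rewrite submK // lep1mP.
  rewrite (bigD1 i) //= big1 ?addr0 => [|j ne_ji]; rewrite fps_varM.
    by rewrite (negPf mi) e E eqxx.
  case: ifP => // mj; rewrite submK ?lep1mP ?mj // E.
  by case: eqP => // -[e']; rewrite e' eqxx in ne_ji.
move=> i m lt_m; case: ifP => // _; apply: fO.
by rewrite mdegD mdeg1 addn1.
Qed.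

Lemma in_xP f : in_x f <-> ordge 1 f.
Proof.
split=> [[g ->]|/ordge_decomp[g -> _]]; last by exists g.
apply: ordge_sum => i _; rewrite -[1%N]addn0.
by apply: ordgeM (@ordge_var i) _; apply: ordge0.
Qed.

Lemma in_x2_ordge f : in_x2 f -> ordge 2 f.
Proof.
case=> g ->; apply: ordge_sum => i _; apply: ordge_sum => j _.
rewrite -[2%N]addn0; apply: ordgeM; last exact: ordge0.
by rewrite -[2%N]/(1 + 1)%N; apply: ordgeM; apply: ordge_var.
Qed.

Definition fpsX m : fps K n := fun k => (k == m)%:R.

Lemma fpsX0 : fpsX 0%MM = 1. Proof. by []. Qed.

Lemma fpsXU i m : fpsX (U_(i) + m)%MM = fps_var K i * fpsX m.
Proof.
apply/funext => k; rewrite fps_varM /fpsX; case: ifP => [/eqP ki|ki].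
  case: eqP => // e; move: ki; rewrite e mnmDE mnm1E eqxx.
  by [].
congr _%:R; congr (nat_of_bool _); have le_Uk : (U_(i) <= k)%MM by rewrite lep1mP ki.
by rewrite -{1}(submK le_Uk) [(_ + U_(_))%MM]addmC eqm_add2l.
Qed.

Lemma fps_truncE d f : exists2 r, ordge d r &
  f = \sum_(m : 'X_{1..n < d}) f m *: fpsX m + r.
Proof.
exists (fun m => if (mdeg m < d)%N then 0 else f m) => [m -> //|].
apply/funext => m; rewrite fpsDE fps_sumE; case: ifP => lt_m.
  rewrite addr0 (bigD1 (BMultinom lt_m)) //= fpsZE /fpsX eqxx mulr1 big1 ?addr0 //.
  move=> k ne_k; rewrite fpsZE /fpsX; case: eqP => [e|]; last by rewrite mulr0.
  by case/eqP: ne_k; apply/eqP; rewrite bmeqP /= e.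
rewrite big1 ?add0r // => k _; rewrite fpsZE /fpsX; case: eqP => [e|]; rewrite ?mulr0 //.
by move: lt_m; rewrite e bmdeg.
Qed.

End FpsTheory.

Section DegreeNorm.
Variables (R : realType) (K : fieldType) (nrm : K -> R).
Hypothesis nrmP : nontrivial_norm nrm.
Variable n : nat.
Implicit Types (f g : fps K n) (d e : nat).

Lemma degree_norm_ge0 f d : 0 <= degree_norm nrm f d.
Proof. by rewrite sumr_ge0 // => m _; apply: nrm_ge0. Qed.

Lemma degree_normE f d D : (d < D)%N ->
  degree_norm nrm f d = \sum_(m : 'X_{1..n < D} | mdeg m == d) nrm (f m).
Proof.
move=> lt_dD; rewrite /degree_norm.
have H (m : 'X_{1..n < D}) : mdeg m = d -> (mdeg m < d.+1)%N by move=> ->.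
pose h (m : 'X_{1..n < d.+1}) : 'X_{1..n < D} :=
  BMultinom (leq_trans (bmdeg m) lt_dD).
pose h' (m : 'X_{1..n < D}) : 'X_{1..n < d.+1} := insubd bm0 (val m).
have valh' (m : 'X_{1..n < D}) : mdeg m = d -> val (h' m) = val m.
  by move=> e; rewrite /h' val_insubd e ltnSn.
rewrite [RHS](reindex_onto h h') /= => [|m /eqP e]; last first.
  by apply: val_inj; rewrite /= valh'.
apply: eq_bigl => m; case: eqP => //= e; apply/esym/eqP/val_inj.
by rewrite /= valh'.
Qed.

Lemma degree_norm_coef f (m : 'X_{1..n}) : nrm (f m) <= degree_norm nrm f (mdeg m).
Proof.
rewrite /degree_norm (bigD1 (BMultinom (ltnSn (mdeg m)))) //= lerDl.
by rewrite sumr_ge0 // => k _; apply: nrm_ge0.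
Qed.

Lemma degree_norm0P f d : degree_norm nrm f d = 0 <->
  forall m, mdeg m = d -> f m = 0.
Proof.
split=> [/eqP f0 m e|f0].
  apply/eqP; rewrite -(nrm_eq0 nrmP) eq_le nrm_ge0 // andbT.
  by rewrite -(eqP f0) -e degree_norm_coef.
by rewrite /degree_norm big1 // => m /eqP e; rewrite f0 // nrm0.
Qed.

Lemma degree_norm_ordge f d : ordge d f <->
  forall e, (e < d)%N -> degree_norm nrm f e = 0.
Proof.
split=> [fO e lt_ed|f0 m lt_m].
  by apply/degree_norm0P => m em; apply: fO; rewrite em.
by move/degree_norm0P: (f0 _ lt_m); apply.
Qed.

Lemma degree_normD f g d :
  degree_norm nrm (f + g) d <= degree_norm nrm f d + degree_norm nrm g d.
Proof. by rewrite -big_split ler_sum // => m _; apply: (nrmD nrmP (f m) (g m)). Qed.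

Lemma degree_normZ c f d :
  degree_norm nrm (c *: f) d = nrm c * degree_norm nrm f d.
Proof. by rewrite mulr_sumr; apply: eq_bigr => m _; rewrite fpsZE nrmM. Qed.

Lemma degree_norm_sum I (r : seq I) (P : pred I) (F : I -> fps K n) d :
  degree_norm nrm (\sum_(i <- r | P i) F i) d <=
  \sum_(i <- r | P i) degree_norm nrm (F i) d.
Proof.
elim/big_rec2: _ => [|i x y _ le_xy].
  by rewrite (_ : degree_norm _ _ _ = 0) //; apply/degree_norm0P.
by rewrite (le_trans (degree_normD _ _ _)) // lerD2l.
Qed.

Lemma degree_normM f g d : degree_norm nrm (f * g) d <=
  \sum_(i < d.+1) degree_norm nrm f i * degree_norm nrm g (d - i).
Proof.
pose T := 'X_{1..n < d.+1}.
pose Ng (k : T) := degree_norm nrm g (d - mdeg k).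
apply: (@le_trans _ _ (\sum_(m : T | mdeg m == d) \sum_(k : T | (k <= m)%MM)
   nrm (f k) * nrm (g (m - k)%MM))).
  apply: ler_sum => m _; rewrite (fps_mulE f g (bmdeg m)).
  apply: le_trans (nrm_sum nrmP _ _ _) _.
  by apply: ler_sum => k _; rewrite nrmM.
rewrite (exchange_big_dep xpredT) //=.
apply: (@le_trans _ _ (\sum_(k : T) nrm (f k) * Ng k)).
  apply: ler_sum => k _; rewrite -mulr_sumr ler_wpM2l ?nrm_ge0 //.
  have lt_d (m : 'X_{1..n}) : (mdeg m < d.+1)%N -> (mdeg (m - k) < d.+1)%N.
    exact/leq_ltn_trans/mdegB.
  rewrite /Ng (@degree_normE _ _ d.+1) ?ltnS ?leq_subr //.
  pose h (l : T) : T := insubd bm0 (l + k)%MM.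
  pose h' (m : T) : T := BMultinom (lt_d m (bmdeg m)).
  rewrite [leLHS](reindex_onto h h') /= => [|m /andP[/eqP em le_km]]; last first.
    by apply: val_inj; rewrite /h val_insubd /= submK // em ltnSn.
  rewrite [leLHS]big_mkcond [leRHS]big_mkcond /=; apply: ler_sum => l _.
  case: ifP => [/andP[/andP[em le_k] /eqP e]|_]; last first.
    by case: ifP => // _; apply: nrm_ge0.
  have el : val l = (h l - k)%MM by rewrite -{1}e.
  rewrite -el; suff -> : mdeg l == (d - mdeg k)%N by [].
  have := congr1 mdeg (submK le_k); rewrite mdegD -el (eqP em) => e'.
  by rewrite -(eqn_add2r (mdeg k)) e' subnK // -ltnS bmdeg.
rewrite (partition_big (fun k : T => Ordinal (bmdeg k)) xpredT) //=.
apply: ler_sum => i _; rewrite (@degree_normE f i d.+1) // mulr_suml.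
rewrite le_eqVlt; apply/orP; left; apply/eqP.
apply: eq_big => [k|k /eqP <- //]; by rewrite -val_eqE.
Qed.

End DegreeNorm.

(** * Power series in one variable *)

(** Course-of-values recursion: [phi u D] sees only the terms of [u] before [D]. *)
Lemma causal_fixpoint (T : Type) (x0 : T) (phi : (nat -> T) -> nat -> T) :
  (forall u v D, (forall i, (i < D)%N -> u i = v i) -> phi u D = phi v D) ->
  exists u, forall D, u D = phi u D.
Proof.
move=> causal.
pose W := fix W k : nat -> T := if k is k'.+1 then phi (W k') else fun=> x0.
have WE D k l : (D < k)%N -> (D < l)%N -> W k D = W l D.
  elim/ltn_ind: D k l => D IH [//|k] [//|l] ltDk ltDl /=.
  by apply: causal => i lt_iD; apply: IH => //; apply: leq_trans lt_iD _.
exists (fun D => W D.+1 D) => D /=.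
by apply: causal => i lt_iD; apply: (WE i D i.+1).
Qed.

Section OneVariable.
Variable K : fieldType.
Implicit Types (f g : fps K 1) (c : nat -> K) (D i j : nat).

Definition mono1 D : 'X_{1..1} := (U_(ord0) *+ D)%MM.
Definition cf f D : K := f (mono1 D).
Definition ser c : fps K 1 := fun m => c (m ord0).

Lemma mono1E D : mono1 D ord0 = D.
Proof. by rewrite mulmnE mnm1E eqxx mul1n. Qed.

Lemma mono1K (m : 'X_{1..1}) : mono1 (m ord0) = m.
Proof. by apply/mnmP => i; rewrite (ord1 i) mono1E. Qed.

Lemma mdeg1E (m : 'X_{1..1}) : mdeg m = m ord0.
Proof. by rewrite mdegE big_ord1. Qed.

Lemma mdeg_mono1 D : mdeg (mono1 D) = D.
Proof. by rewrite mdeg1E mono1E. Qed.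

Lemma cf_ser c D : cf (ser c) D = c D.
Proof. by rewrite /cf /ser mono1E. Qed.

Lemma cf_inj f g : (forall D, cf f D = cf g D) -> f = g.
Proof. by move=> e; apply/funext => m; rewrite -(mono1K m); apply: e. Qed.

Lemma serK f : ser (cf f) = f.
Proof. by apply: cf_inj => D; rewrite cf_ser. Qed.

Lemma cfD f g D : cf (f + g) D = cf f D + cf g D. Proof. by []. Qed.
Lemma cfN f D : cf (- f) D = - cf f D. Proof. by []. Qed.
Lemma cfB f g D : cf (f - g) D = cf f D - cf g D. Proof. by []. Qed.
Lemma cf0 D : cf 0 D = 0. Proof. by []. Qed.
Lemma cfZ a f D : cf (a *: f) D = a * cf f D. Proof. by []. Qed.

Lemma cf1 D : cf 1 D = (D == 0)%:R.
Proof. by rewrite /cf fps1E -mdeg_eq0 mdeg_mono1. Qed.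

Lemma cf_sum I (r : seq I) (P : pred I) (F : I -> fps K 1) D :
  cf (\sum_(i <- r | P i) F i) D = \sum_(i <- r | P i) cf (F i) D.
Proof. exact: fps_sumE. Qed.

Lemma cfM f g D : cf (f * g) D = \sum_(i < D.+1) cf f i * cf g (D - i).
Proof.
have lt_D : (mdeg (mono1 D) < D.+1)%N by rewrite mdeg_mono1.
rewrite /cf (fps_mulE f g lt_D).
have bnd (i : 'I_D.+1) : (mdeg (mono1 i) < D.+1)%N by rewrite mdeg_mono1.
have bnd' (m : 'X_{1..1 < D.+1}) : (m ord0 < D.+1)%N by rewrite -mdeg1E bmdeg.
rewrite (reindex_onto (fun i : 'I_D.+1 => BMultinom (bnd i))
  (fun m => Ordinal (bnd' m))) /=.
  apply: eq_big => [i|i _].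
    rewrite -val_eqE /= mono1E eqxx andbT; apply/mnm_lepP => j.
    by rewrite (ord1 j) !mono1E -ltnS.
  congr (_ * g _); apply/mnmP => j.
  by rewrite (ord1 j) mnmBE !mono1E.
by move=> m _; apply: val_inj; rewrite /= mono1K.
Qed.

Lemma cf0M f g : cf (f * g) 0 = cf f 0 * cf g 0.
Proof. by rewrite cfM big_ord1. Qed.

Lemma ordge1P f D : ordge D f <-> forall i, (i < D)%N -> cf f i = 0.
Proof.
split=> [fO i lt_i|f0 m lt_m]; first by apply: fO; rewrite mdeg_mono1.
by rewrite -(mono1K m); apply: f0; rewrite -mdeg1E.
Qed.

Lemma ordge_exp f d j : ordge d f -> ordge (d * j) (f ^+ j).
Proof.
move=> fO; elim: j => [|j IH]; first by rewrite muln0; apply: ordge0.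
by rewrite exprS mulnS; apply: ordgeM.
Qed.

Lemma cf_exp_small f D j : cf f 0 = 0 -> (D < j)%N -> cf (f ^+ j) D = 0.
Proof.
move=> f0 ltDj; have fO : ordge 1 f by apply/ordge1P => -[].
have /ordge1P := @ordge_exp f 1 j fO; apply; by rewrite mul1n.
Qed.

Lemma cf_exp_diag f D : cf f 0 = 0 -> cf (f ^+ D) D = cf f 1 ^+ D.
Proof.
move=> f0; elim: D => [|D IH]; first by rewrite !expr0 cf1.
rewrite exprS cfM (bigD1 (Ordinal (isT : (1 < D.+2)%N))) //= subSS subn0 IH.
rewrite exprS big1 ?addr0 // => i ne_i.
have [i0|i0] := posnP i; first by rewrite i0 f0 mul0r.
rewrite [X in _ * X]cf_exp_small ?mulr0 //.
have : (i : nat) != 1%N by rewrite -(inj_eq val_inj) in ne_i.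
by move: (ltn_ord i) i0; lia.
Qed.

(** f^j - g^j is f - g times a form of positive degree in [f] and [g], which raises the order. So
    the nonlinear terms of an equation for [f] involve only earlier coefficients. *)
Lemma cf_exp_trunc f g D j : cf f 0 = 0 -> cf g 0 = 0 -> (1 < j)%N ->
  (forall i, (i < D)%N -> cf f i = cf g i) -> cf (f ^+ j) D = cf (g ^+ j) D.
Proof.
move=> f0 g0 j1 e; apply/eqP; rewrite -subr_eq0 -cfB subrXX; apply/eqP.
have fO : ordge 1 f by apply/ordge1P => -[].
have gO : ordge 1 g by apply/ordge1P => -[].
have fgO : ordge D (f - g) by apply/ordge1P => i ltiD; rewrite cfB e // subrr.
suff sO : ordge 1 (\sum_(i < j) f ^+ (j.-1 - i) * g ^+ i).
  by have /ordge1P := ordgeM fgO sO; apply; rewrite addn1.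
apply: ordge_sum => i _; apply: (@ordgeS _ _ _ (1 * (j.-1 - i) + 1 * i)).
  by have := ltn_ord i; lia.
by apply: ordgeM; apply: ordge_exp.
Qed.

Lemma prod_ord2 (V : comPzSemiRingType) (F : 'I_2 -> V) :
  \prod_(i < 2) F i = F ord0 * F ord_max.
Proof. by rewrite !big_ord_recl big_ord0 mulr1; congr (_ * F _); apply/val_inj. Qed.

Lemma mdeg2E (m : 'X_{1..2}) : mdeg m = (m ord0 + m ord_max)%N.
Proof. by rewrite mdegE !big_ord_recl big_ord0 addn0; congr (_ + m _)%N; apply/val_inj. Qed.

Lemma sum_mnm2 (V : nmodType) D (G : nat -> nat -> V) :
  \sum_(m : 'X_{1..2 < D.+1}) G (m ord0) (m ord_max) =
  \sum_(i < D.+1) \sum_(j < D.+1 | (i + j <= D)%N) G i j.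
Proof.
rewrite pair_big_dep /=.
have b0 (m : 'X_{1..2 < D.+1}) : (m ord0 < D.+1)%N.
  by rewrite (leq_ltn_trans _ (bmdeg m)) // mdeg2E leq_addr.
have b1 (m : 'X_{1..2 < D.+1}) : (m ord_max < D.+1)%N.
  by rewrite (leq_ltn_trans _ (bmdeg m)) // mdeg2E leq_addl.
pose h' (m : 'X_{1..2 < D.+1}) := (Ordinal (b0 m), Ordinal (b1 m)).
pose h (p : 'I_D.+1 * 'I_D.+1) : 'X_{1..2 < D.+1} :=
  insubd bm0 (U_(ord0) *+ p.1 + U_(ord_max) *+ p.2)%MM.
have valh (p : 'I_D.+1 * 'I_D.+1) : (p.1 + p.2 <= D)%N ->
    val (h p) = (U_(ord0) *+ p.1 + U_(ord_max) *+ p.2)%MM.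
  by move=> le_D; rewrite val_insubd mdegD !mdegMn !mdeg1 !mul1n ltnS le_D.
rewrite [RHS](reindex_onto h' h) /=; last first.
  case=> i j le_D; have e := valh (i, j) le_D.
  congr pair; apply: val_inj; rewrite /= [bmnm _]e mnmDE !mulmnE !mnm1E /=.
    by rewrite mul1n mul0n addn0.
  by rewrite mul1n mul0n.
apply: eq_bigl => m; have le_D : (m ord0 + m ord_max <= D)%N.
  by rewrite -mdeg2E -ltnS bmdeg.
rewrite le_D /=; apply/esym/eqP/val_inj; rewrite valh //=.
apply/mnmP => i; rewrite mnmDE !mulmnE !mnm1E.
have [->|->] : i = ord0 \/ i = ord_max.
  by case: i => -[|[|//]] lt_i; [left|right]; apply: val_inj.
- by rewrite /= mul1n mul0n addn0.
- by rewrite /= mul1n mul0n.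
Qed.

Lemma cf_varXM f i D :
  cf (fps_var K ord0 ^+ i * f) D = if (i <= D)%N then cf f (D - i) else 0.
Proof.
elim: i D => [|i IH] D; first by rewrite expr0 mul1r subn0.
rewrite exprS -mulrA /cf fps_varM mono1E; case: D => [//|D] /=.
have -> : (mono1 D.+1 - U_(ord0))%MM = mono1 D.
  by apply/mnmP => j; rewrite mnmBE (ord1 j) !mono1E mnm1E subn1.
by rewrite -/(cf _ D) IH subSS.
Qed.

Definition theta f : fps K 1 := ser (fun D => D%:R * cf f D).

Lemma cf_theta f D : cf (theta f) D = D%:R * cf f D.
Proof. exact: cf_ser. Qed.

Lemma thetaM f g : theta (f * g) = theta f * g + f * theta g.
Proof.
apply: cf_inj => D; rewrite cf_theta cfD !cfM -big_split mulr_sumr /=.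
apply: eq_bigr => i _; rewrite !cf_theta.
have -> : D%:R = i%:R + (D - i)%:R :> K by rewrite -natrD subnKC // -ltnS.
by ring.
Qed.

Lemma thetaD f g : theta (f + g) = theta f + theta g.
Proof. by apply: cf_inj => D; rewrite cfD !cf_theta cfD mulrDr. Qed.

Lemma thetaZ a f : theta (a *: f) = a *: theta f.
Proof. by apply: cf_inj => D; rewrite cfZ !cf_theta cfZ mulrCA. Qed.

Lemma theta_sum I (r : seq I) (P : pred I) (F : I -> fps K 1) :
  theta (\sum_(i <- r | P i) F i) = \sum_(i <- r | P i) theta (F i).
Proof.
elim/big_rec2: _ => [|i x y _ <-]; last by rewrite thetaD.
by apply: cf_inj => D; rewrite cf_theta cf0 mulr0.
Qed.

Lemma theta1 : theta 1 = 0.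
Proof. by apply: cf_inj => D; rewrite cf_theta cf1 cf0; case: D => [|D]; rewrite ?mul0r ?mulr0. Qed.

Lemma thetaX f j : theta (f ^+ j.+1) = (f ^+ j * theta f) *+ j.+1.
Proof.
elim: j => [|j IH]; first by rewrite expr1 expr0 mul1r mulr1n.
by rewrite exprS thetaM IH mulrnAr mulrA -exprS [X in X + _]mulrC -mulrS.
Qed.

End OneVariable.

(** * Exponential and logarithm in one variable *)

Section Exponential.
Variable K : fieldType.
Hypothesis K_char0 : [pchar K] =i pred0.
Implicit Types (f g h u v w y : fps K 1) (D N : nat).

(** The truncation at j <= D gives the exponential only if [g] has no constant term. *)
Definition expser g : fps K 1 :=
  ser (fun D => \sum_(j < D.+1) (j`!%:R)^-1 * cf (g ^+ j) D).

Let expN g N : fps K 1 := \sum_(j < N) (j`!%:R)^-1 *: g ^+ j.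

Lemma fact_neq0 j : j`!%:R != 0 :> K.
Proof. by rewrite natK_neq0 // -lt0n fact_gt0. Qed.

Let cf_expN g N D : cf g 0 = 0 -> (D < N)%N -> cf (expser g) D = cf (expN g N) D.
Proof.
move=> g0 ltDN; rewrite cf_ser cf_sum.
rewrite (big_ord_widen _ (fun j => (j`!%:R)^-1 * cf (g ^+ j) D) ltDN) big_mkcond.
apply: eq_bigr => j _; rewrite cfZ ltnS; case: leqP => // ltDj.
by rewrite cf_exp_small // mulr0.
Qed.

Let theta_expN g N : theta (expN g N.+1) = expN g N * theta g.
Proof.
rewrite theta_sum big_ord_recl expr0 thetaZ theta1 scaler0 add0r mulr_suml.
apply: eq_bigr => j _; rewrite thetaZ thetaX -scaler_nat scalerA -scalerAl.
rewrite factS natrM invfM -mulrA mulrC -mulrA mulfV ?mulr1 //.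
by rewrite natK_neq0.
Qed.

Lemma theta_expser g : cf g 0 = 0 -> theta (expser g) = expser g * theta g.
Proof.
move=> g0; apply: cf_inj => D.
rewrite cf_theta (@cf_expN g D.+2) // -cf_theta theta_expN !cfM.
by apply: eq_bigr => i _; rewrite (@cf_expN g D.+1).
Qed.

Lemma cf_expser0 g : cf (expser g) 0 = 1.
Proof. by rewrite cf_ser big_ord1 expr0 cf1 fact0 invr1 mulr1. Qed.

Lemma ode_unique u v w : cf w 0 = 0 -> theta u = u * w -> theta v = v * w ->
  cf u 0 = cf v 0 -> u = v.
Proof.
move=> w0 eu ev e0; apply: cf_inj; elim/ltn_ind => -[|D] IH //.
have H (f : fps K 1) : theta f = f * w ->
    D.+1%:R * cf f D.+1 = \sum_(i < D.+1) cf f i * cf w (D.+1 - i).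
  by move=> e; rewrite -cf_theta e cfM big_ord_recr /= subnn w0 mulr0 addr0.
have D0 : D.+1%:R != 0 :> K by rewrite natK_neq0.
apply: (mulfI D0); rewrite !H //; apply: eq_bigr => i _.
by rewrite IH.
Qed.

Lemma expserD g h : cf g 0 = 0 -> cf h 0 = 0 ->
  expser (g + h) = expser g * expser h.
Proof.
move=> g0 h0; have gh0 : cf (g + h) 0 = 0 by rewrite cfD g0 h0 addr0.
apply: (@ode_unique _ _ (theta (g + h))).
- by rewrite cf_theta mul0r.
- exact: theta_expser.
- by rewrite thetaM !theta_expser // thetaD mulrDr -!mulrA [theta g * _]mulrC.
- by rewrite cf0M !cf_expser0 mulr1.
Qed.

Definition monoser d (c : K) : fps K 1 := ser (fun i => if i == d then c else 0).

Lemma cf_monoserM d c f D :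
  cf (monoser d c * f) D = if (d <= D)%N then c * cf f (D - d) else 0.
Proof.
rewrite cfM; case: leqP => [le_dD|lt_Dd].
  rewrite (bigD1 (Ordinal (le_dD : (d < D.+1)%N))) //= cf_ser eqxx.
  rewrite big1 ?addr0 // => i ne_i; rewrite cf_ser ifN ?mul0r //.
rewrite big1 // => i _; rewrite cf_ser ifN ?mul0r // neq_ltn.
by rewrite (leq_trans (ltn_ord i)).
Qed.

Lemma cf_monoserX d c j D : cf (monoser d c ^+ j) D =
  if D == (j * d)%N then c ^+ j else 0.
Proof.
elim: j D => [|j IH] D; first by rewrite !expr0 cf1 mul0n; case: eqP.
rewrite exprS cf_monoserM IH exprS; case: leqP => [le_dD|lt_Dd].
  rewrite (_ : (D - d == j * d)%N = (D == j.+1 * d)%N); last by rewrite mulSn; lia.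
  by case: ifP => _; rewrite ?mulr0.
by rewrite ifN // neq_ltn mulSn ltn_addr.
Qed.

Lemma cf_expser_monoser d c D : (0 < d)%N ->
  cf (expser (monoser d c)) D =
  if (d %| D)%N then c ^+ (D %/ d)%N / (D %/ d)%N`!%:R else 0.
Proof.
move=> d0; rewrite cf_ser; case: ifP => [/dvdnP[q ->]|ndv].
  rewrite mulnK //; have le_q : (q < (q * d).+1)%N by rewrite ltnS leq_pmulr.
  rewrite (bigD1 (Ordinal le_q)) //= cf_monoserX eqxx mulrC big1 ?addr0 //.
  move=> j ne_j; rewrite cf_monoserX ifN ?mulr0 //.
  by rewrite eqn_pmul2r // eq_sym; rewrite -val_eqE in ne_j.
rewrite big1 // => j _; rewrite cf_monoserX ifN ?mulr0 //.
by apply/eqP => e; move: ndv; rewrite e dvdn_mull.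
Qed.

Lemma sum_multiples (V : nmodType) d D (G : nat -> V) : (0 < d)%N ->
  \sum_(i < D.+1 | (d %| i)%N) G i = \sum_(q < (D %/ d)%N.+1) G (q * d)%N.
Proof.
move=> d0.
have b1 (q : 'I_(D %/ d)%N.+1) : (q * d < D.+1)%N.
  by rewrite ltnS (leq_trans (leq_mul (ltn_ord q : (q <= _)%N) (leqnn d))) ?leq_divM.
have b2 (i : 'I_D.+1) : (i %/ d < (D %/ d).+1)%N by rewrite ltnS leq_div2r // -ltnS.
rewrite (reindex_onto (fun q => Ordinal (b1 q)) (fun i => Ordinal (b2 i))) /=.
  apply: eq_bigl => q; rewrite dvdn_mull //=.
  by rewrite -val_eqE /= mulnK // eqxx.
by move=> i dvi; apply: val_inj; rewrite /= divnK.
Qed.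

(** Displays the coefficient as a polynomial of degree at most D / d in the single parameter [c], to
    which interpolation will be applied. *)
Lemma cf_expser_split d c g D : (0 < d)%N -> cf g 0 = 0 ->
  cf (expser (monoser d c + g)) D =
  \sum_(q < (D %/ d)%N.+1)
    c ^+ q * ((q`!%:R)^-1 * cf (expser g) (D - q * d)).
Proof.
move=> d0 g0; rewrite expserD //; last by rewrite cf_ser ltn_eqF.
rewrite cfM (eq_bigr (fun i : 'I_D.+1 => if (d %| i)%N then
  c ^+ (i %/ d)%N * (((i %/ d)%N`!%:R)^-1 * cf (expser g) (D - i)) else 0)).
  rewrite -big_mkcond /= (sum_multiples _ (fun i => c ^+ (i %/ d)%N *
    (((i %/ d)%N`!%:R)^-1 * cf (expser g) (D - i)))) //.
  by apply: eq_bigr => q _; rewrite mulnK.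
move=> i _; rewrite cf_expser_monoser //; case: ifP => _; rewrite ?mul0r //.
by rewrite mulrA.
Qed.

(** Truncated after [D] terms, log(1 + y) has image (1 - (-y)^D) [theta g] under [theta]; the error
    term has order above [D]. *)
Lemma log_expser g D : cf g 0 = 0 ->
  \sum_(j < D) (-1) ^+ j / j.+1%:R * cf ((expser g - 1) ^+ j.+1) D = cf g D.
Proof.
move=> g0; set y := expser g - 1.
have y0 : cf y 0 = 0 by rewrite cfB cf_expser0 cf1 subrr.
have [->|D0] := posnP D; first by rewrite big_ord0.
pose L : fps K 1 := \sum_(j < D) ((-1) ^+ j / j.+1%:R) *: y ^+ j.+1.
have thy : theta y = (y + 1) * theta g.
  have -> : y + 1 = expser g by rewrite subrK.
  by rewrite -theta_expser // /y thetaD -scaleN1r thetaZ theta1 scaler0 addr0.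
have thL : theta L = (1 - (- y) ^+ D) * theta g.
  have -> : theta L = (\sum_(j < D) (- y) ^+ j) * theta y.
    rewrite theta_sum mulr_suml; apply: eq_bigr => j _.
    rewrite thetaZ thetaX -scaler_nat scalerA -mulrA mulVf ?mulr1; last first.
      by rewrite natK_neq0.
    rewrite [(- y) ^+ j]exprNn -[(-1 : K) ^+ j]signr_odd -[(-1 : fps K 1) ^+ j]signr_odd.
    by case: odd; rewrite ?expr1 ?expr0 ?scaleN1r ?mulN1r ?mulNr ?scale1r ?mul1r.
  rewrite thy mulrA; congr (_ * _).
  have -> : 1 - (- y) ^+ D = (1 - (- y)) * \sum_(j < D) (- y) ^+ j.
    by rewrite -opprB subrX1 -mulNr opprB.
  by rewrite opprK [1 + y]addrC mulrC.
have Dn0 : D%:R != 0 :> K by rewrite natK_neq0 // -lt0n.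
apply: (mulfI Dn0).
have -> : \sum_(j < D) (-1) ^+ j / j.+1%:R * cf (y ^+ j.+1) D = cf L D.
  by rewrite cf_sum; apply: eq_bigr => j _; rewrite cfZ.
rewrite -!cf_theta thL mulrBl mul1r cfB.
suff -> : cf ((- y) ^+ D * theta g) D = 0 by rewrite subr0.
have yO : ordge 1 (- y) by apply/ordge1P => -[|//] _; rewrite cfN y0 oppr0.
have tO : ordge 1 (theta g) by apply/ordge1P => -[|//] _; rewrite cf_theta mul0r.
have /ordge1P := ordgeM (@ordge_exp _ _ 1 D yO) tO; apply.
by rewrite mul1n addn1.
Qed.

End Exponential.

(** * Growth rates in A *)

Section NormRounding.
Variables (R : realType) (K : fieldType) (nrm : K -> R).
Hypothesis nrmP : nontrivial_norm nrm.

Lemma exp_ge_of_gt1 (x y : R) : 1 < x -> exists N, y <= x ^+ N.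
Proof.
move=> x1; have x1' : 0 < x - 1 by rewrite subr_gt0.
pose N := Num.bound (`|y| / (x - 1)); exists N.
have : `|y| / (x - 1) < N%:R by rewrite archi_boundP // divr_ge0 // ltW.
rewrite ltr_pdivrMr // => lt_y.
have := bernoulli_ge N (ltW (lt_trans ltr01 x1)).
by have := ler_norm y; lra.
Qed.

Lemma nrm_round (al : K) (r : R) : 1 < nrm al -> 0 < r ->
  exists c, r <= nrm c <= nrm al * r.
Proof.
move=> al1 r0; have al0 : 0 < nrm al by rewrite (lt_trans ltr01).
have [N le_N] := exp_ge_of_gt1 (r^-1) al1.
have r1 : 1 <= r * nrm al ^+ N by rewrite -ler_pdivrMl // mulr1.
have ex : exists m, r * nrm al ^+ N <= nrm al ^+ m.
  exact: exp_ge_of_gt1.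
have [m le_m min_m] := ex_minnP ex.
have AN0 : 0 < nrm al ^+ N by rewrite exprn_gt0.
exists (al ^+ m / al ^+ N); rewrite (nrmM nrmP) (nrmV nrmP) !(nrmX nrmP).
rewrite ler_pdivlMr // le_m /= ler_pdivrMr // -mulrA.
case: m le_m min_m => [|m] le_m min_m.
  by rewrite expr0 (le_trans r1) // ler_peMl ?ltW // (lt_le_trans ltr01).
rewrite exprS ler_wpM2l ?(ltW al0) // leNgt; apply/negP => lt_m.
by have := min_m m (ltW lt_m); rewrite ltnn.
Qed.

End NormRounding.

Lemma degree_norm1 (R : realType) (K : fieldType) (nrm : K -> R) (f : fps K 1) D :
  degree_norm nrm f D = nrm (cf f D).
Proof.
have ltD : (mdeg (mono1 D) < D.+1)%N by rewrite mdeg_mono1.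
rewrite /degree_norm (big_pred1 (BMultinom ltD)) // => m.
rewrite /= bmeqP /= -{2}(mono1K m) mdeg1E.
by apply/eqP/eqP => [->|/(congr1 (fun k : 'X_{1..1} => k ord0))]; rewrite ?mono1E.
Qed.

Section Growth.
Variables (R : realType) (K : fieldType) (nrm : K -> R).
Hypothesis K_char0 : [pchar K] =i pred0.
Hypothesis nrmP : nontrivial_norm nrm.
Variables (n : nat) (A : {pred fps K n.+1}).
Hypothesis A_alg : GRing.subalg_closed A.
Hypothesis A_diff : forall (i : 'I_n.+1) f, f \in A -> fps_deriv i f \in A.
Hypothesis A_maj : majorization_closed nrm A.
Hypothesis A_ift : implicit_function_closed nrm A.
Implicit Types (r s : nat -> R) (c : nat -> K).

(* membership in A depends only on the growth of the degree norms; [growth] is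
   the set of real sequences eventually dominated by those of members of A *)
Definition growth r : Prop := exists2 g, g \in A &
  exists D0, forall D, (D0 <= D)%N -> r D <= degree_norm nrm g D.

Lemma growth_mono r s D0 : growth s -> (forall D, (D0 <= D)%N -> r D <= s D) ->
  growth r.
Proof.
case=> g gA [D1 le_s] le_r; exists g => //; exists (maxn D0 D1) => D.
by rewrite geq_max => /andP[le0 le1]; rewrite (le_trans (le_r D le0)) ?le_s.
Qed.

Lemma growth_le r s : growth s -> (forall D, r D <= s D) -> growth r.
Proof. by move=> gs le_r; apply: (@growth_mono _ _ 0 gs) => D _. Qed.

Lemma growth_mem f : f \in A -> growth (degree_norm nrm f).
Proof. by move=> fA; exists f => //; exists 0%N. Qed.

Lemma mem_growth f : growth (degree_norm nrm f) -> f \in A.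
Proof. by case=> g gA [D0 le_g]; apply: (A_maj gA); exists D0. Qed.

Lemma A_lin a f g : f \in A -> g \in A -> a *: f + g \in A.
Proof. by case: A_alg => _ lin _; apply: lin. Qed.

Lemma A_0 : 0 \in A.
Proof.
have [A1 lin _] := A_alg; have := lin (-1) 1 1 A1 A1.
by rewrite scaleN1r addNr.
Qed.

Lemma growth_scale (b : K) r : growth r -> growth (fun D => nrm b * r D).
Proof.
case=> g gA [D0 le_g]; exists (b *: g).
  by rewrite -[b *: g]addr0 A_lin ?A_0.
by exists D0 => D leD; rewrite degree_normZ // ler_wpM2l ?(nrm_ge0 nrmP) ?le_g.
Qed.

(** Degree norms do not see how a homogeneous part is spread over monomials, so a sequence can be
    realized on the powers of one variable. *)
Definition axis_ser c : fps K n.+1 :=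
  fun m => if m == (U_(ord0) *+ mdeg m)%MM then c (mdeg m) else 0.

Lemma axis_serE c D : axis_ser c (U_(ord0) *+ D)%MM = c D.
Proof. by rewrite /axis_ser mdegMn mdeg1 mul1n eqxx. Qed.

Lemma degree_norm_axis c D : degree_norm nrm (axis_ser c) D = nrm (c D).
Proof.
have ltD : (mdeg (U_(ord0 : 'I_n.+1) *+ D)%MM < D.+1)%N by rewrite mdegMn mdeg1 mul1n.
rewrite /degree_norm (bigD1 (BMultinom ltD)) /=; last by rewrite mdegMn mdeg1 mul1n.
rewrite axis_serE big1 ?addr0 // => m /andP[/eqP em ne_m].
by rewrite /axis_ser em ifN ?nrm0 //; apply: contraNN ne_m => /eqP e.
Qed.

Lemma growth_axis c : growth (nrm \o c) <-> axis_ser c \in A.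
Proof.
have e : degree_norm nrm (axis_ser c) = nrm \o c.
  by apply/funext => D; rewrite degree_norm_axis.
by split=> [|/growth_mem]; [rewrite -e; apply: mem_growth|rewrite e].
Qed.

(** Rounding real values to norms of scalars costs a factor |al|; it turns a rate into a series to
    which the closure properties of [A] apply. *)
Lemma growth_coef r : growth r ->
  exists2 c, growth (nrm \o c) & forall D, r D <= nrm (c D).
Proof.
have [al _ al2] := nrm_large nrmP 2.
have al1 : 1 < nrm al by rewrite (lt_le_trans _ al2) // ltr1n.
move=> gr; pose r' D := Num.max 0 (r D).
have H D : exists x : K, r D <= nrm x <= nrm al * r' D.
  have [r0|r0] := ltP 0 (r D).
    by rewrite /r' max_r ?ltW //; apply: nrm_round.
  exists 0; rewrite (nrm0 nrmP) r0 /=; apply: mulr_ge0; first exact: nrm_ge0.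
    by rewrite /r' le_max lexx.
have [c cP] := boolp.choice H; exists c; last by move=> D; case/andP: (cP D).
apply: (@growth_le _ (fun D => nrm al * r' D)); last first.
  by move=> D; case/andP: (cP D).
apply: growth_scale; case: gr => g gA [D0 le_g]; exists g => //.
by exists D0 => D leD; rewrite ge_max le_g // degree_norm_ge0.
Qed.

(** In each degree only the larger of the two coefficients is kept. The supports become disjoint,
    nothing cancels, and the sum of the series still has at least half of the wanted size. *)
Lemma growthD r s : growth r -> growth s -> growth (fun D => r D + s D).
Proof.
move=> /growth_coef[c gc le_c] /growth_coef[d gd le_d].
have [be be0 be2] := nrm_large nrmP 2.
pose c1 D := if nrm (d D) <= nrm (c D) then c D else 0.
pose d1 D := if nrm (d D) <= nrm (c D) then 0 else d D.
have gc1 : growth (nrm \o c1).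
  apply: growth_le gc _ => D /=; rewrite /c1; case: ifP => // _.
  by rewrite nrm0 // nrm_ge0.
have gd1 : growth (nrm \o d1).
  apply: growth_le gd _ => D /=; rewrite /d1; case: ifP => // _.
  by rewrite nrm0 // nrm_ge0.
have /growth_axis gcd : axis_ser (fun D => c1 D + d1 D) \in A.
  have -> : axis_ser (fun D => c1 D + d1 D) = 1 *: axis_ser c1 + axis_ser d1.
    rewrite scale1r; apply/funext => m; rewrite fpsDE /axis_ser.
    by case: ifP; rewrite ?addr0.
  by apply: A_lin; apply/growth_axis.
apply: growth_le (growth_scale be gcd) _ => D /=.
have hc := le_c D; have hd := le_d D.
have : nrm (c D) + nrm (d D) <= 2 * nrm (c1 D + d1 D).
  rewrite /c1 /d1; case: ifP => [h|/negbT]; first by rewrite addr0; lra.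
  by rewrite -ltNge add0r => h; lra.
have := nrm_ge0 nrmP (c1 D + d1 D); nra.
Qed.

Lemma growth_sum I (l : seq I) (r : I -> nat -> R) : (forall i, growth (r i)) ->
  growth (fun D => \sum_(i <- l) r i D).
Proof.
move=> gr; elim: l => [|i l IH].
  exists 0; first exact: A_0.
  by exists 0%N => D _; rewrite big_nil degree_norm_ge0.
by apply: growth_le (growthD (gr i) IH) _ => D; rewrite big_cons.
Qed.

Lemma growth_finite r D0 : (forall D, (D0 <= D)%N -> r D <= 0) -> growth r.
Proof.
move=> r0; exists 0; first exact: A_0.
by exists D0 => D leD; rewrite (le_trans (r0 D leD)) ?degree_norm_ge0.
Qed.

Lemma growth_implicit (F : nat -> nat -> K) (y : nat -> K) :
  F 0%N 0%N = 0 -> F 0%N 1%N != 0 -> y 0%N = 0 ->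
  growth (fun D => \sum_(i < D.+1) nrm (F i (D - i)%N)) ->
  (forall D, \sum_(i < D.+1) \sum_(j < D.+1 | (i + j <= D)%N)
     F i j * cf (ser y ^+ j) (D - i) = 0) ->
  growth (nrm \o y).
Proof.
move=> F00 F01 y0 [g gA [D0 le_g]] eqF.
pose f : fps K 2 := fun m => F (m ord0) (m ord_max).
have [|||||h hA [D1 le_h]] := A_ift (f := f) (y := ser y).
- exists g => //; exists D0 => D leD; apply: le_trans (le_g D leD).
  pose G i j := if (i + j == D)%N then nrm (F i j) else 0.
  have -> : degree_norm nrm f D = \sum_(m : 'X_{1..2 < D.+1}) G (m ord0) (m ord_max).
    by rewrite /degree_norm big_mkcond; apply: eq_bigr => m _; rewrite mdeg2E.
  rewrite sum_mnm2; apply: ler_sum => i _.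
  have lt_D : (D - i < D.+1)%N by rewrite ltnS leq_subr.
  have le_iD : (i <= D)%N by rewrite -ltnS.
  rewrite (bigD1 (Ordinal lt_D)) /= ?subnKC // big1 ?addr0 /G => [|j].
    by rewrite subnKC // eqxx.
  case/andP => _ ne_j; case: eqP => // e; case/eqP: ne_j; apply/val_inj.
  by have := e; rewrite /=; lia.
- by rewrite /f !mnm0E.
- by rewrite /fps_deriv /f add0m !mnm0E !mnm1E /= mulr1n.
- by apply/in_xP/ordge1P => -[|//] _; rewrite cf_ser.
- apply/funext => d; rewrite /fps_comp fps0E.
  pose G i j := F i j * cf (fps_var K ord0 ^+ i * ser y ^+ j) (d ord0).
  transitivity (\sum_(m : 'X_{1..2 < (mdeg d).+1}) G (m ord0) (m ord_max)).
    by apply: eq_bigr => m _; rewrite prod_ord2 /G /cf mono1K.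
  rewrite sum_mnm2 mdeg1E -[RHS](eqF (d ord0)); apply: eq_bigr => i _.
  apply: eq_bigr => j _; rewrite /G cf_varXM.
  by rewrite -ltnS ltn_ord.
exists h => //; exists D1 => D /le_h.
by rewrite degree_norm1 cf_ser.
Qed.

Lemma sum_delta (V : nmodType) N k (X : nat -> V) :
  \sum_(i < N) (if i == k :> nat then X i else 0) = if (k < N)%N then X k else 0.
Proof.
case: ifP => [ltk|nltk].
  rewrite (bigD1 (Ordinal ltk)) //= eqxx big1 ?addr0 // => i ne_i.
  by rewrite -val_eqE /= in ne_i; rewrite (negPf ne_i).
rewrite big1 // => i _; case: eqP => // e.
by move: nltk; rewrite -e ltn_ord.
Qed.

Lemma growth_implicit_full (F : nat -> nat -> K) (y : nat -> K) :
  F 0%N 0%N = 0 -> F 0%N 1%N != 0 -> y 0%N = 0 ->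
  growth (fun D => \sum_(i < D.+1) nrm (F i (D - i)%N)) ->
  (forall D, \sum_(i < D.+1) \sum_(j < D.+2)
     F i j * cf (ser y ^+ j) (D - i) = 0) ->
  growth (nrm \o y).
Proof.
move=> F00 F01 y0 gF eqF; apply: (growth_implicit F00 F01 y0 gF) => D.
have sy0 : cf (ser y) 0 = 0 by rewrite cf_ser.
rewrite -[RHS](eqF D); apply: eq_bigr => i _.
rewrite [RHS]big_ord_recr /= [X in _ = _ + _ * X]cf_exp_small ?mulr0 ?addr0 //; last first.
  by rewrite ltnS leq_subr.
rewrite [RHS](bigID (fun j : 'I_D.+1 => (i + j <= D)%N)) /=.
rewrite [X in _ = _ + X]big1 ?addr0 // => j; rewrite -ltnNge => lt_D.
by rewrite cf_exp_small ?mulr0 // ltn_subLR // -ltnS.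
Qed.

(** The implicit equation v(x) y = h(x), that is, the quotient h / v. The term v_i x^i y has degree
    i + 1, whence [D.-1]. *)
Lemma growth_linear (v h y : nat -> K) :
  v 0%N != 0 -> h 0%N = 0 -> y 0%N = 0 ->
  growth (fun D => nrm (v D.-1) + nrm (h D)) ->
  (forall D, \sum_(i < D.+1) v i * y (D - i)%N = h D) -> growth (nrm \o y).
Proof.
move=> v0 h0 y0 gvh eqy.
pose F i j := (if j == 1%N then v i else 0) - (if j == 0%N then h i else 0).
apply: (@growth_implicit_full F) => //; rewrite /F ?h0 ?subrr ?subr0 //=.
  apply: growth_le gvh _ => D.
  apply: (@le_trans _ _ (\sum_(i < D.+1) ((if i == D.-1 :> nat then nrm (v i) else 0) +
    (if i == D :> nat then nrm (h i) else 0)))).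
    apply: ler_sum => i _; have le_iD : (i <= D)%N by rewrite -ltnS.
    apply: le_trans (nrmB nrmP _ _) _; apply: lerD.
      case: eqP => [e|_]; last by rewrite (nrm0 nrmP); case: eqP; rewrite ?(nrm_ge0 nrmP).
      by rewrite ifT //; apply/eqP; lia.
    case: eqP => [e|_]; last by rewrite (nrm0 nrmP); case: eqP; rewrite ?(nrm_ge0 nrmP).
    by rewrite ifT //; apply/eqP; lia.
  rewrite big_split /= (sum_delta _ _ (nrm \o v)) (sum_delta _ _ (nrm \o h)) /=.
  by rewrite ltnS leq_pred ltnSn.
move=> D.
transitivity (\sum_(i < D.+1) v i * y (D - i)%N -
  \sum_(i < D.+1) (if i == D :> nat then h i else 0)); last first.
  by rewrite sum_delta ltnSn eqy subrr.
rewrite -sumrB; apply: eq_bigr => i _; rewrite !big_ord_recl /= big1 ?addr0.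
  rewrite expr0 expr1 cf1 cf_ser sub0r subr0 addrC mulNr; congr (_ - _).
  have le_iD : (i <= D)%N by rewrite -ltnS.
  rewrite subn_eq0; case: (eqVneq (i : nat) D) => [->|ne_i].
    by rewrite leqnn mulr1.
  by rewrite leqNgt ltn_neqAle ne_i le_iD mulr0.
by move=> j _; rewrite subr0 mul0r.
Qed.

(** The implicit equation p(y) = g(x), that is, [g] followed by the inverse of [p] under
    composition. *)
Lemma growth_separated (p g y : nat -> K) :
  p 0%N = 0 -> g 0%N = 0 -> p 1%N != 0 -> y 0%N = 0 ->
  growth (fun D => nrm (p D) + nrm (g D)) ->
  (forall D, \sum_(j < D.+1) p j * cf (ser y ^+ j) D = g D) ->
  growth (nrm \o y).
Proof.
move=> p0 g0 p1 y0 gpg eqy.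
pose F i j := (if i == 0%N then p j else 0) - (if j == 0%N then g i else 0).
apply: (@growth_implicit_full F) => //; rewrite /F ?g0 ?p0 ?subrr ?subr0 //=.
  apply: growth_le gpg _ => D.
  apply: (@le_trans _ _ (\sum_(i < D.+1)
    ((if i == 0 :> nat then nrm (p (D - i)%N) else 0) +
    (if i == D :> nat then nrm (g i) else 0)))).
    apply: ler_sum => i _; have le_iD : (i <= D)%N by rewrite -ltnS.
    apply: le_trans (nrmB nrmP _ _) _; apply: lerD.
      by case: eqP => [//|_]; rewrite (nrm0 nrmP).
    case: eqP => [e|_]; last by rewrite (nrm0 nrmP); case: eqP; rewrite ?(nrm_ge0 nrmP).
    by rewrite ifT //; apply/eqP; lia.
  rewrite big_split /= (sum_delta _ _ (fun i => nrm (p (D - i)%N))).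
  by rewrite (sum_delta _ _ (nrm \o g)) /= ltnSn subn0.
move=> D; have sy0 : cf (ser y) 0 = 0 by rewrite cf_ser.
rewrite big_ord_recl /= subn0 [X in _ + X](eq_bigr (fun i : 'I_D =>
  - g i.+1 * (D - i.+1 == 0)%N%:R)) => [|i _]; last first.
  rewrite big_ord_recl /= expr0 cf1 sub0r big1 ?addr0 // => j _.
  by rewrite subrr mul0r.
rewrite big_ord_recr /= subr0 [X in _ * X]cf_exp_small // mulr0 addr0.
rewrite (eq_bigr (fun j : 'I_D.+1 => p j * cf (ser y ^+ j) D)) => [|j _].
  rewrite eqy; case: D => [|D]; first by rewrite big_ord0 g0 addr0.
  rewrite big_ord_recr /= subnn eqxx mulr1 big1 ?add0r ?subrr //.
  by move=> i _; rewrite subn_eq0 leqNgt ltnS ltn_ord mulr0.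
by case: eqP => [->|_]; rewrite ?p0 ?g0 ?subrr ?subr0.
Qed.

(** Division of t X by 1 - t X, for a scalar t with |t| >= |b|. *)
Lemma growth_geometric (b : R) : growth (fun D => b ^+ D).
Proof.
have [x x0 le_x] := nrm_large nrmP `|b|.
pose y D := if D is _.+1 then x ^+ D else 0.
apply: (@growth_mono _ (nrm \o y) 1); last first.
  move=> [//|D] _ /=; rewrite (nrmX nrmP).
  by rewrite (le_trans (ler_norm _)) // normrX lerXn2r ?nnegrE ?(nrm_ge0 nrmP).
apply: (@growth_linear (fun D => if D == 0%N then 1 else if D == 1%N then - x else 0)
  (fun D => if D == 1%N then x else 0)) => //=; first exact: oner_neq0.
  apply: (@growth_finite _ 3) => -[|[|[|D]]] // _ /=.
  by rewrite (nrm0 nrmP) addr0.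
case=> [|D]; first by rewrite big_ord1 mulr0.
rewrite !big_ord_recl /= big1 ?addr0 => [|i _]; last by rewrite mul0r.
rewrite mul1r subn0 subSS subn0; case: D => [|D] /=; first by rewrite mulr0 addr0 expr1.
by rewrite mulNr -exprS subrr.
Qed.

(** Replacing x by b x is not among the operations given on [A]. But if y starts with la x, a term
    c_D y^D in the equation contributes c_D la^D to the D-th coefficient of [y], and |la| >= b. *)
Lemma growth_rescale (b : R) r : 0 <= b -> growth r -> growth (fun D => b ^+ D * r D).
Proof.
move=> b0 /growth_coef[ga g_ga le_r].
have [la la0 le_la] := nrm_large nrmP (Num.max 2 `|b|).
have la_b : `|b| <= nrm la by rewrite (le_trans _ le_la) // le_max lexx orbT.
(* the series c and the solution y of y = la x + sum c_d y^d are built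
   together, each c_D in {0, ga D} being chosen so that the D-th coefficient
   of y does not suffer from cancellation *)
pose T (u : nat -> K * K) D :=
  let y := ser (fun i => if (i < D)%N then (u i).2 else 0) in
  \sum_(j < D | (1 < j)%N) (u j).1 * cf (y ^+ j) D.
pose pick t D := if nrm (ga D * la ^+ D) <= 2 * nrm t then 0 else ga D.
pose phi u D := if D is 0 then (0, 0) else if D is 1 then (0, la) else
  (pick (T u D) D, T u D + pick (T u D) D * la ^+ D).
have phi_causal u v D : (forall i, (i < D)%N -> u i = v i) -> phi u D = phi v D.
  move=> e; suff eT : T u D = T v D by rewrite /phi eT.
  rewrite /T; have -> : (fun i => if (i < D)%N then (u i).2 else 0) =
      (fun i => if (i < D)%N then (v i).2 else 0).
    by apply/funext => i; case: ifP => // lt_i; rewrite e.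
  by apply: eq_bigr => j _; rewrite e.
have [u uE] := causal_fixpoint (0, 0) phi_causal.
pose c D := (u D).1; pose y D := (u D).2.
have y0 : y 0%N = 0 by rewrite /y uE.
have y1 : y 1%N = la by rewrite /y uE.
have Dge D : (1 < D)%N -> c D = pick (T u D) D /\ y D = T u D + c D * la ^+ D.
  by rewrite /c /y uE; case: D => [|[|D]].
have le_c D : nrm (c D) <= nrm (ga D).
  rewrite /c uE; case: D => [|[|D]]; rewrite /= ?(nrm0 nrmP) ?(nrm_ge0 nrmP) // /pick.
  by case: ifP; rewrite ?(nrm0 nrmP) ?(nrm_ge0 nrmP).
have TE D : (1 < D)%N -> \sum_(j < D | (1 < j)%N) c j * cf (ser y ^+ j) D = T u D.
  move=> D1; apply: eq_bigr => j j1; congr (_ * _).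
  apply: cf_exp_trunc => //; rewrite ?cf_ser //; first by case: ifP.
  by move=> i lt_i; rewrite !cf_ser lt_i.
have gy : growth (nrm \o y).
  apply: (@growth_separated (fun j => if j == 1%N then 1 else if j == 0%N then 0 else - c j)
    (fun i => if i == 1%N then la else 0)) => //=; first exact: oner_neq0.
    apply: (@growth_mono _ (nrm \o ga) 2) => // -[|[|D]] // _ /=.
    by rewrite (nrm0 nrmP) addr0 (nrmN nrmP).
  case=> [|[|D]]; first by rewrite big_ord1 mul0r.
    by rewrite !big_ord_recl big_ord0 /= mul0r mul1r expr1 cf_ser y1 add0r addr0.
  have [cE yE] := Dge D.+2 isT; have sE := TE D.+2 isT.
  rewrite big_mkcond !big_ord_recl /= !add0r in sE.
  rewrite big_ord_recr !big_ord_recl /= !mul0r mul1r expr1 cf_ser add0r.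
  rewrite cf_exp_diag ?cf_ser // y1 yE -sE.
  under [X in _ + X + _]eq_bigr => i _ do rewrite mulNr.
  by rewrite sumrN mulNr [X in X - _]addrAC subrr add0r subrr.
have [be be0 be2] := nrm_large nrmP 2.
apply: (@growth_mono _ (fun D => nrm be * (nrm \o y) D) 2).
  exact: growth_scale.
move=> D D1 /=; have [cE yE] := Dge D D1.
have le1 : b ^+ D * r D <= nrm (ga D * la ^+ D).
  rewrite (nrmM nrmP) (nrmX nrmP) mulrC.
  have [r0|/ltW r0] := leP 0 (r D); last first.
    by rewrite (le_trans (mulr_le0_ge0 r0 (exprn_ge0 _ b0))) // mulr_ge0 ?exprn_ge0 ?(nrm_ge0 nrmP).
  rewrite ler_pM ?exprn_ge0 // lerXn2r ?nnegrE ?(nrm_ge0 nrmP) //.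
  by rewrite (le_trans (ler_norm b)).
apply: (le_trans le1).
suff : nrm (ga D * la ^+ D) <= 2 * nrm (y D).
  by move=> h; rewrite (le_trans h) // ler_wpM2r ?(nrm_ge0 nrmP).
rewrite yE cE /pick; case: ifP => [|/negbT]; first by rewrite mul0r addr0.
rewrite -ltNge => lt_t.
have := nrm_subl nrmP (ga D * la ^+ D) (T u D).
rewrite [_ + T u D]addrC; lra.
Qed.

(** The equation solved is log(1 + y) = g, whose left-hand coefficients grow at most
    geometrically. *)
Lemma growth_exp (g : nat -> K) : g 0%N = 0 -> growth (nrm \o g) ->
  growth (nrm \o cf (expser (ser g))).
Proof.
move=> g0 gg; pose y := cf (expser (ser g) - 1).
have sy : ser y = expser (ser g) - 1 by apply: serK.
suff gy : growth (nrm \o y).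
  apply: (@growth_mono _ _ 1 gy) => -[//|D] _ /=.
  by rewrite /y cfB cf1 subr0.
have [C C1 le_C] := inv_nat_norm_geometric nrmP K_char0.
apply: (@growth_separated (fun j => if j is i.+1 then (-1) ^+ i / j%:R else 0) g) => //.
- by rewrite expr0 divr1 oner_neq0.
- by rewrite /y cfB cf_expser0 cf1 subrr.
- apply: (@growth_mono _ (fun D => C ^+ D + nrm (g D)) 1).
    exact: growthD (growth_geometric C) gg.
  move=> [//|D] _ /=; rewrite lerD2r (nrmM nrmP) (nrmX nrmP) (nrmN nrmP).
  by rewrite (nrm1 nrmP) expr1n mul1r (nrmV nrmP) le_C.
move=> D; rewrite big_ord_recl /= mul0r add0r sy.
by rewrite -[RHS]cf_ser -(log_expser K_char0) ?cf_ser.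
Qed.

(** Differentiation lowers degrees by one; the factor D + 1 that it produces may be small in norm,
    and a rescaling makes up for it. *)
Lemma growth_shift r : growth r -> growth (fun D => r D.+1).
Proof.
move=> /growth_coef[c /growth_axis cA le_r].
have [C C1 le_C] := inv_nat_norm_geometric nrmP K_char0.
have C0 : 0 <= C by rewrite (le_trans ler01).
have := growth_scale 1 (growth_rescale C0 (growth_mem (A_diff ord0 cA))).
have [x x0 le_x] := nrm_large nrmP C.
move/(growth_scale x) => gg; apply: growth_le gg _ => D; rewrite (nrm1 nrmP) mul1r mulrA.
apply: (@le_trans _ _ (C ^+ D.+1 * nrm (D.+1%:R * c D.+1))).
  rewrite (nrmM nrmP) mulrA (le_trans (le_r _)) // ler_peMl ?(nrm_ge0 nrmP) //.
  by rewrite -ler_pdivrMr ?(nrm_gt0 nrmP) ?natK_neq0 // mul1r le_C.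
have N0 := degree_norm_ge0 nrmP (fps_deriv ord0 (axis_ser c)) D.
have : nrm (D.+1%:R * c D.+1) <= degree_norm nrm (fps_deriv ord0 (axis_ser c)) D.
  have := degree_norm_coef nrmP (fps_deriv ord0 (axis_ser c)) (U_(ord0) *+ D)%MM.
  rewrite mdegMn mdeg1 mul1n /fps_deriv mulmnE mnm1E eqxx mul1n.
  by rewrite -mulmSr axis_serE mulr_natl.
move=> le_N; apply: ler_pM => //; rewrite ?exprn_ge0 ?(nrm_ge0 nrmP) //.
by rewrite exprS ler_wpM2r // exprn_ge0.
Qed.

End Growth.

(** * Splittings into large parts *)

Section LargeParts.
Local Open Scope nat_scope.

(* l is a list of parts of D := sumn l + rho, each of size at least about
   D^(2/3), and the remainder rho is smaller than all of them *)
Definition large_parts (l : seq nat) (rho : nat) : bool :=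
  all (fun d => (rho < d) && ((sumn l + rho) ^ 2 <= 8 * d ^ 3)) l.

Definition weight (e : nat -> nat) (l : seq nat) := \sum_(d <- l) e d.

(** Weights of iterated splittings: the remainder is split again until nothing is left. *)
Inductive achieved (e : nat -> nat) : nat -> nat -> Prop :=
| Achieved0 : achieved e 0 0
| AchievedS l rho v : l != [::] -> large_parts l rho -> achieved e rho v ->
    achieved e (sumn l + rho) (weight e l + v).

Lemma weight_le e l b : all (fun d => (0 < d) && (e d <= b)) l ->
  weight e l <= sumn l * b.
Proof.
rewrite /weight; elim: l => [|d l IH] /=; first by rewrite big_nil.
by case/andP=> /andP[d0 le_b] /IH le_l; rewrite big_cons; nia.
Qed.

Lemma leq_mem_sumn (l : seq nat) d : d \in l -> d <= sumn l.
Proof.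
elim: l => [//|x l IH]; rewrite inE => /predU1P[->|/IH] /=; first exact: leq_addr.
by move/leq_trans; apply; apply: leq_addl.
Qed.

Lemma achieved_bound e D v : achieved e D v -> v <= D * \max_(i < D.+1) e i.
Proof.
elim=> [//|l rho {}v _ lP _ IH]; set D' := sumn l + rho.
have le_b i : i <= D' -> e i <= \max_(i < D'.+1) e i.
  by move=> le_i; apply: (leq_bigmax (F := fun i : 'I_D'.+1 => e i) (Ordinal (le_i : i < D'.+1))).
rewrite /D' mulnDl; apply: leq_add.
  apply: weight_le; apply/allP => d dl; move/allP: lP => /(_ d dl) /andP[ltd _].
  rewrite (leq_ltn_trans _ ltd) //= le_b //.
  by rewrite (leq_trans (leq_mem_sumn dl)) // leq_addr.
rewrite (leq_trans IH) // leq_mul2l; apply/orP; right.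
apply/bigmax_leqP => i _; apply: le_b.
by rewrite (leq_trans (_ : i <= rho)) ?leq_addl // -ltnS.
Qed.

Lemma achieved_ex e D : exists v, achieved e D v.
Proof.
case: D => [|D]; first by exists 0; apply: Achieved0.
exists (weight e [:: D.+1] + 0).
rewrite -[X in achieved e X]addn0 -[X in achieved e (X + _)]addn0.
apply: (@AchievedS e [:: D.+1] 0 0) => //; last exact: Achieved0.
by rewrite /large_parts /= !addn0 andbT; nia.
Qed.

(** [y D] is the largest achieved weight. The inequality is the closure property wanted of [y]; that
    some splitting attains [y D] is what the generic exponential needs. *)
Lemma best_split e : exists y : nat -> nat, [/\ y 0 = 0,
  forall l rho, large_parts l rho -> weight e l + y rho <= y (sumn l + rho) &
  forall D, 0 < D -> exists l rho, [/\ l != [::], large_parts l rho,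
    D = sumn l + rho & y D = weight e l + y rho]].
Proof.
have H D : exists v, achieved e D v /\ forall v', achieved e D v' -> v' <= v.
  have ex : exists v, `[< achieved e D v >].
    by have [v av] := achieved_ex e D; exists v; apply/asboolP.
  have bnd v : `[< achieved e D v >] -> v <= D * \max_(i < D.+1) e i.
    by move/asboolP/achieved_bound.
  have [v /asboolP av maxv] := ex_maxnP ex bnd.
  by exists v; split=> // v' av'; apply/maxv/asboolP.
have [y yP] := boolp.choice H.
have le_y l rho : large_parts l rho -> weight e l + y rho <= y (sumn l + rho).
  have [->|l0] := eqVneq l [::]; first by rewrite /weight big_nil.
  by move=> lP; apply: (yP _).2; apply: AchievedS => //; apply: (yP _).1.
exists y; split=> // [|D D0].
  by have [a0 _] := yP 0; have := achieved_bound a0; rewrite mul0n leqn0 => /eqP.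
have [aD _] := yP D; move: D0; move eqv: (y D) aD => v aD D0.
case: aD eqv D0 => [//|l rho w l0 lP aw eqv _].
exists l, rho; split=> //; apply/eqP; rewrite eqn_leq leq_add2l (yP rho).2 //=.
by rewrite -eqv le_y.
Qed.

Lemma sum_undup (f : nat -> nat) l :
  \sum_(d <- undup l) count_mem d l * f d = \sum_(d <- l) f d.
Proof.
rewrite -(big_undup_iterop_count addn l xpredT f); apply: eq_bigr => d _.
by rewrite Monoid.iteropE iter_addn_0 mulnC.
Qed.

Definition bitlen d := (trunc_log 2 d).+1.

Lemma ltn_bitlen d : d < 2 ^ bitlen d. Proof. exact: trunc_log_ltn. Qed.

Lemma bitlen_le d D : d <= D -> bitlen d <= bitlen D.
Proof. by move=> le_d; rewrite ltnS leq_trunc_log. Qed.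

Lemma bitlen_leS d : bitlen d <= d.+1.
Proof.
case: d => [|d]; first by rewrite /bitlen trunc_log0.
have := trunc_logP (isT : 1 < 2) (ltn0Sn d); rewrite /bitlen => le_d.
by rewrite ltnS (leq_trans _ le_d) // ltnW // ltn_expl.
Qed.

Lemma cube_le_exp L : L.+1 ^ 3 <= 8 * 2 ^ L.
Proof.
have H k : (k + 5) ^ 3 <= 8 * 2 ^ (k + 4).
  elim: k => [//|k IH]; rewrite addSn (addSn k 4) (expnS 2).
  have x5 : 5 <= k + 5 by apply: leq_addl.
  move: (k + 5) (2 ^ (k + 4)) x5 IH => x z x5; rewrite !expnS expn0 !muln1.
  by nia.
by case: L => [|[|[|[|L]]]] //; have := H L; rewrite !addnS !addn0.
Qed.

Lemma bitlen_cube D : 0 < D -> bitlen D ^ 3 <= 8 * D.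
Proof.
move=> D0; rewrite (leq_trans (cube_le_exp _)) // leq_mul2l /=.
exact: trunc_logP.
Qed.

(** 2 ^ [digits d] is at least 256 d^6, hence at least 4 D^4 when [d] is a large part of [D]: enough
    values of b_d for a union bound over all [D] and [d], while |b_d| stays polynomial in [d]. *)
Definition digits d := 8 + 6 * bitlen d.

Lemma digits_large d D : D ^ 2 <= 8 * d ^ 3 -> 2 * D ^ 3 * D.+1 <= 2 ^ digits d.
Proof.
move=> le_D; rewrite /digits expnD [6 * _]mulnC expnM.
have lt_d := ltn_bitlen d.
have H : d ^ 6 <= (2 ^ bitlen d) ^ 6 by rewrite leq_exp2r // ltnW.
have H2 : (D ^ 2) ^ 2 <= (8 * d ^ 3) ^ 2 by rewrite leq_exp2r.
have e1 : (8 * d ^ 3) ^ 2 = 64 * d ^ 6 by ring.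
have e2 : (D ^ 2) ^ 2 = D ^ 4 by rewrite -expnM.
have H3 : 2 * D ^ 3 * D.+1 <= 4 * D ^ 4.
  by case: D {le_D H2 e2} => [//|D]; rewrite !expnS expn0; nia.
rewrite (leq_trans H3) // (_ : 2 ^ 8 = 256) //.
by move: H H2 H3; rewrite e1 e2; lia.
Qed.

(** For Q = D / d0, with d0 the least part, largeness gives Q^3 <= 8 D. There are at most [Q] parts,
    each costs O(Q log D), and Q^2 log D = O(D). The constant is 15 * 8 + 8. *)
Lemma loss_le l rho (D := sumn l + rho) : l != [::] -> large_parts l rho ->
  \sum_(d <- undup l) ((digits d).+1 * (D %/ d) + bitlen D * count_mem d l)
  <= 128 * D.
Proof.
move=> l0 lP.
have [d0 d0l min_d0] : exists2 d0, d0 \in l & {in l, forall d, d0 <= d}.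
  case: l l0 {lP D} => [//|x l] _; exists (foldr minn x l).
    elim: l => [|z l IH] /=; first by rewrite mem_head.
    rewrite !inE in IH *; case: leqP => _; first by rewrite eqxx orbT.
    by case/orP: IH => [->|->]; rewrite ?orbT.
  move=> d; elim: l => [|z l IH] /=; first by rewrite inE => /eqP ->.
  rewrite !inE in IH *; case/or3P=> [dx|/eqP ->|dl].
  - by rewrite geq_min IH ?dx ?orbT.
  - by rewrite geq_min leqnn.
  - by rewrite geq_min IH ?dl ?orbT.
have lP' d : d \in l -> rho < d /\ D ^ 2 <= 8 * d ^ 3.
  by move=> dl; move/allP: lP => /(_ d dl) /andP[].
have [rho_d0 D_d0] := lP' _ d0l.
have d0_gt0 : 0 < d0 by apply: leq_ltn_trans rho_d0.
have D0 : 0 < D by rewrite (leq_trans d0_gt0) // (leq_trans (leq_mem_sumn d0l)) // leq_addr.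
pose Q := D %/ d0; pose L := bitlen D.
have szQ : size l <= Q.
  rewrite leq_divRL // (leq_trans _ (leq_addr _ _)) //.
  elim: l min_d0 {l0 lP D D0 Q L lP' d0l D_d0} => [//|x l IH] min_d0 /=.
  rewrite mulSn leq_add ?min_d0 ?mem_head // IH // => d dl.
  by rewrite min_d0 // inE dl orbT.
have Q3 : Q ^ 3 <= 8 * D.
  have le_Q : Q * d0 <= D by apply: leq_divM.
  have : Q ^ 3 * d0 ^ 3 <= D ^ 3 by rewrite -expnMn leq_exp2r.
  have -> : D ^ 3 = D ^ 2 * D by ring.
  move=> H; rewrite -(leq_pmul2r (_ : 0 < D ^ 2)) ?expn_gt0 ?D0 //.
  apply: (@leq_trans (Q ^ 3 * (8 * d0 ^ 3))); first by rewrite leq_mul2l D_d0 orbT.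
  by rewrite mulnCA -mulnA leq_mul2l /= mulnC (leq_trans _ (_ : D ^ 2 * D <= _)) // mulnC.
have L3 : L ^ 3 <= 8 * D by apply: bitlen_cube.
have L0 : 0 < L by [].
have QQL : Q ^ 2 * L <= 8 * D.
  have [LQ|QL] := leqP L Q; first by rewrite (leq_trans _ Q3) // (expnSr Q 2) leq_mul2l LQ orbT.
  by rewrite (leq_trans _ L3) // (expnSr L 2) leq_mul2r leq_exp2r // (ltnW QL) orbT.
rewrite big_split /= -big_distrr /=.
have -> : \sum_(d <- undup l) count_mem d l = size l.
  rewrite -sum1_size -(sum_undup (fun=> 1)).
  by apply: eq_bigr => d _; rewrite muln1.
have le1 : \sum_(d <- undup l) (digits d).+1 * (D %/ d) <= Q * (15 * L * Q).
  apply: (@leq_trans (\sum_(d <- undup l) 15 * L * Q)).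
    rewrite !big_seq; apply: leq_sum => d; rewrite mem_undup => dl.
    apply: leq_mul; last by rewrite leq_div2l // min_d0.
    have : bitlen d <= L.
      by rewrite bitlen_le // (leq_trans (leq_mem_sumn dl)) // leq_addr.
    by rewrite /digits; lia.
  rewrite big_const_seq count_predT iter_addn_0 mulnC leq_mul2r.
  by rewrite (leq_trans (size_undup l)) ?szQ ?orbT.
have le2 : L * size l <= L * Q by rewrite leq_mul2l szQ orbT.
rewrite (leq_trans (leq_add le1 le2)) //.
by nia.
Qed.

End LargeParts.

(** * Generic exponentials *)

Section GenericExponential.
Variables (R : realType) (K : fieldType) (nrm : K -> R).
Hypothesis K_char0 : [pchar K] =i pred0.
Hypothesis nrmP : nontrivial_norm nrm.
Variables (al : K) (e : nat -> nat).
Hypothesis al8 : 8 <= nrm al.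
Implicit Types (w : nat -> nat) (X l : seq nat) (D d : nat).

Let al2 : 2 <= nrm al. Proof. by rewrite (le_trans _ al8) // ler_nat. Qed.
Let al1 : 1 <= nrm al. Proof. by rewrite (le_trans _ al2) // ler1n. Qed.
Let al0 : 0 < nrm al. Proof. by rewrite (lt_le_trans ltr01). Qed.

Definition gcoef w d : K :=
  if d == 0%N then 0 else al ^+ e d * binary_point al (digits d) (w d).

Definition masked w X d : K := if d \in X then 0 else gcoef w d.

Definition EX w X : nat -> K := cf (expser (ser (masked w X))).

Lemma masked0 w X : masked w X 0 = 0.
Proof. by rewrite /masked /gcoef eqxx if_same. Qed.

Lemma cf_expser_eq (g h : fps K 1) D :
  (forall i, (i <= D)%N -> cf g i = cf h i) ->
  cf (expser g) D = cf (expser h) D.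
Proof.
move=> gh; rewrite !cf_ser; apply: eq_bigr => j _; congr (_ * _).
apply/eqP; rewrite -subr_eq0 -cfB subrXX; apply/eqP.
have ghO : ordge D.+1 (g - h) by apply/ordge1P => i lti; rewrite cfB gh // subrr.
have := ordgeM ghO (@ordge0 _ _ (\sum_(i < j) g ^+ (j.-1 - i) * h ^+ i)).
by move/ordge1P; apply; rewrite addn0.
Qed.

Lemma EX_eq w w' X X' D :
  (forall i, (i <= D)%N -> masked w X i = masked w' X' i) -> EX w X D = EX w' X' D.
Proof. by move=> mm; apply: cf_expser_eq => i le_i; rewrite !cf_ser mm. Qed.

Lemma EX_split w X d D : (0 < d)%N -> d \notin X ->
  EX w X D = \sum_(q < (D %/ d)%N.+1)
    gcoef w d ^+ q * ((q`!%:R)^-1 * EX w (rcons X d) (D - q * d)).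
Proof.
move=> d0 dX.
transitivity (cf (expser (monoser d (gcoef w d) + ser (masked w (rcons X d)))) D).
  2: by apply: cf_expser_split => //; rewrite cf_ser masked0.
apply: cf_expser_eq => i _; rewrite cfD !cf_ser /masked mem_rcons inE.
by case: (eqVneq i d) => [->|_]; rewrite ?(negPf dX) ?addr0 ?add0r.
Qed.

(** For [d] outside [X], the D-th coefficient is a polynomial in b_d of degree at most D / d, and
    the right-hand side is the norm of its [mu]-th coefficient, in which the part [d] is absent from
    the exponential. The event is that this polynomial is much smaller than its coefficient. *)
Definition bad_event w X d D mu :=
  nrm (EX w X D) * (3 + 2 * nrm al ^+ digits d) ^+ (D %/ d)%N <
  nrm al ^+ (e d * mu) * (nrm (mu`!%:R))^-1 * nrm (EX w (rcons X d) (D - mu * d)).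

Lemma few_bad_values w X d D mu : (0 < d)%N -> d \notin X -> (mu * d <= D)%N ->
  (\sum_(t < 2 ^ digits d) bad_event (upd w d t) X d D mu <= D %/ d)%N.
Proof.
move=> d0 dX le_mu; pose b t := binary_point al (digits d) t.
pose bad t := bad_event (upd w d t) X d D mu.
pose s := [seq b (val t) | t <- enum 'I_(2 ^ digits d) & bad (val t)].
have bI : {in [pred t | (t < 2 ^ digits d)%N] &, injective b}.
  move=> t u; rewrite !inE => ltt ltu ebb; apply/eqP; apply: contraT => tu.
  have := binary_point_sep nrmP al2 ltt ltu tu.
  by rewrite -/(b t) -/(b u) ebb subrr (nrm0 nrmP) ler10.
have -> : (\sum_(t < 2 ^ digits d) bad t)%N = size s.
  rewrite size_map -sum1_size big_filter big_enum_cond [RHS]big_mkcond /=.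
  by apply: eq_bigr => t _; case: (bad _).
pose c q : K := (al ^+ e d) ^+ q * ((q`!%:R)^-1 * EX w (rcons X d) (D - q * d)).
pose Q := \poly_(q < (D %/ d).+1) c q.
have QE t : Q.[b t] = EX (upd w d t) X D.
  rewrite horner_poly (EX_split _ _ d0 dX); apply: eq_bigr => q _.
  rewrite /gcoef /upd eqxx gtn_eqF // exprMn mulrAC /c; congr (_ * _ * _).
  congr (_ * _); apply: EX_eq => i _; rewrite /masked mem_rcons inE /gcoef /upd.
  by case: eqP.
apply: (@few_small_values _ _ _ nrmP (nrm al ^+ digits d) (D %/ d) Q s mu).
- by rewrite exprn_ge0 // ltW.
- exact: size_poly.
- rewrite map_inj_in_uniq; first by apply: filter_uniq; exact: enum_uniq.
  by move=> t u _ _ ebb; apply: val_inj; apply: bI => //; rewrite inE ltn_ord.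
- move=> x /mapP[t _ ->]; rewrite (le_trans (binary_point_le nrmP _ _ al2)) //.
  by rewrite lerBlDr lerDl.
- move=> x y /mapP[t _ ->] /mapP[u _ ->] ne_b.
  apply: binary_point_sep => //; rewrite ?ltn_ord //.
  by apply/eqP => etu; rewrite etu eqxx in ne_b.
move=> x /mapP[t]; rewrite mem_filter => /andP[bt _] ->; rewrite QE.
rewrite coef_poly ltnS leq_divRL // le_mu /c -exprM (nrmM nrmP) mulrCA mulrA.
rewrite (nrmX nrmP) (nrmM nrmP) (nrmV nrmP).
suff -> : EX w (rcons X d) (D - mu * d) = EX (upd w d t) (rcons X d) (D - mu * d).
  by move: bt; rewrite /bad /bad_event -mulrA mulrCA mulrA.
apply: EX_eq => i _; rewrite /masked mem_rcons inE /gcoef /upd.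
by case: eqP.
Qed.

Lemma bad_event_local w w' X d D mu N : (D <= N)%N ->
  (forall i, (i <= N)%N -> w i = w' i) -> bad_event w X d D mu = bad_event w' X d D mu.
Proof.
move=> le_DN eqw; have H Y D' : (D' <= N)%N -> EX w Y D' = EX w' Y D'.
  move=> le_D'; apply: EX_eq => i le_i; rewrite /masked /gcoef eqw //.
  exact: leq_trans le_D'.
by rewrite /bad_event !H // (leq_trans (leq_subr _ _)).
Qed.

Let wsum (mu : nat -> nat) l : nat := (\sum_(x <- l) mu x * x)%N.

(** The parts of [l] are removed in order, each with its multiplicity; every step loses at most the
    factor allowed by a good event, and the factors multiply. *)
Lemma good_chain w l mu D N rho : (D <= N)%N ->
  (forall p d s, l = p ++ d :: s ->
     ~~ bad_event w p d (D - wsum mu p) (mu d)) ->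
  (D - wsum mu l)%N = rho ->
  \prod_(d <- l) nrm al ^+ (e d * mu d) * nrm (EX w l rho) <=
  nrm (EX w [::] D) * \prod_(d <- l)
    ((3 + 2 * nrm al ^+ digits d) ^+ (N %/ d)%N * nrm (mu d)`!%:R).
Proof.
move=> le_DN good defrho.
pose c d := (3 + 2 * nrm al ^+ digits d) ^+ (N %/ d)%N * nrm (mu d)`!%:R.
suff H p s : l = p ++ s ->
    \prod_(d <- s) nrm al ^+ (e d * mu d) * nrm (EX w l rho) <=
    nrm (EX w p (D - wsum mu p)) * \prod_(d <- s) c d.
  by have := H [::] l erefl; rewrite /wsum big_nil subn0.
elim: s p => [|d s IH] p; first by rewrite cats0 => <-; rewrite !big_nil mul1r mulr1 defrho.
move=> defl; have {}IH := IH (rcons p d); rewrite cat_rcons in IH.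
have {IH} := IH defl; have := good _ _ _ defl; rewrite /bad_event -leNgt.
have -> : (D - wsum mu (rcons p d) = D - wsum mu p - mu d * d)%N.
  by rewrite /wsum big_rcons /= subnDA.
rewrite !big_cons; set a := nrm al ^+ _; set b := nrm (EX w p _).
set x := nrm (EX w (rcons p d) _); set y := nrm (EX w l rho).
set u := \prod_(j <- s) _; set v := \prod_(j <- s) _ => bad_d IH.
set f := nrm (mu d)`!%:R in bad_d; have f0 : 0 < f by rewrite (nrm_gt0 nrmP) fact_neq0.
have a0 : 0 <= a by rewrite exprn_ge0 // ltW.
have v0 : 0 <= v.
  rewrite prodr_ge0 // => j _; rewrite mulr_ge0 ?(nrm_ge0 nrmP) // exprn_ge0 //.
  by rewrite addr_ge0 // mulr_ge0 // exprn_ge0 // ltW.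
apply: (@le_trans _ _ (a * (x * v))); first by rewrite -mulrA ler_wpM2l.
have le_ax : a * x <= b * c d.
  rewrite mulrAC ler_pdivrMr // in bad_d; rewrite (le_trans bad_d) //.
  rewrite /c mulrA ler_wpM2r ?(ltW f0) // ler_wpM2l ?(nrm_ge0 nrmP) //.
  apply: ler_weXn2l; last by rewrite leq_div2r // (leq_trans (leq_subr _ _)).
  have := exprn_ge0 (digits d) (ltW al0); lra.
by rewrite mulrA [leRHS]mulrA ler_wpM2r.
Qed.

Lemma fact_le_exp k n : (k <= n)%N -> (k`! <= n ^ k)%N.
Proof.
elim: k => [//|k IH] le_kn; rewrite factS expnS leq_mul // IH //.
exact: ltnW.
Qed.

(** Since |al| >= 8, 3 + 2 |al|^k <= |al|^(k + 1); and |m!| <= |al|^(m [bitlen D]) for a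
    multiplicity m <= D. All losses become powers of |al| with the exponents of [loss_le]. *)
Lemma loss_prod_le l rho (D := (sumn l + rho)%N) :
  l != [::] -> large_parts l rho ->
  \prod_(d <- undup l) ((3 + 2 * nrm al ^+ digits d) ^+ (D %/ d)%N *
     nrm (count_mem d l)`!%:R) <= nrm al ^+ (128 * D).
Proof.
move=> l0 lP; apply: le_trans (ler_weXn2l al1 (loss_le l0 lP)).
rewrite -prodrXr !big_seq; apply: ler_prod => d; rewrite mem_undup => dl.
have pow0 k : 0 < nrm al ^+ k by rewrite exprn_gt0.
rewrite mulr_ge0 ?(nrm_ge0 nrmP) ?exprn_ge0 //=; last first.
  by rewrite addr_ge0 // mulr_ge0 // ltW.
rewrite exprD; apply: ler_pM; rewrite ?(nrm_ge0 nrmP) ?exprn_ge0 //.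
- by rewrite addr_ge0 // mulr_ge0 // ltW.
- rewrite exprM lerXn2r ?nnegrE ?(ltW (pow0 _)) //.
    by rewrite addr_ge0 // mulr_ge0 // ltW.
  rewrite exprS; have : 1 <= nrm al ^+ digits d by rewrite exprn_ege1.
  by move: al8; nra.
have leD : (count_mem d l <= D)%N.
  have d0 : (0 < d)%N by move/allP: lP => /(_ d dl) /andP[]; case: d {dl}.
  apply: (@leq_trans (sumn l)); last exact: leq_addr.
  have := sum_undup id l; rewrite (big_rem d) ?mem_undup //= -sumnE => <-.
  by rewrite (leq_trans _ (leq_addr _ _)) // leq_pmulr.
apply: (le_trans (nrm_nat_le nrmP _)).
have /(fact_le_exp) : (count_mem d l <= 2 ^ bitlen D)%N.
  by rewrite (leq_trans leD) // ltnW // ltn_bitlen.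
rewrite -expnM -(ler_nat R) => /le_trans; apply.
by rewrite natrX lerXn2r // nnegrE // ltW.
Qed.

End GenericExponential.

Lemma notin_take_index (T : eqType) (x : T) (s : seq T) : x \notin take (index x s) s.
Proof.
elim: s => [//|z s IH] /=; case: ifP => [//|zx] /=.
by rewrite inE negb_or IH andbT eq_sym zx.
Qed.

Lemma cat_take_index (T : eqType) (x : T) (s : seq T) : x \in s ->
  s = take (index x s) s ++ x :: drop (index x s).+1 s.
Proof.
move=> xs; rewrite -{1}(cat_take_drop (index x s) s); congr (_ ++ _).
by rewrite (drop_nth x) ?index_mem // nth_index.
Qed.

Section GenericLarge.
Variables (R : realType) (K : fieldType) (nrm : K -> R).
Hypothesis K_char0 : [pchar K] =i pred0.
Hypothesis nrmP : nontrivial_norm nrm.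
Variables (al : K) (e : nat -> nat).
Hypothesis al8 : 8 <= nrm al.

(* If removing a part d from the exponential decreased its D-th coefficient too
   much, this coefficient, a polynomial in the coordinate b_d, would be small at
   b_d without being small everywhere. This is so for few of the values of b_d,
   so some choice of all the b_d avoids it for all D and d. *)
Lemma generic_exponential_large (y : nat -> nat) : y 0%N = 0%N ->
  (forall D, (0 < D)%N -> exists l rho, [/\ l != [::], large_parts l rho,
     D = (sumn l + rho)%N & y D = (weight e l + y rho)%N]) ->
  exists w, forall D,
    nrm al ^+ y D <= nrm (EX al e w [::] D) * nrm al ^+ (256 * D).
Proof.
move=> y0 yP.
have al1 : 1 <= nrm al by rewrite (le_trans _ al8) // ler1n.
have al0 : 0 < nrm al by rewrite (lt_le_trans ltr01).
have H D : exists p : seq nat * nat, (0 < D)%N -> [/\ p.1 != [::], large_parts p.1 p.2,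
     D = (sumn p.1 + p.2)%N & y D = (weight e p.1 + y p.2)%N].
  have [->|D0] := posnP D; first by exists ([::], 0%N).
  by have [l [rho lP]] := yP D D0; exists (l, rho).
have {H} [P PP] := boolp.choice H.
pose I D := if D == 0%N then [::] else undup (P D).1.
pose mu D d := count_mem d (P D).1.
pose tot D s := (\sum_(x <- s) mu D x * x)%N.
pose pre D d := take (index d (I D)) (I D).
(* Failure at the part [d] of the optimal splitting of [D], when the parts before it have been
   removed. *)
pose Bad D d w := bad_event nrm al e w (pre D d) d (D - tot D (pre D d)) (mu D d).
have IP D d : d \in I D ->
    [/\ (0 < D)%N, d \in (P D).1, (0 < d)%N, (d <= D)%N & (D ^ 2 <= 8 * d ^ 3)%N].
  rewrite /I; case: posnP => // D0; rewrite mem_undup => dl.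
  have [_ lP eD _] := PP D D0; move/allP: (lP) => /(_ d dl) /andP[ltd].
  rewrite -eD => le_D; split=> //; first by case: d {dl le_D} ltd.
  by rewrite eD (leq_trans (leq_mem_sumn dl)) // leq_addr.
have totI D : (0 < D)%N -> (tot D (I D) + (P D).2 = D)%N.
  move=> D0; have [_ _ eD _] := PP D D0; rewrite [RHS]eD; congr addn.
  by rewrite /tot /I gtn_eqF // (sum_undup id) sumnE.
have Iuniq D : uniq (I D) by rewrite /I; case: ifP => // _; apply: undup_uniq.
have totI_le D d : d \in I D -> (tot D (pre D d) + mu D d * d <= D)%N.
  move=> dI; have [D0 _ _ _ _] := IP D d dI.
  rewrite -[leqRHS](totI D D0) /tot [in leqRHS](cat_take_index dI) big_cat big_cons /=.
  by rewrite !addnA -addnA leq_addr.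
have le_md D d : D \in [pred D | d \in I D] -> D%:R / (2 ^ digits d)%:R <=
     (2 * D ^ 2 * D.+1)%:R^-1 :> R.
  rewrite inE => /IP[D0 _ _ _ /digits_large le_dig].
  have D0' : 0 < D%:R :> R by rewrite ltr0n.
  rewrite ler_pdivrMr ?ltr0n ?expn_gt0 // mulrC ler_pdivlMr ?ltr0n //; last first.
    by rewrite !muln_gt0 ?expn_gt0 D0.
  by rewrite -natrM ler_nat (leq_trans _ le_dig) //; nia.
have szI D : (size (I D) <= D)%N.
  rewrite /I; case: posnP => // D0; rewrite (leq_trans (size_undup _)) //.
  have [_ lP eD _] := PP D D0.
  rewrite [leqRHS]eD (leq_trans _ (leq_addr _ _)) //.
  have : all (leq 1) (P D).1.
    by apply/allP => d dl; move/allP: lP => /(_ d dl) /andP[+ _]; case: d {dl}.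
  by elim: (P D).1 => [//|x l IHl] /= /andP[x0 /IHl le_l]; rewrite -[_.+1]add1n leq_add.
have [||||||w wM good] := @selection R (fun d => 2 ^ digits d)%N I Bad id 2^-1.
- by move=> i; rewrite expn_gt0.
- by move=> D d /IP[].
- move=> D d w w' eqw.
  exact: (bad_event_local nrm al e _ _ _ (leq_subr _ _) eqw).
- move=> D d w dI; have [D0 _ d0 _ _] := IP D d dI.
  apply: leq_trans (few_bad_values K_char0 nrmP _ al8 w d0 (notin_take_index d (I D)) _) _.
    by have := totI_le D d dI; rewrite /pre; lia.
  by rewrite (leq_trans (leq_div _ _)) // leq_subr.
(* At most [D] events for each [D], each of probability at most 1 / (2 D^2 (D + 1)): the sum
   telescopes and stays below 1 / 2. *)
- case=> [|N]; first by rewrite big_ord0 invr_ge0.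
  apply: (@le_trans _ _ (2^-1 - (2 * N.+1)%:R^-1)); last by rewrite gerBl invr_ge0.
  elim: N => [|N IHN]; first by rewrite big_ord1 muln1 subrr /I eqxx big_nil.
  rewrite big_ord_recr /=; set M := N.+1 in IHN *.
  have le1 : \sum_(d <- I M) M%:R / (2 ^ digits d)%:R <= (2 * M)%:R^-1 - (2 * M.+1)%:R^-1 :> R.
    apply: (@le_trans _ _ (\sum_(d <- I M) (2 * M ^ 2 * M.+1)%:R^-1)).
      by rewrite !big_seq; apply: ler_sum => d dI; apply: le_md.
    rewrite big_const_seq count_predT iter_addr_0 -[_ *+ _]mulr_natl.
    apply: (@le_trans _ _ (M%:R * (2 * M ^ 2 * M.+1)%:R^-1)).
      by rewrite ler_wpM2r ?invr_ge0 // ler_nat.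
    rewrite le_eqVlt; apply/orP; left; apply/eqP.
    have n0 : M%:R != 0 :> R by rewrite pnatr_eq0.
    have : M.+1%:R != 0 :> R by rewrite pnatr_eq0.
    rewrite -mulnn !natrM -[M.+1%:R]natr1 => n1.
    by field; rewrite n0 n1.
  by have := lerD IHN le1; rewrite addrA subrK.
- by rewrite invf_lt1 ?ltr1n.
exists w; elim/ltn_ind => D IHD.
have [->|D0] := posnP D; first by rewrite y0 muln0 !expr0 mulr1 /EX cf_expser0 (nrm1 nrmP).
have [l0 lP eD yE] := PP D D0.
have ID : I D = undup (P D).1 by rewrite /I gtn_eqF.
have goodP p d s : I D = p ++ d :: s ->
    ~~ bad_event nrm al e w p d (D - tot D p) (mu D d).
  move=> eI; have dI : d \in I D by rewrite eI mem_cat mem_head orbT.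
  have := good D d dI; rewrite /Bad; suff -> : pre D d = p by [].
  have := Iuniq D; rewrite /pre eI cat_uniq => /and3P[_ /hasPn /(_ d)].
  rewrite mem_head => /(_ isT) dp _.
  by rewrite index_cat (negPf dp) /= eqxx addn0 take_size_cat.
have remP : (D - tot D (I D))%N = (P D).2 by rewrite -{1}(totI D D0) addKn.
have chain := good_chain K_char0 nrmP al8 (leqnn D) goodP remP.
have loss := loss_prod_le nrmP al8 l0 lP; rewrite -eD -ID in loss.
(* The remainder is below every part, and there is a part. Hence 128 D + 256 rho <= 256 D, which
   closes the induction. *)
have rhoD : (2 * (P D).2 <= D)%N.
  case El: (P D).1 l0 lP eD => [//|d l] _ /andP[/andP[ltd _] _] /=; lia.
(* The removed parts all exceed rho and do not affect the coefficient of degree rho. *)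
have EXr : EX al e w (I D) (P D).2 = EX al e w [::] (P D).2.
  apply: EX_eq => i le_i; rewrite /masked /=; case: ifP => // iI.
  move: iI; rewrite ID mem_undup => /(allP lP) /andP[]; lia.
have lhs : \prod_(d <- I D) nrm al ^+ (e d * mu D d) = nrm al ^+ weight e (P D).1.
  rewrite prodrXr /weight -(sum_undup e) ID; congr (_ ^+ _).
  by apply: eq_bigr => d _; rewrite mulnC.
have rD : ((P D).2 < D)%N by lia.
have IHr := IHD _ rD.
rewrite lhs EXr in chain; rewrite yE exprD.
set x := nrm (EX al e w [::] D) in chain *; set z := nrm (EX al e w [::] (P D).2) in chain IHr.
have pow0 k : 0 <= nrm al ^+ k by rewrite exprn_ge0 // ltW.
apply: (@le_trans _ _ (nrm al ^+ weight e (P D).1 * (z * nrm al ^+ (256 * (P D).2)))).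
  by rewrite ler_wpM2l.
rewrite mulrA; apply: (@le_trans _ _ (x * nrm al ^+ (128 * D) * nrm al ^+ (256 * (P D).2))).
  rewrite ler_wpM2r //; apply: (le_trans chain).
  by rewrite ler_wpM2l ?(nrm_ge0 nrmP).
rewrite -mulrA -exprD ler_wpM2l ?(nrm_ge0 nrmP) // ler_weXn2l //.
by lia.
Qed.

End GenericLarge.

(** * Rates as powers of a scalar, and their closure under large parts *)

Section GrowthExponents.
Variables (R : realType) (K : fieldType) (nrm : K -> R).
Hypothesis K_char0 : [pchar K] =i pred0.
Hypothesis nrmP : nontrivial_norm nrm.
Variables (n : nat) (A : {pred fps K n.+1}).
Hypothesis A_alg : GRing.subalg_closed A.
Hypothesis A_maj : majorization_closed nrm A.
Hypothesis A_ift : implicit_function_closed nrm A.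
Variable al : K.
Hypothesis al8 : 8 <= nrm al.
Implicit Types (e y : nat -> nat).

Let al1 : 1 <= nrm al. Proof. by rewrite (le_trans _ al8) // ler1n. Qed.
Let al0 : 0 < nrm al. Proof. by rewrite (lt_le_trans ltr01). Qed.

Definition grE e := growth nrm A (fun D => nrm al ^+ e D).

Lemma grE_mono e y D0 : grE y -> (forall D, (D0 <= D)%N -> (e D <= y D)%N) -> grE e.
Proof.
move=> gy le_ey; apply: (growth_mono gy (D0 := D0)) => D leD.
by rewrite ler_weXn2l // le_ey.
Qed.

Lemma grE_affine e a b : grE e -> grE (fun D => e D + a * D + b)%N.
Proof.
move=> ge.
have := growth_scale nrmP A_alg (al ^+ b)
  (growth_rescale nrmP A_alg A_ift (exprn_ge0 a (ltW al0)) ge).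
move=> g; apply: growth_le g _ => D.
by rewrite (nrmX nrmP) -exprM -!exprD addnC [(e D + _)%N]addnC.
Qed.

Lemma grE_max e y : grE e -> grE y -> grE (fun D => maxn (e D) (y D)).
Proof.
move=> ge gy; have g := growthD nrmP A_alg A_maj ge gy.
apply: growth_le g _ => D; case: leqP => _; rewrite ?lerDl ?lerDr exprn_ge0 //; exact: ltW.
Qed.

Lemma grE_of_growth r : growth nrm A r ->
  exists2 e, grE e & forall D, r D <= nrm al ^+ e D.
Proof.
move=> /(growth_coef nrmP A_alg)[c gc le_r].
have ex D : exists k, nrm (c D) <= nrm al ^+ k.
  by apply: exp_ge_of_gt1; rewrite (lt_le_trans _ al8) // ltr1n.
pose e D := ex_minn (ex D).
exists e => [|D]; last by rewrite /e; case: ex_minnP => k le_k _; apply: le_trans (le_r D) le_k.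
have g1 := growth_geometric nrmP A_alg A_ift 1.
have g := growthD nrmP A_alg A_maj (growth_scale nrmP A_alg al gc) g1.
apply: growth_le g _ => D; rewrite /e; case: ex_minnP => -[|k] _ mink.
  by rewrite expr0 expr1n lerDr mulr_ge0 ?(nrm_ge0 nrmP).
rewrite expr1n (le_trans _ (_ : nrm al * nrm (c D) <= _)) ?lerDl ?ler01 //.
rewrite exprS ler_wpM2l ?(ltW al0) // leNgt; apply/negP => lt_c.
by have := mink k (ltW lt_c); rewrite ltnn.
Qed.

Theorem large_parts_closure e : grE e -> exists2 y, grE y &
  forall l rho, large_parts l rho ->
    (weight e l + y rho <= y (sumn l + rho))%N.
Proof.
move=> ge; have [y [y0 le_y yP]] := best_split e.
exists y => //.
have [w wP] := generic_exponential_large K_char0 nrmP al8 y0 yP.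
have gE : growth nrm A (nrm \o gcoef al e w).
  apply: growth_le (grE_affine 6 14 ge) _ => d /=.
  rewrite /gcoef; case: eqP => [_|_]; first by rewrite (nrm0 nrmP) exprn_ge0 // ltW.
  rewrite (nrmM nrmP) (nrmX nrmP) -addnA exprD ler_wpM2l ?exprn_ge0 ?(ltW al0) //.
  rewrite (le_trans (binary_point_le nrmP _ _ _)) ?(le_trans _ al8) ?ler_nat //.
  rewrite (@le_trans _ _ (nrm al ^+ digits d)) ?gerBl // ler_weXn2l //.
  by have := bitlen_leS d; rewrite /digits; lia.
have := growth_exp K_char0 nrmP A_alg A_maj A_ift _ gE.
rewrite /gcoef eqxx => /(_ erefl) gX.
have g := growth_rescale nrmP A_alg A_ift (exprn_ge0 256 (ltW al0)) gX.
apply: growth_le g _ => D; rewrite -exprM mulrC.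
apply: le_trans (wP D) _; rewrite ler_wpM2r ?exprn_ge0 ?(ltW al0) //.
Qed.

End GrowthExponents.

(** * Powers of the parts of record rate *)

Section RecordRates.
Local Open Scope nat_scope.
Variable k : nat -> nat.

(** Maximality on the whole range below 2 G, and not just up to [G], is what forces records to
    double. *)
Definition record_rate G := (0 < G) &&
  all (fun d => (k d <= k G) && ((d < G) ==> (k d < k G))) (iota 1 (2 * G).-1).

Lemma record_rateP G : reflect (0 < G /\ forall d, 0 < d -> d < 2 * G ->
    k d <= k G /\ (d < G -> k d < k G)) (record_rate G).
Proof.
apply: (iffP andP) => -[G0 GP]; split=> //.
  move=> d d0 lt_d.
  move/allP: GP => /(_ d); rewrite mem_iota.
  by case/(_ ltac:(lia))/andP => -> /implyP.
apply/allP => d; rewrite mem_iota => /andP[d0 lt_d].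
by have [|-> lt_k] := GP d d0; [lia | apply/implyP].
Qed.

Lemma record_rate_double G G' : record_rate G -> record_rate G' -> G < G' -> 2 * G <= G'.
Proof.
move=> /record_rateP[G0 GP] /record_rateP[G'0 GP'] lt_G.
rewrite leqNgt; apply/negP => /(GP _ G'0)[le_k _].
by have [|_ /(_ lt_G)] := GP' G G0; [lia | lia].
Qed.

End RecordRates.

Lemma mulnS_lt_exp16 j : (j.+1 * j < 16 ^ j)%N.
Proof. by elim: j => [//|j IHj]; rewrite expnS; nia. Qed.

Section PowerParts.
Variables (R : realType) (K : fieldType) (nrm : K -> R).
Hypothesis K_char0 : [pchar K] =i pred0.
Hypothesis nrmP : nontrivial_norm nrm.
Variables (al : K) (k : nat -> nat).
Implicit Types (D G N : nat).

(* Record rates at least double, so that the expansion of the product has at most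
   one term in each degree and its coefficients are controlled without
   cancellation. Minus its logarithmic derivative, [record_log], contains all the
   geometric sequences al^(q G k_G) x^(q G) at once. *)
Definition record_prod N : fps K 1 :=
  \prod_(G < N.+1 | record_rate k G) (1 - monoser G (al ^+ (G * k G))).

(** Coefficients of (theta z) / (1 - z) for z = al^(G k_G) x^G. *)
Definition power_coef G D : K :=
  if (0 < D)%N && (G %| D)%N then G%:R * al ^+ (D * k G) else 0.

Definition record_log N : fps K 1 :=
  \sum_(G < N.+1 | record_rate k G) ser (power_coef G).

Lemma power_coefP G : (0 < G)%N ->
  (1 - monoser G (al ^+ (G * k G))) * ser (power_coef G) =
  theta (monoser G (al ^+ (G * k G))).
Proof.
move=> G0; apply: cf_inj => D; rewrite mulrBl mul1r cfB cf_monoserM cf_theta !cf_ser.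
rewrite /power_coef; case: (ltngtP D G) => [ltD|ltG|->].
- rewrite /= subr0 mulr0; case: posnP => //= D0.
  by rewrite gtnNdvd.
- rewrite /= subn_gt0 ltG (ltn_trans _ ltG) //= mulr0.
  rewrite dvdn_subl ?(ltnW ltG) //; case: ifP => _; last by rewrite mulr0 subr0.
  by rewrite mulrCA -exprD -mulnDl subnKC ?subrr // ltnW.
by rewrite /= subnn dvdnn G0 /= mulr0 subr0.
Qed.

Lemma theta_record_prod N : theta (record_prod N) = - (record_log N * record_prod N).
Proof.
rewrite /record_prod /record_log; elim: N.+1 => [|M IH].
  by rewrite !big_ord0 theta1 mul0r oppr0.
rewrite ![\prod_(G < M.+1 | _) _]big_mkcond ![\sum_(G < M.+1 | _) _]big_mkcond.
rewrite !big_ord_recr -!big_mkcond /=; case: ifP => [recM|_]; last first.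
  by rewrite mulr1 addr0.
set z := monoser _ _; set P := \prod_(_ < _ | _) _ in IH *; set L := \sum_(_ < _ | _) _ in IH *.
have /record_rateP[M0 _] := recM; rewrite thetaM IH -[1 - z]addrC thetaD theta1 addr0.
have -> : theta (- z) = - theta z by rewrite -scaleN1r thetaZ scaleN1r.
rewrite -(power_coefP M0) -/z [- z + 1]addrC; set u := 1 - z.
rewrite mulNr mulrN -opprD [(L + _) * _]mulrDl; congr (- (_ + _)); first by rewrite mulrA.
by rewrite mulrA mulrC.
Qed.

Lemma cf_record_prodS N D : cf (record_prod N.+1) D =
  if record_rate k N.+1 then cf (record_prod N) D -
    (if (N.+1 <= D)%N then al ^+ (N.+1 * k N.+1) * cf (record_prod N) (D - N.+1) else 0)
  else cf (record_prod N) D.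
Proof.
rewrite /record_prod !(big_mkcond (fun G : 'I__ => record_rate k G)) big_ord_recr /=.
by case: ifP => _; rewrite ?mulr1 // mulrC mulrBl mul1r cfB cf_monoserM.
Qed.

Lemma record_prod0 : record_prod 0 = 1.
Proof. by rewrite /record_prod big_mkcond big_ord1. Qed.

Lemma record_prod_stable N D : (D <= N)%N -> cf (record_prod N) D = cf (record_prod D) D.
Proof.
elim: N => [|N IH]; first by case: D.
rewrite leq_eqVlt => /predU1P[-> //|le_D].
by rewrite cf_record_prodS leqNgt le_D subr0 if_same IH.
Qed.

Lemma record_log_stable N D : (D <= N)%N -> cf (record_log N) D = cf (record_log D) D.
Proof.
elim: N => [|N IH]; first by case: D.
rewrite leq_eqVlt => /predU1P[-> //|le_D].
rewrite -IH // /record_log !(big_mkcond (fun G : 'I__ => record_rate k G)) big_ord_recr /=.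
rewrite cfD; case: ifP => _; last by rewrite cf0 addr0.
rewrite cf_ser /power_coef; case: posnP => [_|D0]; first by rewrite addr0.
by rewrite gtnNdvd // addr0.
Qed.

(** As records at least double, those up to [N] have a sum below the record [G]; so the product has
    degree below [G]. *)
Lemma record_prod_vanish N G D : record_rate k G -> (N < G)%N -> (G <= D)%N ->
  cf (record_prod N) D = 0.
Proof.
elim: N G D => [|N IH] G D recG ltG leD.
  by rewrite record_prod0 cf1; case: D leD => // /(leq_trans ltG).
rewrite cf_record_prodS; case: ifP => [recN|_]; last by apply: (IH G); rewrite // ltnW.
have le2 := record_rate_double recN recG ltG.
rewrite !(IH N.+1) //; try lia.
by rewrite mulr0 if_same subr0.
Qed.

(** If N + 1 is a record, the coefficient in degree D, for N + 1 <= D < 2 (N + 1), comes from the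
    new factor alone: [D] is split into the large part N + 1 and a smaller remainder. *)
Lemma record_prod_le (y : nat -> nat) : 1 <= nrm al ->
  (forall l rho, large_parts l rho ->
     (weight (fun d => d * k d) l + y rho <= y (sumn l + rho))%N) ->
  forall N D, nrm (cf (record_prod N) D) <= nrm al ^+ y D.
Proof.
move=> al1 yP; have pow0 j : 0 <= nrm al ^+ j by rewrite exprn_ge0 // (le_trans ler01).
elim=> [|N IH] D.
  rewrite record_prod0 cf1; case: eqP => _; last by rewrite (nrm0 nrmP) pow0.
  by rewrite (nrm1 nrmP) exprn_ege1.
rewrite cf_record_prodS; case: ifP => [recN|_]; last exact: IH.
case: ifP => [leD|_]; last by rewrite subr0.
rewrite (record_prod_vanish recN (ltnSn N) leD) sub0r (nrmN nrmP) (nrmM nrmP).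
have [lt2|le2] := ltnP D (2 * N.+1); last first.
  rewrite (record_prod_vanish recN (ltnSn N)) ?(nrm0 nrmP) ?mulr0 ?pow0 //.
  lia.
have := yP [:: N.+1] (D - N.+1)%N; rewrite /large_parts /= /weight big_seq1 addn0.
rewrite subnKC // => /(_ _) le_y.
apply: le_trans (ler_weXn2l al1 (le_y _)).
  rewrite exprD (nrmX nrmP) ler_wpM2l // IH.
rewrite andbT; apply/andP; split; first by lia.
nia.
Qed.

(** A larger record has a larger integer rate, so the largest record [H] dividing [D] beats the
    others by a factor |al|^D. Of this, C^D pays for |H|, which may be small, and 16^D for the at
    most D + 1 other terms, each with an integer factor of norm at most [D]. *)
Lemma record_log_large C D G : 1 <= C -> 16 * C <= nrm al ->
  (forall n, (0 < n)%N -> (nrm n%:R)^-1 <= C ^+ n) ->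
  record_rate k G -> (0 < D)%N -> (G %| D)%N ->
  nrm al ^+ (D * k G) <= nrm (cf (record_log D) D) * nrm al ^+ D.
Proof.
move=> C1 alC nC recG D0 GD.
pose P H := record_rate k H && (H %| D)%N.
have exP : exists H, P H by exists G; rewrite /P recG.
have ubP H : P H -> (H <= D)%N by case/andP=> _ /dvdn_leq; apply.
case: (ex_maxnP exP ubP) => {exP} H /andP[recH HD] maxH.
have C0 : 0 < C by rewrite (lt_le_trans ltr01).
have al16 : 16 <= nrm al by rewrite (le_trans _ alC) // -{1}[16]mulr1 ler_pM2l ?ltr0n.
have al1 : 1 <= nrm al by rewrite (le_trans _ al16) // ler1n.
have al0 : 0 < nrm al by rewrite (lt_le_trans ltr01).
have pow0 j : 0 < nrm al ^+ j by rewrite exprn_gt0.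
have ltk H' : P H' -> H' != H -> (k H' < k H)%N.
  move=> PH' neH; have ltH : (H' < H)%N by rewrite ltn_neqAle neH maxH.
  have /record_rateP[_ HP] := recH; case/andP: PH' => /record_rateP[H'0 _] _.
  by have [|_ ->] := HP H' H'0; first lia.
have /record_rateP[H0 _] := recH.
have leH : (H <= D)%N by rewrite dvdn_leq.
apply: (@le_trans _ _ (nrm al ^+ (D * k H))).
  rewrite ler_weXn2l // leq_mul2l; apply/orP; right.
  by case: (eqVneq G H) => [->//|neG]; rewrite ltnW // ltk // /P recG.
rewrite /record_log cf_sum (bigD1 (Ordinal (leH : (H < D.+1)%N))) //=.
rewrite cf_ser /power_coef D0 HD /=.
set rest := \sum_(i < _ | _) _.
have restP : nrm rest * nrm al ^+ D <= D.+1%:R * D%:R * nrm al ^+ (D * k H).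
  have le1 (i : 'I_D.+1) : record_rate k i && (i != Ordinal (leH : (H < D.+1)%N)) ->
      nrm (cf (ser (power_coef i)) D) * nrm al ^+ D <= D%:R * nrm al ^+ (D * k H).
    case/andP=> reci nei; rewrite cf_ser /power_coef D0 /=.
    case: ifP => iD; last by rewrite (nrm0 nrmP) mul0r mulr_ge0 // ltW.
    rewrite (nrmM nrmP) (nrmX nrmP) -mulrA -exprD; apply: ler_pM.
    - exact: (nrm_ge0 nrmP).
    - exact: ltW.
    - rewrite (le_trans (nrm_nat_le nrmP _)) // ler_nat -ltnS; exact: ltn_ord.
    rewrite ler_weXn2l // -mulnSr leq_mul2l ltk ?orbT //; first by rewrite /P reci.
  apply: (@le_trans _ _ (\sum_(i < D.+1 | record_rate k i && (i != Ordinal (leH : (H < D.+1)%N)))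
      D%:R * nrm al ^+ (D * k H))).
    rewrite (le_trans (ler_wpM2r (ltW (pow0 _)) (nrm_sum nrmP _ _ _))) //.
    by rewrite mulr_suml; apply: ler_sum.
  rewrite big_const iter_addr_0 -[_ *+ _]mulr_natl mulrA ler_wpM2r ?(ltW (pow0 _)) //.
  by rewrite ler_wpM2r // ler_nat (leq_trans (max_card _)) // card_ord.
have topP : nrm al ^+ (D * k H) * 16 ^+ D <= nrm (H%:R * al ^+ (D * k H)) * nrm al ^+ D.
  rewrite (nrmM nrmP) (nrmX nrmP) [X in _ <= X]mulrAC [leLHS]mulrC ler_wpM2r ?(ltW (pow0 _)) //.
  have nH : 0 < nrm H%:R by rewrite (nrm_gt0 nrmP) // (natK_neq0 K_char0) -lt0n.
  rewrite (@le_trans _ _ (nrm H%:R * (16 * C) ^+ D)) //; last first.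
    by rewrite ler_wpM2l ?(ltW nH) // lerXn2r // nnegrE ?ltW // mulr_gt0.
  rewrite exprMn mulrCA ler_peMr ?exprn_ge0 // -(mulfV (lt0r_neq0 nH)) ler_wpM2l ?(ltW nH) //.
  by rewrite (le_trans (nC H H0)) // ler_weXn2l.
have e16 : D.+1%:R * D%:R + 1 <= 16 ^+ D :> R.
  by rewrite -natrX -natrM natr1 ler_nat mulnS_lt_exp16.
have := nrm_subl nrmP (H%:R * al ^+ (D * k H)) rest => le_sub.
have le2 := ler_wpM2r (ltW (pow0 D)) le_sub; apply: le_trans le2; rewrite mulrBl.
have le3 := ler_wpM2l (ltW (pow0 (D * k H)%N)) e16.
rewrite lerBrDr (le_trans _ topP) // (le_trans _ le3) // mulrDr mulr1 addrC lerD2r.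
by rewrite (le_trans restP) // mulrC.
Qed.

End PowerParts.

Section PowerPartsGrowth.
Variables (R : realType) (K : fieldType) (nrm : K -> R).
Hypothesis K_char0 : [pchar K] =i pred0.
Hypothesis nrmP : nontrivial_norm nrm.
Variables (n : nat) (A : {pred fps K n.+1}).
Hypothesis A_alg : GRing.subalg_closed A.
Hypothesis A_maj : majorization_closed nrm A.
Hypothesis A_ift : implicit_function_closed nrm A.
Variables (al : K) (C : R).
Hypothesis C1 : 1 <= C.
Hypothesis alC : 16 * C <= nrm al.
Hypothesis nC : forall n, (0 < n)%N -> (nrm n%:R)^-1 <= C ^+ n.

Lemma power_parts (k : nat -> nat) : grE nrm A al (fun d => d * k d)%N ->
  exists2 p, grE nrm A al p & forall G D, record_rate k G -> (0 < D)%N ->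
    (G %| D)%N -> (D * k G <= p D)%N.
Proof.
have al16 : 16 <= nrm al by rewrite (le_trans _ alC) // -{1}[16]mulr1 ler_pM2l ?ltr0n.
have al8 : 8 <= nrm al by rewrite (le_trans _ al16) // ler_nat.
have al1 : 1 < nrm al by rewrite (lt_le_trans _ al8) // ltr1n.
have al0 : 0 < nrm al by rewrite (lt_trans ltr01).
move=> ge; have [y gy yP] := large_parts_closure K_char0 nrmP A_alg A_maj A_ift al8 ge.
(* A second closure in order to shift degrees: splitting D + 1 into [D] and 1 gives y D <= z (D +
   1), as required by the index [D.-1] in [growth_linear]. *)
have [z gz zP] := large_parts_closure K_char0 nrmP A_alg A_maj A_ift al8 gy.
pose v D := cf (record_prod al k D) D; pose M D := cf (record_log al k D) D.
have leV D : nrm (v D) <= nrm al ^+ y D by apply: record_prod_le => //; exact: ltW.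
have gM : growth nrm A (nrm \o M).
  apply: (@growth_linear _ _ _ nrmP _ _ A_ift v (fun D => - (D%:R * v D))).
  - by rewrite /v record_prod0 cf1 oner_eq0.
  - by rewrite mul0r oppr0.
  - by rewrite /M /record_log big_mkcond big_ord1 /= cf0.
  - apply: (growth_mono (D0 := 3) (grE_affine nrmP A_alg A_ift al8 1 1 gz)) => -[|D] // leD.
    rewrite (nrmN nrmP) (nrmM nrmP) /= mul1n -addnA exprD.
    have le_yz : (y D <= z D.+1)%N.
      have := zP [:: D] 1%N; rewrite /weight big_seq1 /= addn0 addn1 => le_z.
      rewrite (leq_trans (leq_addr (z 1%N) _)) // le_z // /large_parts /= addn0 addn1 andbT.
      by apply/andP; split; nia.
    have le_yz' : (y D.+1 <= z D.+1)%N.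
      have := zP [:: D.+1] 0%N; rewrite /weight big_seq1 /= !addn0 => le_z.
      rewrite (leq_trans (leq_addr (z 0%N) _)) // le_z // /large_parts /= !addn0 andbT.
      nia.
    apply: (@le_trans _ _ (nrm al ^+ z D.+1 * 1 + nrm al ^+ z D.+1 * D.+1%:R)).
      rewrite mulr1 lerD ?(le_trans (leV _)) ?ler_weXn2l // ?(ltW al1) //.
      rewrite mulrC ler_pM ?(nrm_ge0 nrmP) ?(nrm_nat_le nrmP) //.
      by rewrite (le_trans (leV _)) // ler_weXn2l // ltW.
    rewrite -mulrDr ler_wpM2l ?exprn_ge0 ?(ltW al0) // addrC natr1.
    apply: (@le_trans _ _ (2 ^+ (D.+1 + 1))).
      by rewrite -natrX ler_nat addn1 ltnW // ltn_expl.
    by rewrite lerXn2r ?nnegrE ?(ltW al0) // (le_trans _ al8) // ler_nat.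
  move=> D; transitivity (cf (- theta (record_prod al k D)) D).
    rewrite theta_record_prod opprK [_ * record_prod _ _ _]mulrC cfM.
    apply: eq_bigr => i _; rewrite /v /M (@record_prod_stable _ _ _ D) -1?ltnS //.
    by rewrite (@record_log_stable _ _ _ D) // leq_subr.
  by rewrite cfN cf_theta.
have [p gp pP] := grE_of_growth nrmP A_alg A_maj A_ift al8
  (growth_rescale nrmP A_alg A_ift (ltW al0) gM).
exists p => // G D recG D0 GD; rewrite -(ler_eXn2l al1) (le_trans _ (pP D)) //.
by rewrite mulrC; apply: (@record_log_large _ _ _ K_char0 nrmP _ _ C D G).
Qed.

End PowerPartsGrowth.

(** * Superadditive exponents *)

Section Exchange.
Local Open Scope nat_scope.
Implicit Types (e f y z k : nat -> nat) (l s t : seq nat).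

Lemma weight_cat e s t : weight e (s ++ t) = weight e s + weight e t.
Proof. by rewrite /weight big_cat. Qed.

Lemma weight_cons e d s : weight e (d :: s) = e d + weight e s.
Proof. by rewrite /weight big_cons. Qed.

Lemma weight_nil e : weight e [::] = 0. Proof. by rewrite /weight big_nil. Qed.

Lemma weight_nseq e q d : weight e (nseq q d) = q * e d.
Proof. by elim: q => [|q IH]; rewrite ?weight_nil //= weight_cons IH. Qed.

Lemma weight_perm e s t : perm_eq s t -> weight e s = weight e t.
Proof. by move=> st; apply: perm_big. Qed.

Lemma perm_sumn s t : perm_eq s t -> sumn s = sumn t.
Proof. by move=> st; rewrite !sumnE; apply: perm_big. Qed.

Lemma sumn_nseqE q d : sumn (nseq q d) = q * d.
Proof. by rewrite sumn_nseq mulnC. Qed.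

Lemma weight_filter e (a : pred nat) s :
  weight e s = weight e (filter a s) + weight e (filter (predC a) s).
Proof. by rewrite -weight_cat; apply: weight_perm; rewrite perm_sym perm_filterC. Qed.

Lemma sumn_filter (a : pred nat) s :
  sumn s = sumn (filter a s) + sumn (filter (predC a) s).
Proof. by rewrite -sumn_cat; apply: perm_sumn; rewrite perm_sym perm_filterC. Qed.

Lemma weight_mono e f s : all (leq 1) s -> (forall d, 0 < d -> e d <= f d) ->
  weight e s <= weight f s.
Proof.
move=> /allP s0 le_ef; rewrite /weight !big_seq; apply: leq_sum => d /s0.
exact: le_ef.
Qed.

Lemma sumn_le_size s b : all (fun d => d <= b) s -> sumn s <= size s * b.
Proof. by elim: s => [//|d s IH] /= /andP[le_d /IH le_s]; rewrite mulSn leq_add. Qed.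

(** Pigeonhole: two of the first d + 1 partial sums agree modulo [d]. *)
Lemma sublist_multiple d s : 0 < d -> d <= size s ->
  exists t u, [/\ perm_eq s (t ++ u), t != [::] & d %| sumn t].
Proof.
move=> d0 le_d; pose f i := sumn (take i s) %% d.
have : ~~ uniq [seq f i | i <- iota 0 d.+1].
  apply/negP => uf.
  have := @uniq_leq_size _ _ (iota 0 d) uf; rewrite size_map !size_iota ltnn => H.
  suff : false by []. by apply: H => x /mapP[i _ ->]; rewrite mem_iota leq0n ltn_mod d0.
case/(uniqPn 0) => i [j []]; rewrite size_map size_iota => ltij ltj.
rewrite !(nth_map 0) ?size_iota ?(ltn_trans ltij) // !nth_iota ?(ltn_trans ltij) // !add0n.
rewrite /f => eqf; exists (take (j - i) (drop i s)), (take i s ++ drop j s); split.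
- rewrite -{1}(cat_take_drop i s) -{1}(cat_take_drop (j - i) (drop i s)) drop_drop.
  by rewrite subnK 1?ltnW //; apply/permEl/perm_catCA.
- have : 0 < size (take (j - i) (drop i s)) by rewrite size_takel ?size_drop; lia.
  by case: (take _ _).
have -> : sumn (take (j - i) (drop i s)) = sumn (take j s) - sumn (take i s).
  have -> : take j s = take i s ++ take (j - i) (drop i s).
    by rewrite take_drop subnK ?(ltnW ltij) // -(take_takel s (ltnW ltij)) cat_take_drop.
  by rewrite sumn_cat addKn.
by rewrite -eqn_mod_dvd ?eqf // -(subnK (ltnW ltij)) addnC takeD sumn_cat leq_addr.
Qed.

(* Any d parts of rate at most k d contain a sublist whose sum is a multiple of
   d, which can be traded for copies of d without decreasing the weight. *)
Lemma exchange k d s : 0 < d -> all (fun x => k x <= k d) s ->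
  exists t q, [/\ size t < d, {subset t <= s}, sumn s = sumn t + q * d &
    weight (fun x => x * k x) s <= weight (fun x => x * k x) t + q * d * k d].
Proof.
move=> d0; have [m] := ubnP (size s); elim: m s => // m IH s lt_m ks.
have [lt_d|le_d] := ltnP (size s) d.
  by exists s, 0; rewrite !mul0n !addn0; split.
have [t [u [stu t0 /dvdnP[q qE]]]] := sublist_multiple d0 le_d.
have us : {subset u <= s} by move=> x xu; rewrite (perm_mem stu) mem_cat xu orbT.
have ts : {subset t <= s} by move=> x xt; rewrite (perm_mem stu) mem_cat xt.
have [||t' [q' [sz sub sumE le_w]]] := IH u.
- have := perm_size stu; rewrite size_cat; case: (t) t0 => //= x r _; lia.
- by apply/allP => x /us /(allP ks).
exists t', (q' + q); split=> // [x /sub/us//||].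
  by rewrite (perm_sumn stu) sumn_cat sumE qE mulnDl; lia.
rewrite (weight_perm _ stu) weight_cat.
have : weight (fun x => x * k x) t <= sumn t * k d.
  rewrite sumnE big_distrl /= /weight !big_seq; apply: leq_sum => x /ts xs.
  by rewrite leq_mul2l (allP ks) ?orbT.
by rewrite qE; nia.
Qed.

Lemma first_argmax k T : exists d, [/\ 0 < d <= T.+1 &
  forall x, 0 < x -> x <= T.+1 -> k x <= k d /\ (x < d -> k x < k d)].
Proof.
elim: T => [|T [d [dT dP]]].
  by exists 1; split=> // x x0 le_x; have -> : x = 1 by lia.
have [lt_k|le_k] := ltnP (k d) (k T.+2).
  exists T.+2; split=> [|x x0]; first (by rewrite leqnn); rewrite leq_eqVlt => /predU1P[->|le_x].
    by rewrite ltnn; split.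
  have [le_x' _] := dP x x0 le_x; split=> [|_]; lia.
exists d; split=> [|x x0]; first by case/andP: dT => -> /leqW.
rewrite leq_eqVlt => /predU1P[->|le_x]; last exact: dP.
by split=> // lt_d; lia.
Qed.

(** Parts are accumulated until they reach [th], hence stay below 3 th; an incomplete last lump is
    merged into another one. *)
Lemma lumps th s : 0 < th -> all (fun x => x < 2 * th) s -> th <= sumn s ->
  exists ss, perm_eq (flatten ss) s /\ all (fun t => th <= sumn t < 4 * th) ss.
Proof.
move=> th0 sP le_s.
suff {le_s} [ss [r [ssr lt_r ssP]]] : exists ss r, [/\ perm_eq (flatten ss ++ r) s,
    sumn r < th & all (fun t => th <= sumn t < 3 * th) ss].
  case: ss ssr ssP => [|t ss] /= ssr ssP.
    by rewrite -(perm_sumn ssr) leqNgt lt_r in le_s.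
  exists ((r ++ t) :: ss); split; first by apply: perm_trans ssr; rewrite /= -catA perm_catC.
  case/andP: ssP => tP /allP ssP /=; rewrite sumn_cat; apply/andP; split; first by lia.
  by apply/allP => u /ssP; lia.
elim: s sP => [|x s IH] /=; first by exists [::], [::].
case/andP=> lt_x /IH[ss [r [ssr lt_r ssP]]].
have [lt|le] := ltnP (x + sumn r) th.
  exists ss, (x :: r); split=> //.
  by rewrite -cat1s perm_catCA /= perm_cons.
exists ((x :: r) :: ss), [::]; split=> //=; last by rewrite ssP andbT; lia.
by rewrite cats0 perm_cons perm_catC.
Qed.

Definition handles f y a S :=
  forall l, all (leq a) l -> sumn l <= S -> weight f l <= y (sumn l).

Lemma absorb f y a th s : 0 < th -> handles f y a (4 * th) ->
  all (fun x => a <= x < 2 * th) s -> th <= sumn s ->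
  exists L, [/\ all (leq th) L, sumn L = sumn s & weight f s <= weight y L].
Proof.
move=> th0 hf sP le_s.
have [|ss [sss ssP]] := lumps th0 _ le_s.
  by apply: sub_all sP => x /andP[].
have aP : all (leq a) (flatten ss).
  by rewrite (perm_all _ sss); apply: sub_all sP => x /andP[].
exists (map sumn ss); rewrite -(perm_sumn sss) -(weight_perm _ sss) => {sss sP le_s}.
elim: ss ssP aP => [|t ss IH] /=; first by rewrite !weight_nil.
case/andP=> /andP[le_t lt_t] /IH{}IH; rewrite all_cat => /andP[at_ /IH[LP sumE le_w]].
rewrite le_t LP sumn_cat sumE; split=> //.
by rewrite weight_cat weight_cons leq_add // hf // ltnW.
Qed.

Definition closes e y :=
  forall l rho, large_parts l rho -> weight e l + y rho <= y (sumn l + rho).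

Lemma closes_le e y d : closes e y -> 0 < d -> e d <= y d.
Proof.
move=> ey d0; have := ey [:: d] 0; rewrite /weight big_seq1 /= !addn0 => le_y.
by rewrite (leq_trans (leq_addr (y 0) _)) // le_y // /large_parts /= !addn0 d0 andbT; nia.
Qed.

Lemma closes_handles e y a S : closes e y -> 0 < a -> S ^ 2 <= 8 * a ^ 3 ->
  handles e y a S.
Proof.
move=> ey a0 leS l al le_l; have := ey l 0; rewrite addn0 => le_w.
rewrite (leq_trans (leq_addr (y 0) _)) // le_w // /large_parts addn0.
apply: sub_all al => x le_x; rewrite (leq_trans a0 le_x) /=.
have le1 : sumn l ^ 2 <= S ^ 2 by rewrite leq_sqr.
have le2 : a ^ 3 <= x ^ 3 by rewrite leq_exp2r.
lia.
Qed.

(** One more closure extends the range of totals from order th to order th^(3/2): parts below [th]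
    are grouped into lumps that [y] handles and that are large parts for [z]. If their total is
    below [th], it serves as the remainder. *)
Lemma handles_closes f y z a th S : handles f y a (4 * th) -> closes y z ->
  (forall d, 0 < d -> f d <= y d) -> 0 < a -> 0 < th -> S ^ 2 <= 8 * th ^ 3 ->
  handles f z a S.
Proof.
move=> hf yz fy a0 th0 leS l al le_l.
pose r := filter (fun x => x < th) l; pose b := filter (predC (fun x => x < th)) l.
have posl : all (leq 1) l by apply: sub_all al => x; apply: leq_trans.
have sumE : sumn l = sumn r + sumn b := sumn_filter _ l.
have wE : weight f l = weight f r + weight f b := weight_filter f _ l.
have bP : all (leq th) b.
  by apply/allP => x; rewrite mem_filter /= -leqNgt => /andP[].
have rP : all (fun x => a <= x < th) r.
  by apply/allP => x; rewrite mem_filter => /andP[-> /(allP al) ->].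
have rP' : all (leq a) r by apply: sub_all rP => x /andP[].
have wb : weight f b <= weight y b.
  by apply: weight_mono => //; apply: sub_all bP => x; apply: leq_trans.
have large L : all (leq th) L -> sumn L <= S -> forall rho, rho < th ->
    sumn L + rho <= S -> large_parts L rho.
  move=> LP _ rho lt_rho le_S; apply: sub_all LP => x le_x; rewrite (leq_trans lt_rho le_x) /=.
  have le1 : (sumn L + rho) ^ 2 <= S ^ 2 by rewrite leq_sqr.
  have le2 : th ^ 3 <= x ^ 3 by rewrite leq_exp2r.
  lia.
have [lt_r|le_r] := ltnP (sumn r) th.
  have le_yz : weight f r <= z (sumn r).
    have [r0|r0] := posnP (sumn r).
      have -> : r = [::] by move: r0 rP'; case: (r) => //= x u; lia.
      by rewrite weight_nil.
    by rewrite (leq_trans (hf r rP' _)) ?(closes_le yz) //; lia.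
  have := yz b (sumn r); rewrite large //; try lia.
  by move=> /(_ isT); rewrite wE sumE [sumn r + _]addnC; lia.
have rP2 : all (fun x => a <= x < 2 * th) r.
  by apply: sub_all rP => x /andP[-> lt_x] /=; lia.
have [L [LP sumL wL]] := absorb th0 hf rP2 le_r.
have := yz (L ++ b) 0; rewrite sumn_cat sumL addn0 -sumE weight_cat wE => le_z.
rewrite (leq_trans _ (leq_trans (leq_addr (z 0) _) (le_z _))) ?leq_add //.
by rewrite large ?all_cat ?LP // ?addn0 sumn_cat sumL -sumE.
Qed.

(** Parts below [T] are traded for copies of the first [d] < [T] of maximal rate. If [d] is a
    record, its copies merge into a single part. If not, some d' in [T, 2 d) has a larger rate, and
    d' copies of [d] are exchanged for d copies of d'. The list [md] has the total of [mid] but is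
    counted with the weight [e], so that it can return to the remainder when [mid] is too small to
    form a lump. *)
Lemma decompose k e1 T c l (e := fun d => d * k d) :
  0 < T -> 2 * T <= c -> all (leq 1) l ->
  (forall d, 0 < d -> e d <= e1 d) ->
  (forall G D, record_rate k G -> 0 < D -> G %| D -> D * k G <= e1 D) ->
  exists sm md mid big,
  [/\ [/\ all (leq 1) sm, sumn sm <= 4 * T ^ 2 & all (leq 1) md],
      [/\ all (fun x => T <= x < c) mid, all (leq c) big & sumn md = sumn mid],
      sumn l = sumn sm + sumn mid + sumn big,
      weight e l <= weight e sm + weight e1 mid + weight e1 big &
      weight e l <= weight e sm + weight e md + weight e1 big].
Proof.
move=> T0 leTc posl ee1 rec1.
pose s := filter (fun x => x < T) l; pose b := filter (predC (fun x => x < T)) l.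
pose m := filter (fun x => x < c) b; pose g := filter (predC (fun x => x < c)) b.
have sumE : sumn l = sumn s + sumn m + sumn g.
  rewrite (sumn_filter (fun x => x < T) l).
  by rewrite (sumn_filter (fun x => x < c) [seq x <- l | predC _ x]) addnA.
have wE f : weight f l = weight f s + weight f m + weight f g.
  rewrite (weight_filter _ (fun x => x < T) l).
  by rewrite (weight_filter _ (fun x => x < c) [seq x <- l | predC _ x]) addnA.
have posm : all (leq 1) m.
  by apply/allP => x; rewrite !mem_filter => /and3P[_ _ /(allP posl)].
have posg : all (leq 1) g.
  by apply/allP => x; rewrite !mem_filter => /and3P[_ _ /(allP posl)].
have mP : all (fun x => T <= x < c) m.
  by apply/allP => x; rewrite !mem_filter /= -leqNgt => /and3P[-> -> _].
have gP : all (leq c) g.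
  by apply/allP => x; rewrite !mem_filter /= -leqNgt => /and3P[-> _ _].
have wm := weight_mono posm ee1; have wg := weight_mono posg ee1.
have [s0|s0] := eqVneq s [::].
  exists [::], m, m, g; rewrite sumE !wE s0 !weight_nil; split=> //; lia.
have sP x : x \in s -> 0 < x < T by rewrite mem_filter => /andP[-> /(allP posl) ->].
have T2 : exists T', T = T'.+2.
  case: (s) s0 sP => [//|x ?] _ /(_ x (mem_head _ _)).
  by case: (T) => [|[|T']]; [lia|lia|exists T'].
have [T' ET] := T2.
have [d [dT dP]] := first_argmax k T'.
have d0 : 0 < d by move: dT; lia.
have lt_d : d < T by move: dT; lia.
have [|t [q [sz ts sumS wS]]] := @exchange k d s d0.
  by apply/allP => x /sP /andP[x0 lt_x]; have [|-> //] := dP x x0; lia.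
have post : all (leq 1) t by apply/allP => x /ts /sP /andP[].
have sumt : sumn t <= T ^ 2.
  apply: leq_trans (sumn_le_size (b := T) _) _; last first.
    by rewrite -mulnn leq_mul // ltnW // (ltn_trans sz).
  by apply/allP => x /ts /sP /andP[_ /ltnW].
rewrite -/e in wS.
have [recd|nrec] := boolP (record_rate k d).
  pose X := q * d; rewrite -/X in wS sumS.
  have [X0|X0] := posnP X.
    exists t, m, m, g; rewrite sumE !wE sumS; rewrite X0 mul0n !addn0 in wS *.
    split=> //; [|by clear - wS wm wg; lia..].
    by split=> //; clear - sumt; lia.
  have leX : q * d * k d <= e1 X by apply: rec1 => //; apply: dvdn_mull.
  have eX : weight e (nseq q d) = q * d * k d by rewrite weight_nseq mulnA.
  have posX : all (leq 1) (nseq q d) by rewrite all_nseq d0 orbT.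
  have [ltX|leTX] := ltnP X T.
    exists (t ++ nseq q d), m, m, g.
    rewrite sumE !wE sumS sumn_cat sumn_nseqE weight_cat eX all_cat post posX; split=> //.
    - by split=> //; rewrite -/X; clear - sumt ltX T0; nia.
    - by clear - wS wm wg; lia.
    by clear - wS wm wg; lia.
  have [ltX|leX'] := ltnP X c.
    exists t, (nseq q d ++ m), (X :: m), g.
    rewrite sumE !wE sumS !sumn_cat sumn_nseqE weight_cons weight_cat eX all_cat posm posX /=.
    rewrite leTX ltX mP -/X; split=> //; [split=> // | | |].
    - by clear - sumt; lia.
    - by clear; lia.
    - by clear - wS leX wm wg; lia.
    by clear - wS leX wm wg; lia.
  exists t, m, m, (X :: g).
  rewrite sumE !wE sumS weight_cons /= leX' gP; split=> //; [split=> // | | |].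
  - by clear - sumt; lia.
  - by clear; lia.
  - by clear - wS leX wm wg; lia.
  by clear - wS leX wm wg; lia.
have [d' [leTd' ltd' ltk]] : exists d', [/\ T <= d', d' < 2 * d & k d < k d'].
  apply: contrapT => no; case/record_rateP: nrec; split=> // x x0 lt_x.
  have [ltT|leT] := ltnP x T; first by apply: dP => //; rewrite -ltnS -ET.
  split; last by rewrite ltnNge ltnW // (leq_trans lt_d).
  by rewrite leqNgt; apply/negP => lt_k; case: no; exists x.
have d'0 : 0 < d' by rewrite (leq_trans T0).
pose a := d * (q %/ d'); pose r := q %% d'.
have qE : q = q %/ d' * d' + r by rewrite -divn_eq.
have ltr : r < d' by rewrite ltn_mod.
have posa : all (leq 1) (nseq a d') by rewrite all_nseq d'0 orbT.
have posr : all (leq 1) (nseq r d) by rewrite all_nseq d0 orbT.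
have aP : all (fun x => T <= x < c) (nseq a d').
  by rewrite all_nseq leTd' orbC; clear - ltd' lt_d leTc; lia.
have wa : q * d * k d <= weight e (nseq a d') + weight e (nseq r d).
  rewrite !weight_nseq /e {1}qE /a.
  have : q %/ d' * d' * d * k d <= q %/ d' * d' * d * k d' by rewrite leq_mul2l (ltnW ltk) orbT.
  by clear; move: (q %/ d') => u; nia.
have wa1 : weight e (nseq a d') <= weight e1 (nseq a d') by apply: weight_mono.
have qdE : q * d = r * d + a * d'.
  by rewrite {1}qE /a; clear; move: (q %/ d') => u; ring.
exists (t ++ nseq r d), (nseq a d' ++ m), (nseq a d' ++ m), g.
rewrite sumE !wE sumS !sumn_cat !weight_cat !all_cat post posa posm posr aP mP !sumn_nseqE.
split=> //; [split=> // | | |].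
- have : r * d <= T * (2 * T) by rewrite mulnC leq_mul ?(ltnW lt_d) //; clear - ltr ltd' lt_d; lia.
  by clear - sumt; lia.
- by rewrite qdE; clear; lia.
- by clear - wS wa wa1 wm wg; lia.
by clear - wS wa wm wg; lia.
Qed.

End Exchange.

Section HullBound.
Local Open Scope nat_scope.
Variables (k e1 y1 y2 z : nat -> nat).
Let e d := d * k d.
Hypothesis e_le : forall d, 0 < d -> e d <= e1 d.
Hypothesis record_le : forall G D, record_rate k G -> 0 < D -> G %| D -> D * k G <= e1 D.
Hypothesis cl1 : closes e1 y1.
Hypothesis cl2 : closes y1 y2.
Hypothesis cl3 : closes y2 z.

(* With sumn l at most about 8 s^9, parts below s^3 are small, those between s^3 and 16 s^6 are
   grouped into lumps of size about s^6, and s >= 128 makes every use of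
   large_parts legitimate. *)
Lemma weight_bounded : exists K0, forall l, all (leq 1) l ->
  weight e l <= z (sumn l) + K0.
Proof.
have [B BE] : exists B, B = 128 by exists 128.
have [D0 D0E] : exists D0, D0 = 8 * B ^ 9 by eexists.
have [K0 K0E] : exists K0, K0 = D0 * \max_(i < D0.+1) e i by eexists.
exists K0 => l; have [m] := ubnP (sumn l); elim: m l => // m IH l lt_m posl.
have [le_D|lt_D] := leqP (sumn l) D0.
  rewrite (leq_trans _ (leq_addl _ _)) // K0E.
  apply: leq_trans (weight_le (b := \max_(i < D0.+1) e i) _) _; last by rewrite leq_mul2r le_D orbT.
  apply/allP => x xl; rewrite (allP posl) //.
  have lex : x < D0.+1 by rewrite ltnS (leq_trans (leq_mem_sumn xl)).
  exact: (leq_bigmax (F := fun i : 'I_D0.+1 => e i) (Ordinal lex)).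
have exs : exists s, sumn l <= 8 * s ^ 9.
  exists (sumn l); rewrite (leq_trans (leq_pmull _ (isT : 0 < 8))) // leq_mul2l /=.
  by case: (sumn l) => // D; rewrite -{1}[D.+1]expn1 leq_pexp2l.
case: (ex_minnP exs) => s leD mins.
have leB : B < s.
  rewrite ltnNge; apply/negP => le_s; have := leq_exp2r s B (isT : 0 < 9).
  by rewrite le_s D0E in lt_D *; clear - lt_D leD; lia.
have s128 : 128 <= s by rewrite -BE ltnW.
have ltD : 8 * s.-1 ^ 9 < sumn l by rewrite ltnNge; apply/negP => /mins; lia.
have [[T ET] [W EW] [U EU]] : [/\ exists T, T = s ^ 3, exists W, W = s ^ 4 &
    exists U, U = s ^ 6] by split; eexists.
have s0 : 0 < s by rewrite (leq_trans _ s128).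
have T0 : 0 < T by rewrite ET expn_gt0 s0.
have W0 : 0 < W by rewrite EW expn_gt0 s0.
have U0 : 0 < U by rewrite EU expn_gt0 s0.
have TU : T ^ 2 = U by rewrite ET EU -expnM.
have T3 : T ^ 3 = s * W ^ 2 by rewrite ET EW -!expnM -expnS.
have W3 : W ^ 3 = U ^ 2 by rewrite EW EU -!expnM.
have U3 : s ^ 9 * s ^ 9 = U ^ 3 by rewrite EU -expnM -expnD.
(* The three closures reach totals of order s^4, s^6 and s^9 from parts of order s^3, s^4 and s^6;
   each exponent is at most 3/2 times the one it starts from, the limit for large parts. *)
have y1h : handles e1 y1 T (4 * (8 * W)).
  apply: (closes_handles cl1 T0); rewrite T3 !expnMn.
  by move: (W ^ 2) => w; clear - s128; nia.
have y2h : handles e1 y2 T (4 * (8 * U)).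
  apply: (handles_closes y1h cl2 _ T0); first by move=> d; apply: closes_le.
    by rewrite muln_gt0.
  by rewrite !expnMn W3; move: (U ^ 2) => u; clear; lia.
have e1y2 d : 0 < d -> e1 d <= y2 d.
  by move=> d0; apply: leq_trans (closes_le cl1 d0) (closes_le cl2 d0).
have large L rho : all (fun x => 8 * U <= x) L -> all (fun x => rho < x) L ->
    sumn L + rho = sumn l -> large_parts L rho.
  move=> /allP LU /allP Lr sumE; apply/allP => x xL; rewrite Lr //= sumE.
  have le1 : sumn l ^ 2 <= (8 * s ^ 9) ^ 2 by rewrite leq_sqr.
  have le2 : (8 * U) ^ 3 <= x ^ 3 by rewrite leq_exp2r // LU.
  rewrite expnMn -[(s ^ 9) ^ 2]mulnn U3 in le1; rewrite expnMn in le2.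
  by move: (U ^ 3) le1 le2 => u; clear; lia.
have ltr : 12 * U < sumn l.
  apply: leq_ltn_trans ltD.
  have le1 : 2 * s ^ 2 <= s.-1 ^ 3.
    by clear - s128; case: s s128 => [|j] /= s128; [by [] | rewrite !expnS !expn0; nia].
  have : (2 * s ^ 2) ^ 3 <= (s.-1 ^ 3) ^ 3 by rewrite leq_exp2r.
  by rewrite expnMn -!expnM -EU; move: (s.-1 ^ _) U0 => u; clear; lia.
clear K0E D0E BE lt_D exs leD mins leB s128 ltD ET EW EU s0 T3 W3 U3 y1h.
have [|sm [md [mid [big [[possm lesm posmd] [midP bigP sumd] sumE wE wE']]]]] :=
    decompose T0 _ posl e_le record_le (c := 2 * (8 * U)).
  by rewrite -TU; clear - T0; nia.
rewrite TU in lesm; rewrite -/e in wE wE'.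
have posb : all (leq 1) big by apply: sub_all bigP => x; lia.
have wb : weight e1 big <= weight y2 big by apply: weight_mono.
have [le_mid|lt_mid] := leqP (8 * U) (sumn mid).
  (* Lumps and big parts exceed 4 s^6, which bounds the total of the small parts; the latter is a
     legitimate remainder, treated by induction. *)
  have [|L [LP sumL wL]] := absorb _ y2h midP le_mid; first by rewrite muln_gt0.
  have lt_sm : sumn sm < m by clear - lt_m sumE le_mid U0; lia.
  have := @cl3 (L ++ big) (sumn sm); rewrite large ?sumn_cat ?all_cat; last first.
  - by rewrite sumL; lia.
  - by apply/andP; split; [apply: sub_all LP | apply: sub_all bigP] => x; lia.
  - by apply/andP; split; [| apply: sub_all bigP] => // x; lia.
  move=> /(_ isT); have -> : sumn L + sumn big + sumn sm = sumn l by rewrite sumL sumE; clear; lia.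
  rewrite weight_cat.
  by have := IH sm lt_sm possm; lia.
(* The middle parts join the remainder, which stays below 12 s^6, while big parts are at least 16
   s^6. *)
have lt_rem : sumn (sm ++ md) < m by rewrite sumn_cat sumd; lia.
have posrem : all (leq 1) (sm ++ md) by rewrite all_cat possm.
have := @cl3 big (sumn (sm ++ md)); rewrite large ?sumn_cat; last first.
- by rewrite sumd; lia.
- by rewrite sumd; apply: sub_all bigP => x; lia.
- by apply: sub_all bigP => x; lia.
move=> /(_ isT); have -> : sumn big + (sumn sm + sumn md) = sumn l by rewrite sumd; lia.
by have := IH _ lt_rem posrem; rewrite weight_cat sumn_cat; lia.
Qed.

End HullBound.

(** * The superadditive hull of a rate *)

Section Hull.
Variables (R : realType) (K : fieldType) (nrm : K -> R).
Hypothesis K_char0 : [pchar K] =i pred0.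
Hypothesis nrmP : nontrivial_norm nrm.
Variables (n : nat) (A : {pred fps K n.+1}).
Hypothesis A_alg : GRing.subalg_closed A.
Hypothesis A_maj : majorization_closed nrm A.
Hypothesis A_ift : implicit_function_closed nrm A.
Variables (al : K) (C : R).
Hypothesis C1 : 1 <= C.
Hypothesis alC : 16 * C <= nrm al.
Hypothesis nC : forall n, (0 < n)%N -> (nrm n%:R)^-1 <= C ^+ n.

(** [h D] is the largest weight of any partition of [D]: concatenation of partitions makes it
    superadditive, and [weight_bounded] keeps it below [z] plus a constant. *)
Theorem superadditive_hull e : grE nrm A al e ->
  exists h, [/\ grE nrm A al h, h 0%N = 0%N, forall d, (0 < d)%N -> (e d <= h d)%N &
    forall i j, (h i + h j <= h (i + j))%N].
Proof.
have al8 : 8 <= nrm al.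
  by rewrite (le_trans _ alC) //; move: C1; lra.
(* Moving e d up to the next multiple of d makes rates integers, so that distinct ones differ by at
   least 1; the cost is at most |al|^d. *)
move=> ge; pose k d := (e d %/ d).+1.
have gk : grE nrm A al (fun d => d * k d)%N.
  apply: (grE_mono (D0 := 0) al8 (grE_affine nrmP A_alg A_ift al8 1 0 ge)) => d _.
  by rewrite /k mulnS mulnC; have := leq_trunc_div (e d) d; lia.
have [p gp pP] := power_parts K_char0 nrmP A_alg A_maj A_ift C1 alC nC gk.
have ge1 := grE_max nrmP A_alg A_maj al8 gk gp.
have cl := @large_parts_closure _ _ _ K_char0 nrmP _ _ A_alg A_maj A_ift _ al8.
have [y1 gy1 cl1] := cl _ ge1; have [y2 gy2 cl2] := cl _ gy1.
have [z gz cl3] := cl _ gy2.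
have [||K0 le_w] := @weight_bounded k _ _ _ _ _ _ cl1 cl2 cl3.
- by move=> d _; apply: leq_maxl.
- by move=> G D recG D0 GD; rewrite (leq_trans (pP _ _ recG D0 GD)) // leq_maxr.
pose f d := (d * k d)%N.
pose ach D v := `[< exists l, [/\ all (leq 1) l, sumn l = D & weight f l = v] >].
have bnd D v : ach D v -> (v <= z D + K0)%N.
  by move/asboolP => [l [posl <- <-]]; apply: le_w.
have D1 D : (0 < D)%N -> ach D (f D).
  by move=> D0; apply/asboolP; exists [:: D]; rewrite /= addn0 D0 /weight big_seq1.
have ach0 : ach 0%N 0%N by apply/asboolP; exists [::]; rewrite weight_nil.
have exa D : exists v, ach D v by case: (posnP D) => [->|/D1]; eexists; eauto.
pose h D := ex_maxn (exa D) (@bnd D).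
have hP D : ach D (h D) by rewrite /h; case: ex_maxnP.
have hmax D v : ach D v -> (v <= h D)%N by rewrite /h; case: ex_maxnP => w _; apply.
exists h; split.
- apply: (grE_mono (D0 := 0) al8 (grE_affine nrmP A_alg A_ift al8 0 K0 gz)) => D _.
  by rewrite mul0n addn0 bnd.
- have /asboolP[[|x l] [posl]] := hP 0%N; first by rewrite weight_nil.
  by move=> /= s0 _; move: posl => /=; lia.
- move=> d d0; apply: leq_trans (hmax d _ (D1 d d0)).
  by rewrite /f /k mulnC ltnW // ltn_ceil.
move=> i j; have /asboolP[l [posl sl wl]] := hP i; have /asboolP[l' [posl' sl' wl']] := hP j.
apply: hmax; apply/asboolP; exists (l ++ l').
by rewrite all_cat posl sumn_cat weight_cat sl sl' wl wl'.
Qed.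

End Hull.

(** * Divided powers of the derivation *)

Section Derivation.
Variables (K : fieldType) (n : nat).
Hypothesis K_char0 : [pchar K] =i pred0.
Variable a : 'I_n -> fps K n.
Implicit Types (f g : fps K n) (c : K) (d j N : nat).

Local Notation xi := (fps_derivation a).

Lemma derivationD f g : xi (f + g) = xi f + xi g.
Proof. by rewrite -big_split; apply: eq_bigr => i _; rewrite fps_derivD mulrDr. Qed.

Lemma derivationZ c f : xi (c *: f) = c *: xi f.
Proof. by rewrite scaler_sumr; apply: eq_bigr => i _; rewrite fps_derivZ scalerAr. Qed.

Lemma derivation0 : xi 0 = 0.
Proof. by rewrite -[in LHS](scale0r 0) derivationZ scale0r. Qed.

Lemma derivation_sum I (r : seq I) (P : pred I) (F : I -> fps K n) :
  xi (\sum_(i <- r | P i) F i) = \sum_(i <- r | P i) xi (F i).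
Proof. by apply: (big_morph _ derivationD derivation0). Qed.

Lemma derivationM f g : xi (f * g) = xi f * g + f * xi g.
Proof.
rewrite /fps_derivation mulr_suml mulr_sumr -big_split; apply: eq_bigr => i _.
by rewrite fps_derivM mulrDr mulrA mulrCA.
Qed.

Lemma derivation1 : xi 1 = 0.
Proof. by rewrite /fps_derivation big1 // => i _; rewrite fps_deriv1 mulr0. Qed.

Lemma derivation_var i : xi (fps_var K i) = a i.
Proof.
rewrite /fps_derivation (bigD1 i) //= big1 => [|j ji].
  rewrite addr0 -[RHS]mulr1; congr (_ * _); apply/funext => m.
  rewrite /fps_deriv /fps_var fps1E -{2}[U_(i)%MM]add0m eqm_add2r.
  by case: eqP => [->|_]; rewrite ?mnm0E ?mulr1n // mul0rn.
rewrite (_ : fps_deriv _ _ = 0) ?mulr0 //; apply/funext => m.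
rewrite /fps_deriv /fps_var fps0E; case: eqP => [/mnmP /(_ j)|_]; last by rewrite mul0rn.
by rewrite mnmDE !mnm1E eqxx eq_sym (negPf ji) addn1.
Qed.

Lemma iter_derivationD j f g : iter j xi (f + g) = iter j xi f + iter j xi g.
Proof. by elim: j => //= j ->; rewrite derivationD. Qed.

Lemma iter_derivationZ j c f : iter j xi (c *: f) = c *: iter j xi f.
Proof. by elim: j => //= j ->; rewrite derivationZ. Qed.

Definition dpow j f : fps K n := (j`!%:R)^-1 *: iter j xi f.

Lemma iter_dpow j f : iter j xi f = j`!%:R *: dpow j f.
Proof. by rewrite /dpow scalerA divff ?scale1r // fact_neq0. Qed.

Lemma dpow0 f : dpow 0 f = f.
Proof. by rewrite /dpow fact0 invr1 scale1r. Qed.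

Lemma dpowD j f g : dpow j (f + g) = dpow j f + dpow j g.
Proof. by rewrite /dpow iter_derivationD scalerDr. Qed.

Lemma dpowZ j c f : dpow j (c *: f) = c *: dpow j f.
Proof. by rewrite /dpow iter_derivationZ !scalerA mulrC. Qed.

Lemma dpow_sum j I (r : seq I) (P : pred I) (F : I -> fps K n) :
  dpow j (\sum_(i <- r | P i) F i) = \sum_(i <- r | P i) dpow j (F i).
Proof.
apply: (big_morph _ (dpowD j)).
by rewrite -[in LHS](scale0r 0) dpowZ scale0r.
Qed.

Lemma derivation_dpow j f : xi (dpow j f) = j.+1%:R *: dpow j.+1 f.
Proof.
rewrite /dpow derivationZ scalerA factS natrM invfM mulrA divff ?mul1r //.
by rewrite natK_neq0.
Qed.

Lemma dpow1 j : dpow j.+1 1 = 0.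
Proof.
rewrite /dpow; suff -> : iter j.+1 xi (1 : fps K n) = 0 by rewrite scaler0.
by elim: j => [|j IH]; rewrite iterS ?derivation1 // IH derivation0.
Qed.

Lemma dpowM j f g : dpow j (f * g) = \sum_(i < j.+1) dpow i f * dpow (j - i) g.
Proof.
elim: j => [|j IH]; first by rewrite big_ord1 !dpow0.
have nz : j.+1%:R != 0 :> K by rewrite natK_neq0.
apply: (scalerI nz); rewrite -derivation_dpow IH derivation_sum.
transitivity (\sum_(i < j.+1) i.+1%:R *: (dpow i.+1 f * dpow (j - i) g) +
              \sum_(i < j.+1) (j - i).+1%:R *: (dpow i f * dpow (j - i).+1 g)).
  rewrite -big_split; apply: eq_bigr => i _.
  by rewrite derivationM !derivation_dpow scalerAl scalerAr.
rewrite scaler_sumr.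
have E (i : 'I_j.+2) : j.+1%:R *: (dpow i f * dpow (j.+1 - i) g) =
    i%:R *: (dpow i f * dpow (j.+1 - i) g) + (j.+1 - i)%:R *: (dpow i f * dpow (j.+1 - i) g).
  by rewrite -scalerDl -natrD subnKC // -ltnS.
under [RHS]eq_bigr => i _ do rewrite E.
rewrite big_split; congr (_ + _).
  by rewrite [RHS]big_ord_recl /= scale0r add0r; apply: eq_bigr => i _.
rewrite [RHS]big_ord_recr /= subnn scale0r addr0; apply: eq_bigr => i _.
by rewrite subSn // -ltnS.
Qed.

Lemma dpow_shift N j f :
  dpow (j + N) f = (j`!%:R / (j + N)`!%:R) *: dpow j (iter N xi f).
Proof.
rewrite /dpow iterD scalerA mulrAC divff ?mul1r //.
by rewrite fact_neq0.
Qed.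

(* The constant terms of the divided powers of xi form a ring morphism
   K[[x]] -> K[[t]]; it maps x_i to a_i(0) t + ..., hence x_i^N to
   a_i(0)^N t^N + ..., which nilpotency forces to vanish. *)
Lemma nilpotent_coef0 : x_nilpotent xi -> forall i, a i 0%MM = 0.
Proof.
case=> N0 nil i; pose x : fps K n := fps_var K i.
pose psi f : fps K 1 := ser (fun j => dpow j f 0%MM).
have coef0M f g : (f * g) 0%MM = f 0%MM * g 0%MM.
  pose r := f - f 0%MM *: 1.
  have rO : ordge 1 r.
    move=> m; rewrite ltnS leqn0 mdeg_eq0 => /eqP ->.
    by rewrite /r fpsDE fpsNE fpsZE fps1E eqxx mulr1 subrr.
  rewrite -{1}(subrK (f 0%MM *: 1) f) -/r mulrDl fpsDE -scalerAl mul1r fpsZE.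
  by rewrite (ordgeM rO (@ordge0 _ _ g)) ?add0r // mdeg0.
have psiM f g : psi (f * g) = psi f * psi g.
  apply: cf_inj => j; rewrite cf_ser dpowM fps_sumE cfM.
  by apply: eq_bigr => k _; rewrite coef0M !cf_ser.
have psi1 : psi 1 = 1.
  apply: cf_inj => -[|j]; rewrite cf_ser cf1 ?dpow0 ?fps1E ?eqxx //.
  by rewrite dpow1 fps0E.
have psiX N : psi (x ^+ N) = psi x ^+ N.
  by elim: N => [|N IH]; rewrite ?expr0 // !exprS psiM IH.
have x0 : x 0%MM = 0 by apply: ordge_var; rewrite mdeg0.
have psi0 : cf (psi x) 0 = 0 by rewrite cf_ser dpow0.
have := cf_exp_diag N0.+1 psi0; rewrite -psiX !cf_ser.
have -> : dpow 1 x = a i by rewrite /dpow /= derivation_var invr1 scale1r.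
have xO : ordge 1 (x ^+ N0.+1).
  by rewrite exprS -[1%N]addn0; apply: ordgeM; [exact: ordge_var | exact: ordge0].
have /in_x2_ordge H : in_x2 (iter N0.+1 xi (x ^+ N0.+1)) by apply: nil => //; apply/in_xP.
rewrite /dpow fpsZE H ?mdeg0 // mulr0 => /esym /eqP.
by rewrite expf_eq0 => /eqP.
Qed.

Hypothesis nilp : x_nilpotent xi.

Lemma derivation_ordge d f : ordge d f -> ordge d (xi f).
Proof.
case: d => [|d] fO; first exact: ordge0.
apply: ordge_sum => i _; rewrite -add1n; apply: ordgeM.
  by move=> m; rewrite ltnS leqn0 mdeg_eq0 => /eqP ->; apply: nilpotent_coef0.
by move=> m lt_m; rewrite /fps_deriv fO ?mul0rn // mdegD mdeg1 addn1.
Qed.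

Lemma iter_derivation_ordge j d f : ordge d f -> ordge d (iter j xi f).
Proof. by move=> fO; elim: j => [//|j IH]; apply: derivation_ordge. Qed.

Lemma dpow_ordge j d f : ordge d f -> ordge d (dpow j f).
Proof. by move=> fO; apply/ordgeZ/iter_derivation_ordge. Qed.

(** In the Leibniz expansion for x_i g_i, either the index at x_i reaches N0 or the one at g_i
    reaches N1, and that factor gains an order. *)
Lemma dpow_raises_order d : exists N, forall j, (N <= j)%N -> forall f,
  ordge d.+1 f -> ordge d.+2 (dpow j f).
Proof.
elim: d => [|d [N1 IH]]; last first.
  have [N0 nil] := nilp; exists (N0 + N1)%N => j le_j f /ordge_decomp[g -> gO].
  rewrite dpow_sum; apply: ordge_sum => i _; rewrite dpowM; apply: ordge_sum => k _.
  have [leN|ltN] := leqP N0 k.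
    rewrite -[d.+3]/(2 + d.+1)%N; apply: ordgeM; last exact: dpow_ordge.
    by apply/ordgeZ/in_x2_ordge/nil => //; apply/in_xP/ordge_var.
  rewrite -add1n; apply: ordgeM; first exact/dpow_ordge/ordge_var.
  by apply: IH => //; lia.
have [N0 nil] := nilp; exists N0 => j le_j f /in_xP fx.
by apply/ordgeZ/in_x2_ordge/nil.
Qed.

Lemma dpow_ordge_large d f : exists N, forall j, (N <= j)%N -> ordge d (dpow j f).
Proof.
suff [N NP] : exists N, forall j, (N <= j)%N -> ordge d (iter j xi f).
  by exists N => j /NP; apply: ordgeZ.
elim: d => [|[|d] [N IH]]; first by exists 0%N => j _; apply: ordge0.
  exists 1%N => -[//|j] _; rewrite iterSr; apply: iter_derivation_ordge.
  apply: ordge_sum => i _; rewrite -[1%N]addn0; apply: ordgeM; last exact: ordge0.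
  by move=> m; rewrite ltnS leqn0 mdeg_eq0 => /eqP ->; apply: nilpotent_coef0.
have [N1 raise] := dpow_raises_order d; exists (N + N1)%N => j le_j.
have -> : j = ((j - N) + N)%N by lia.
rewrite iterD iter_dpow; apply/ordgeZ/raise; last exact: IH.
by lia.
Qed.

End Derivation.

(** * The majorant of the exponential *)

Lemma sum_triangle_le (R : realDomainType) (F : nat -> nat -> R) J :
  (forall i k, 0 <= F i k) ->
  \sum_(j < J) \sum_(i < j.+1) F i (j - i)%N <= \sum_(i < J) \sum_(k < J) F i k.
Proof.
move=> F0; have E (i : nat) (G : nat -> R) :
    \sum_(j < J | (i <= j)%N) G (j - i)%N = \sum_(k < J - i) G k.
  elim: J => [|J IH]; first by rewrite !big_ord0.
  rewrite big_mkcond big_ord_recr -big_mkcond /= IH; case: leqP => [le_iJ|lt_Ji].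
    by rewrite subSn // big_ord_recr.
  by rewrite addr0 (eqP (ltnW lt_Ji)) (eqP lt_Ji).
apply: (@le_trans _ _ (\sum_(i < J) \sum_(j < J | (i <= j)%N) F i (j - i)%N)).
  rewrite (exchange_big_dep xpredT) //= le_eqVlt; apply/orP; left; apply/eqP.
  apply: eq_bigr => j _; rewrite (big_ord_widen_cond J xpredT (fun i => F i (j - i)%N)) //.
apply: ler_sum => i _; rewrite E.
have le_J : (J - i <= J)%N by apply: leq_subr.
rewrite (big_ord_widen _ _ le_J) big_mkcond; apply: ler_sum => k _.
by case: ifP.
Qed.

Lemma sum_geometric_le (R : realFieldType) (F : nat -> R) B eta s M :
  0 <= B -> 0 <= eta -> 2 * eta <= 1 ->
  (forall d, F d <= if (s <= d)%N then B * eta ^+ d else 0) ->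
  \sum_(d < M) F d <= 2 * B * eta ^+ s.
Proof.
move=> B0 eta0 eta1 le_F.
have E k : \sum_(d < k) F d <= 2 * B * (eta ^+ s - eta ^+ (maxn s k)).
  elim: k => [|k IH]; first by rewrite big_ord0 maxn0 subrr mulr0.
  rewrite big_ord_recr /=; have := le_F k; case: leqP => [le_sk|lt_ks] le1; last first.
    rewrite (maxn_idPl lt_ks); rewrite (maxn_idPl (ltnW lt_ks)) in IH.
    by rewrite (le_trans (lerD IH le1)) // addr0.
  have -> : maxn s k.+1 = k.+1 by apply/maxn_idPr; rewrite leqW.
  rewrite (maxn_idPr le_sk) in IH; apply: le_trans (lerD IH le1) _.
  have le2 : 2 * eta ^+ k.+1 <= eta ^+ k.
    by rewrite exprS mulrA ler_piMl // exprn_ge0.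
  have := ler_wpM2l B0 le2; lra.
by apply: le_trans (E M) _; rewrite ler_wpM2l ?mulr_ge0 // gerBl exprn_ge0.
Qed.

Section Majorant.
Variables (R : realType) (K : fieldType) (nrm : K -> R).
Hypothesis K_char0 : [pchar K] =i pred0.
Hypothesis nrmP : nontrivial_norm nrm.
Variables (n : nat) (a : 'I_n -> fps K n).
Hypothesis nilp : x_nilpotent (fps_derivation a).
Variables (w V : nat -> R) (C : R).
Hypothesis C1 : 1 <= C.
Hypothesis w1 : forall j, 1 <= w j.
Hypothesis wD : forall i j, w (i + j)%N <= w i * w j.
Hypothesis wS : forall j, w j.+1 * (nrm j.+1%:R)^-1 <= C * w j.
Hypothesis V0 : V 0%N = 1.
Hypothesis V_gt0 : forall d, 0 < V d.
Hypothesis VD : forall i j, V i * V j <= V (i + j)%N.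
Variables (r : R) (M : nat).
Hypothesis r0 : 0 < r.
Implicit Types (f g : fps K n) (c : K) (d j J D l : nat).

Local Notation dp := (dpow a).
Local Notation N := (degree_norm nrm).

Let w0 j : 0 <= w j. Proof. by rewrite (le_trans ler01). Qed.

Definition dpow_norm J D f : R := \sum_(j < J) w j * N (dp j f) D.

(** The truncations [J] and [M] keep the sums finite; the bounds will not depend on them. The shift
    [l] is meant for series of order at least [l]: shifts add up in products, by V (i - l) V (k -
    l') <= V (i + k - l - l'). *)
Definition majorant J l f : R :=
  \sum_(D < M) dpow_norm J D f * (r ^+ D / V (D - l)).

Local Notation Phi := dpow_norm.

Lemma dpow_norm_ge0 J D f : 0 <= Phi J D f.
Proof. by rewrite sumr_ge0 // => j _; rewrite mulr_ge0 // degree_norm_ge0. Qed.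

Lemma dpow_normD J D f g : Phi J D (f + g) <= Phi J D f + Phi J D g.
Proof.
rewrite /dpow_norm -big_split; apply: ler_sum => j _ /=; rewrite -mulrDr ler_wpM2l //.
by rewrite dpowD degree_normD.
Qed.

Lemma dpow_normZ J D c f : Phi J D (c *: f) = nrm c * Phi J D f.
Proof.
by rewrite mulr_sumr; apply: eq_bigr => j _; rewrite dpowZ degree_normZ // mulrCA.
Qed.

Lemma dpow_norm_ordge J D d f : ordge d f -> (D < d)%N -> Phi J D f = 0.
Proof.
move=> fO lt_D; rewrite /Phi big1 // => j _.
have /(degree_norm_ordge nrmP) -> // := dpow_ordge K_char0 nilp j fO.
by rewrite mulr0.
Qed.

Lemma dpow_normM J D f g :
  Phi J D (f * g) <= \sum_(i < D.+1) Phi J i f * Phi J (D - i)%N g.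
Proof.
pose F i k := \sum_(d < D.+1) (w i * N (dp i f) d) * (w k * N (dp k g) (D - d)%N).
have F0 i k : 0 <= F i k.
  by rewrite sumr_ge0 // => d _; rewrite !mulr_ge0 // degree_norm_ge0.
apply: (@le_trans _ _ (\sum_(j < J) \sum_(i < j.+1) F i (j - i)%N)).
  apply: ler_sum => j _; rewrite dpowM //.
  apply: le_trans (ler_wpM2l (w0 j) (degree_norm_sum nrmP _ _ _ _)) _.
  rewrite mulr_sumr; apply: ler_sum => i _.
  apply: le_trans (ler_wpM2l (w0 j) (degree_normM nrmP _ _ _)) _.
  rewrite mulr_sumr; apply: ler_sum => d _; rewrite mulrACA ler_wpM2r //.
    by rewrite mulr_ge0 // degree_norm_ge0.
  by rewrite (le_trans _ (wD _ _)) // subnKC // -ltnS.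
apply: le_trans (sum_triangle_le J F0) _.
under eq_bigr => i _ do rewrite exchange_big.
rewrite exchange_big; apply: ler_sum => d _ /=.
by rewrite [leRHS]big_distrlr.
Qed.

Lemma majorant_ge0 J l f : 0 <= majorant J l f.
Proof.
rewrite sumr_ge0 // => D _; rewrite mulr_ge0 ?dpow_norm_ge0 // mulr_ge0 ?exprn_ge0 ?(ltW r0) //.
by rewrite invr_ge0 ltW.
Qed.

Lemma majorantD J l f g : majorant J l (f + g) <= majorant J l f + majorant J l g.
Proof.
rewrite /majorant -big_split; apply: ler_sum => D _ /=; rewrite -mulrDl ler_wpM2r ?dpow_normD //.
by rewrite mulr_ge0 ?exprn_ge0 ?(ltW r0) // invr_ge0 ltW.
Qed.

Lemma majorantZ J l c f : majorant J l (c *: f) = nrm c * majorant J l f.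
Proof. by rewrite /majorant mulr_sumr; apply: eq_bigr => D _; rewrite dpow_normZ -mulrA. Qed.

Lemma majorant_ordge J l f : ordge M f -> majorant J l f = 0.
Proof. by move=> fO; rewrite /majorant big1 // => D _; rewrite (dpow_norm_ordge _ fO) ?mul0r. Qed.

Lemma majorant_sum J l I (s : seq I) (F : I -> fps K n) :
  majorant J l (\sum_(i <- s) F i) <= \sum_(i <- s) majorant J l (F i).
Proof.
elim: s => [|i s IH]; last by rewrite !big_cons (le_trans (majorantD _ _ _ _)) // lerD2l.
rewrite !big_nil -(scale0r (0 : fps K n)) majorantZ (nrm0 nrmP) mul0r //.
Qed.

Lemma majorantM J l l' f g : ordge l f -> ordge l' g ->
  majorant J (l + l') (f * g) <= majorant J l f * majorant J l' g.
Proof.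
move=> fO gO.
pose F i k := (Phi J i f * (r ^+ i / V (i - l))) * (Phi J k g * (r ^+ k / V (k - l'))).
have rV0 D k : 0 <= r ^+ D / V k by rewrite mulr_ge0 ?invr_ge0 ?exprn_ge0 ?(ltW r0) ?(ltW (V_gt0 _)).
have F0 i k : 0 <= F i k by apply: mulr_ge0; apply: mulr_ge0; rewrite ?dpow_norm_ge0 ?rV0.
rewrite [leRHS]big_distrlr; apply: le_trans (sum_triangle_le M F0).
apply: ler_sum => D _; apply: le_trans (ler_wpM2r (rV0 _ _) (dpow_normM _ _ _ _)) _.
rewrite mulr_suml; apply: ler_sum => i _; rewrite /F [leRHS]mulrACA.
have [lt_i|le_i] := ltnP i l; first by rewrite (dpow_norm_ordge _ fO lt_i) !mul0r.
have [lt_k|le_k] := ltnP (D - i) l'; first by rewrite (dpow_norm_ordge _ gO lt_k) !mulr0 !mul0r.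
rewrite ler_wpM2l ?mulr_ge0 ?dpow_norm_ge0 // [leRHS]mulrACA -exprD.
rewrite subnKC -1?ltnS // ler_wpM2l ?exprn_ge0 ?(ltW r0) //.
rewrite -invfM lef_pV2 ?posrE ?mulr_gt0 // (le_trans (VD _ _)) //.
by rewrite le_eqVlt; apply/orP; left; apply/eqP; congr V; have := ltn_ord i; lia.
Qed.

Lemma majorant_one J : majorant J 0 1 <= w 0%N.
Proof.
have PhiE D : Phi J D 1 <= w 0%N * N (1 : fps K n) D.
  rewrite /Phi; case: J => [|J]; first by rewrite big_ord0 mulr_ge0 // degree_norm_ge0.
  rewrite big_ord_recl big1 ?addr0 ?dpow0 // => j _.
  rewrite dpow1 (_ : N 0 D = 0) ?mulr0 //; exact/(degree_norm0P nrmP).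
rewrite /majorant.
case: M => [|M']; first by rewrite big_ord0.
rewrite big_ord_recl big1 ?addr0 => [|D _].
  rewrite expr0 subn0 V0 divr1 mulr1 (le_trans (PhiE _)) // /degree_norm.
  have lt0 : (mdeg (0%MM : 'X_{1..n}) < 1)%N by rewrite mdeg0.
  rewrite (big_pred1 (BMultinom lt0)) => [|m]; last by rewrite /= bmeqP /= mdeg_eq0.
  by rewrite fps1E eqxx (nrm1 nrmP) mulr1.
apply/eqP; rewrite mulf_eq0; apply/orP; left; rewrite eq_le dpow_norm_ge0 andbT.
apply: le_trans (PhiE _) _; rewrite (_ : N 1 _ = 0) ?mulr0 //.
apply/(degree_norm0P nrmP) => m; rewrite fps1E -mdeg_eq0 => ->.
by [].
Qed.

Lemma ordge_fpsX (m : 'X_{1..n}) : ordge (mdeg m) (fpsX K m).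
Proof. by move=> k lt_k; rewrite /fpsX; case: eqP => // e; rewrite e ltnn in lt_k. Qed.

Lemma majorant_monomial J eta (m : 'X_{1..n}) : 0 <= eta ->
  (forall i, majorant J 1 (fps_var K i) <= eta) ->
  majorant J (mdeg m) (fpsX K m) <= w 0%N * eta ^+ mdeg m.
Proof.
move=> eta0 var_le; have [d] := ubnP (mdeg m); elim: d m => // d IH m lt_m.
have [m0|/eqP m0] := eqVneq m 0%MM.
  by rewrite m0 mdeg0 fpsX0 expr0 mulr1 majorant_one.
have [i mi] : exists i, m i != 0%N.
  apply: contrapT => no; apply: m0; apply/mnmP => i; rewrite mnm0E.
  by apply/eqP; apply: contraT => mi; case: no; exists i.
have le_Um : (U_(i) <= m)%MM by rewrite lep1mP.
have eqm : m = (U_(i) + (m - U_(i)))%MM by rewrite addmC submK.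
rewrite eqm fpsXU mdegD mdeg1 addnC exprD expr1 mulrA [_ * eta]mulrC addnC.
apply: le_trans (majorantM _ (@ordge_var _ _ _) (@ordge_fpsX _)) _.
apply: ler_pM; rewrite ?majorant_ge0 //; apply: IH.
by move: lt_m; rewrite {1}eqm mdegD mdeg1.
Qed.

(** Expansion in monomials: since V (|m| - l) V (D - |m|) <= V (D - l), passing from shift |m| to
    shift [l] gains the factor V (|m| - l), which absorbs the growth of the coefficients in degree
    |m|. A geometric series in eta remains. *)
Lemma majorant_le J l s B eta f : (l <= s)%N -> 0 <= eta -> 2 * eta <= 1 ->
  (forall i, majorant J 1 (fps_var K i) <= eta) -> ordge s f -> 0 <= B ->
  (forall d, (s <= d)%N -> N f d <= B * V (d - l)) ->
  majorant J l f <= 2 * (B * w 0%N) * eta ^+ s.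
Proof.
move=> le_ls eta0 eta1 var_le fO B0 fB; have [h hO {1}->] := fps_truncE M f.
apply: le_trans (majorantD _ _ _ _) _; rewrite (majorant_ordge _ _ hO) addr0.
apply: le_trans (majorant_sum _ _ _ _) _.
pose c d := if (s <= d)%N then w 0%N * eta ^+ d / V (d - l) else 0.
have c0 d : 0 <= c d.
  by rewrite /c; case: ifP => // _; rewrite !mulr_ge0 ?exprn_ge0 ?invr_ge0 ?(ltW (V_gt0 _)).
apply: (@le_trans _ _ (\sum_(m : 'X_{1..n < M}) nrm (f m) * c (mdeg m))).
  apply: ler_sum => m _; rewrite majorantZ /c; case: ifP => [le_m|/negbT]; last first.
    by rewrite -ltnNge => /fO ->; rewrite (nrm0 nrmP) !mul0r.
  rewrite ler_wpM2l ?(nrm_ge0 nrmP) // -ler_pdivrMr ?invr_gt0 // invrK.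
  apply: le_trans (majorant_monomial _ eta0 var_le).
  rewrite /majorant mulr_suml; apply: ler_sum => D _.
  have [lt_D|le_D] := ltnP D (mdeg m).
    by rewrite (dpow_norm_ordge _ (@ordge_fpsX _) lt_D) !mul0r.
  rewrite -!mulrA ler_wpM2l ?dpow_norm_ge0 // ler_wpM2l ?exprn_ge0 ?(ltW r0) //.
  rewrite mulrC ler_pdivrMr // mulrC ler_pdivlMr // mulrC (le_trans (VD _ _)) //.
  by rewrite le_eqVlt; apply/orP; left; apply/eqP; congr V; lia.
have -> : \sum_(m : 'X_{1..n < M}) nrm (f m) * c (mdeg m) = \sum_(d < M) N f d * c d.
  rewrite (partition_big (fun m : 'X_{1..n < M} => Ordinal (bmdeg m)) xpredT) //=.
  apply: eq_bigr => d _; rewrite (degree_normE _ _ (ltn_ord d)) mulr_suml.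
  rewrite (eq_bigl (fun m : 'X_{1..n < M} => mdeg m == d)) //.
  by apply: eq_bigr => m /eqP ->.
apply: (@sum_geometric_le _ (fun d => N f d * c d)) => //; first by rewrite mulr_ge0.
move=> k; rewrite /c; case: leqP => [le_sk|_]; last by rewrite mulr0.
rewrite mulrA ler_pdivrMr //.
have -> : B * w 0%N * eta ^+ k * V (k - l) = B * V (k - l) * (w 0%N * eta ^+ k) by ring.
by rewrite ler_wpM2r ?fB // mulr_ge0 // exprn_ge0.
Qed.

Lemma majorant_mono J J' l f : (J <= J')%N -> majorant J l f <= majorant J' l f.
Proof.
move=> leJ; apply: ler_sum => D _; rewrite ler_wpM2r //.
  by rewrite mulr_ge0 ?exprn_ge0 ?(ltW r0) // invr_ge0 ltW.
rewrite {1}/dpow_norm (big_ord_widen J' (fun j => w j * N (dp j f) D) leJ).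
rewrite big_mkcond; apply: ler_sum => j _.
by case: ifP => // _; rewrite mulr_ge0 // degree_norm_ge0.
Qed.

Lemma weight_shift N0 j :
  w (N0 + j)%N * nrm (j`!%:R / (N0 + j)`!%:R) <= C ^+ N0 * w j.
Proof.
elim: N0 => [|N0 IH].
  by rewrite add0n divff ?(nrm1 nrmP) ?mulr1 ?mul1r // (fact_neq0 K_char0).
rewrite addSn factS natrM invfM mulrA [_ / (N0 + j).+1%:R]mulrC -!mulrA (nrmM nrmP) mulrA (nrmV nrmP).
apply: (@le_trans _ _ (C * w (N0 + j)%N * nrm (j`!%:R / (N0 + j)`!%:R))).
  by rewrite ler_wpM2r ?(nrm_ge0 nrmP).
by rewrite exprS -!mulrA ler_wpM2l // (le_trans ler01).
Qed.

(** The divided power of index N0 + j of [f] is a multiple of the j-th one of xi^N0 f; the weights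
    keep the cost of the factorials at C^N0, independently of j. *)
Lemma dpow_norm_shift N0 J D f : Phi (N0 + J) D f <=
  Phi N0 D f + C ^+ N0 * Phi J D (iter N0 (fps_derivation a) f).
Proof.
rewrite {1}/dpow_norm big_split_ord /= lerD2l mulr_sumr; apply: ler_sum => j _.
rewrite addnC (dpow_shift K_char0) (degree_normZ nrmP) !mulrA addnC.
by rewrite ler_wpM2r ?degree_norm_ge0 // weight_shift.
Qed.

Lemma majorant_shift N0 J l f : majorant (N0 + J) l f <=
  majorant N0 l f + C ^+ N0 * majorant J l (iter N0 (fps_derivation a) f).
Proof.
rewrite /majorant mulr_sumr -big_split; apply: ler_sum => D _ /=.
rewrite [C ^+ _ * _]mulrA -mulrDl ler_wpM2r ?dpow_norm_shift //.
by rewrite mulr_ge0 ?exprn_ge0 ?(ltW r0) // invr_ge0 ltW.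
Qed.

(* Since xi^N0 x_i has order at least 2, the bound eta for the terms j < J of
   all the x_i gives a bound quadratic in eta for the terms N0 <= j < N0 + J. *)
Lemma majorant_var N0 B eta : (0 < N0)%N -> 0 <= B -> 0 <= eta -> 2 * eta <= 1 ->
  2 * r <= 1 -> 4 * B * r <= eta -> 4 * B * w 0%N * C ^+ N0 * eta <= 1 ->
  (forall i, ordge 2 (iter N0 (fps_derivation a) (fps_var K i))) ->
  (forall i D, Phi N0 D.+1 (fps_var K i) <= B * V D) ->
  (forall i D, N (iter N0 (fps_derivation a) (fps_var K i)) D.+1 <= B * V D) ->
  forall J i, majorant J 1 (fps_var K i) <= eta.
Proof.
move=> N00 B0 eta0 eta1 r1 le_r le_eta bO varB bB.
have base i : majorant N0 1 (fps_var K i) <= 2 * B * r ^+ 1.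
  apply: (@sum_geometric_le _ (fun D => Phi N0 D (fps_var K i) * (r ^+ D / V (D - 1)))) => //.
    exact: ltW.
  case=> [|D] /=; first by rewrite (dpow_norm_ordge _ (@ordge_var _ _ _)) ?mul0r.
  rewrite subn1 /= mulrA ler_pdivrMr // mulrAC ler_wpM2r ?exprn_ge0 ?(ltW r0) //.
elim/ltn_ind => J IH i.
have [le_J|lt_J] := leqP J N0.
  rewrite (le_trans (majorant_mono _ _ le_J)) // (le_trans (base i)) // expr1.
  by have := mulr_ge0 B0 (ltW r0); move: le_r; lra.
have eJ : J = (N0 + (J - N0))%N by rewrite subnKC // ltnW.
rewrite eJ (le_trans (majorant_shift _ _ _ _)) //.
have lt' : (J - N0 < J)%N by lia.
have H : majorant (J - N0) 1 (iter N0 (fps_derivation a) (fps_var K i)) <=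
    2 * (B * w 0%N) * eta ^+ 2.
  apply: (majorant_le _ eta0 eta1 (IH _ lt') (bO i) B0) => // -[//|D] _.
  by rewrite subn1.
have C0 : 0 <= C ^+ N0 by rewrite exprn_ge0 // (le_trans ler01).
have := lerD (base i) (ler_wpM2l C0 H); rewrite expr1 => le1.
apply: (le_trans le1); have := ler_wpM2r eta0 le_eta; rewrite mul1r expr2.
by move: le_r; lra.
Qed.

End Majorant.

(** The orders of the terms tend to infinity, so each degree norm of the sum is that of a partial
    sum, and bounds uniform in [J] pass to the limit. *)
Lemma exp_series_exists (R : realType) (K : fieldType) (nrm : K -> R) n
    (a : 'I_n -> fps K n) (f : fps K n) :
  [pchar K] =i pred0 -> x_nilpotent (fps_derivation a) ->
  exists2 g, fps_series_sum (fun j => dpow a j f) g &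
    forall D, exists J, degree_norm nrm g D = degree_norm nrm (\sum_(j < J) dpow a j f) D.
Proof.
move=> K_char0 nilp.
have [N NP] := boolp.choice (fun d => dpow_ordge_large K_char0 nilp d f).
have stable (m : 'X_{1..n}) j : (N (mdeg m).+1 <= j)%N ->
    (\sum_(i < j) dpow a i f) m = (\sum_(i < N (mdeg m).+1) dpow a i f) m.
  elim: j => [|j IH]; first by rewrite leqn0 => /eqP ->.
  rewrite leq_eqVlt => /predU1P[-> //|le_j].
  by rewrite -IH // !fps_sumE big_ord_recr /= (NP _ _ le_j) // addr0.
exists (fun m => (\sum_(i < N (mdeg m).+1) dpow a i f) m).
  by move=> m; exists (N (mdeg m).+1) => j; apply: stable.
by move=> D; exists (N D.+1); apply: eq_bigr => m /eqP ->.
Qed.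

(** * Growth of exp(xi) f *)

Section ExponentialGrowth.
Variables (R : realType) (K : fieldType) (nrm : K -> R).
Hypothesis K_char0 : [pchar K] =i pred0.
Hypothesis nrmP : nontrivial_norm nrm.
Variables (n : nat) (A : {pred fps K n.+1}).
Hypothesis A_alg : GRing.subalg_closed A.
Hypothesis A_poly : forall p : {mpoly K[n.+1]}, fps_of_mpoly p \in A.
Hypothesis A_diff : forall (i : 'I_n.+1) (f : fps K n.+1), f \in A -> fps_deriv i f \in A.
Hypothesis A_maj : majorization_closed nrm A.
Hypothesis A_ift : implicit_function_closed nrm A.
Variable a : 'I_n.+1 -> fps K n.+1.
Hypothesis aA : forall i, a i \in A.
Hypothesis nilp : x_nilpotent (fps_derivation a).

Lemma derivation_mem f : f \in A -> fps_derivation a f \in A.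
Proof.
have [A1 AL AM] := A_alg; move=> fA.
have A0 : 0 \in A by have := AL (-1) _ _ A1 A1; rewrite scaleN1r addNr.
apply: (big_ind (fun g => g \in A)) => // [g h gA hA|i _]; first by rewrite -[g]scale1r AL.
by rewrite AM // A_diff.
Qed.

Lemma iter_derivation_mem j f : f \in A -> iter j (fps_derivation a) f \in A.
Proof. by move=> fA; elim: j => //= j; apply: derivation_mem. Qed.

Lemma dpow_mem j f : f \in A -> dpow a j f \in A.
Proof.
have [A1 AL AM] := A_alg; move=> fA.
have A0 : 0 \in A by have := AL (-1) _ _ A1 A1; rewrite scaleN1r addNr.
by rewrite -[dpow _ _ _]addr0 AL // iter_derivation_mem.
Qed.

Lemma var_mem i : fps_var K i \in A.
Proof.
suff -> : fps_var K i = fps_of_mpoly 'X_i by apply: A_poly.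
by apply/funext => m; rewrite /fps_of_mpoly mcoeffX eq_sym.
Qed.

Lemma growth_scale_real b r : growth nrm A r -> (forall D, 0 <= r D) ->
  growth nrm A (fun D => b * r D).
Proof.
move=> gr r0; have [c _ le_b] := nrm_large nrmP b.
by apply: growth_le (growth_scale nrmP A_alg c gr) _ => D; rewrite ler_wpM2r.
Qed.

Lemma exp_derivation_growth f : f \in A -> exists2 s, growth nrm A s &
  forall J D, degree_norm nrm (\sum_(j < J) dpow a j f) D <= s D.
Proof.
move=> fA; have [w [C [C1 w1 wD wS]]] := divided_power_weights nrmP K_char0.
have [N0' nil] := nilp; pose N0 := N0'.+1.
pose b i := iter N0 (fps_derivation a) (fps_var K i).
pose N := @degree_norm R K nrm n.+1.
have N_ge0 g D : 0 <= N g D := degree_norm_ge0 nrmP g D.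
have w0 j : 0 <= w j by rewrite (le_trans ler01).
have gN g : g \in A -> growth nrm A (N g) by apply: growth_mem.
have gshift := growth_shift K_char0 nrmP A_alg A_diff A_maj A_ift.
(* One rate for all the data. The series of order at least 1 enter with index D + 1, to match the
   shift [l = 1] of the majorant. *)
pose rho D := \sum_i dpow_norm nrm a w N0 D.+1 (fps_var K i) + \sum_i N (b i) D.+1 + N f D.
have grho : growth nrm A rho.
  apply: growthD => //; last exact: gN.
  apply: growthD => //; apply: growth_sum => // i; last first.
    by apply: (gshift (N (b i))); apply/gN/iter_derivation_mem/var_mem.
  apply: growth_sum => // j; apply: growth_scale_real => //.
  by apply: (gshift (N (dpow a j (fps_var K i)))); apply/gN/dpow_mem/var_mem.
have [C2 C21 nC2] := inv_nat_norm_geometric nrmP K_char0.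
have [al _ alC] := nrm_large nrmP (16 * C2).
have al8 : 8 <= nrm al by rewrite (le_trans _ alC) //; move: C21; lra.
have al1 : 1 <= nrm al by rewrite (le_trans _ al8) // ler1n.
have al0 : 0 < nrm al by rewrite (lt_le_trans ltr01).
have [e ge le_e] := grE_of_growth nrmP A_alg A_maj A_ift al8 grho.
have [h [gh h0 le_h hD]] := superadditive_hull K_char0 nrmP A_alg A_maj A_ift C21 alC nC2 ge.
(* [B] takes care of degree 0, where h 0 = 0 while e 0 is arbitrary. *)
pose V D := nrm al ^+ h D; pose B := nrm al ^+ e 0%N.
have V0 : V 0%N = 1 by rewrite /V h0 expr0.
have V_gt0 D : 0 < V D by rewrite exprn_gt0.
have VD i j : V i * V j <= V (i + j)%N by rewrite -exprD ler_weXn2l.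
have B1 : 1 <= B by rewrite exprn_ege1.
have B0 : 0 <= B by rewrite (le_trans ler01).
have rhoB D : rho D <= B * V D.
  apply: le_trans (le_e D) _; have [->|D0] := posnP D; first by rewrite V0 mulr1.
  by rewrite -[leLHS]mul1r ler_pM ?exprn_ge0 ?ler01 ?(ltW al0) // ler_weXn2l // le_h.
have Phi_ge0 J D g : 0 <= dpow_norm nrm a w J D g by apply: dpow_norm_ge0.
have sum1 (F : 'I_n.+1 -> R) i : (forall i, 0 <= F i) -> F i <= \sum_i F i.
  by move=> F0; rewrite (bigD1 i) //= lerDl sumr_ge0.
have [varB bB fB] : [/\ forall i D, dpow_norm nrm a w N0 D.+1 (fps_var K i) <= B * V D,
    forall i D, N (b i) D.+1 <= B * V D & forall D, N f D <= B * V D].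
  pose X D := \sum_i dpow_norm nrm a w N0 D.+1 (fps_var K i).
  pose Y D := \sum_i N (b i) D.+1.
  have X0 D : 0 <= X D by rewrite sumr_ge0.
  have Y0 D : 0 <= Y D by rewrite sumr_ge0.
  have XYB D : X D + Y D + N f D <= B * V D := rhoB D.
  split=> [i D|i D|D]; have := XYB D; have := X0 D; have := Y0 D; have := N_ge0 f D.
  - have : dpow_norm nrm a w N0 D.+1 (fps_var K i) <= X D.
      by apply: (sum1 (fun i => dpow_norm nrm a w N0 D.+1 (fps_var K i))).
    lra.
  - have : N (b i) D.+1 <= Y D by apply: (sum1 (fun i => N (b i) D.+1)).
    lra.
  lra.
have bO i : ordge 2 (b i).
  by apply/in_x2_ordge/nil => //; apply/in_xP/ordge_var.
pose Q := B * w 0%N * C ^+ N0.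
have CN : 0 <= C ^+ N0 by rewrite exprn_ge0 // (le_trans ler01).
have Q0 : 0 <= Q by rewrite !mulr_ge0.
(* eta is small enough for the quadratic term of the contraction, and r, compared with eta, for its
   initial term. *)
pose eta := (2 + 4 * Q)^-1; pose r := eta / (2 + 4 * B).
have Q2 : 0 < 2 + 4 * Q by move: Q0; lra.
have B2 : 0 < 2 + 4 * B by move: B0; lra.
have eta_gt0 : 0 < eta by rewrite invr_gt0.
have r_gt0 : 0 < r by rewrite divr_gt0.
have etaE : eta * (2 + 4 * Q) = 1 by rewrite mulVf // gt_eqF.
have rE : r * (2 + 4 * B) = eta by rewrite mulfVK // gt_eqF.
have etaQ := mulr_ge0 (ltW eta_gt0) Q0; have rB := mulr_ge0 (ltW r_gt0) B0.
have eta1 : 2 * eta <= 1 by move: etaE etaQ; lra.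
have le_var M J i : majorant nrm a w V r M J 1 (fps_var K i) <= eta.
  apply: (majorant_var K_char0 nrmP nilp C1 w1 wD wS V0 V_gt0 VD M r_gt0 (N0 := N0) (B := B)) => //.
  - exact: ltW.
  - by move: rE rB eta1 eta_gt0; lra.
  - by move: rE rB (ltW r_gt0); lra.
  by move: etaE etaQ (ltW eta_gt0); rewrite /Q; lra.
exists (fun D => 2 * (B * w 0%N) * ((r^-1) ^+ D * V D)) => [|J D].
  apply: growth_scale_real => [|D].
    by apply: growth_rescale => //; rewrite invr_ge0 ltW.
  by rewrite mulr_ge0 ?exprn_ge0 ?invr_ge0 ?(ltW r_gt0) // ltW.
apply: (@le_trans _ _ (dpow_norm nrm a w J D f)).
  apply: le_trans (degree_norm_sum nrmP _ _ _ _) _; apply: ler_sum => j _.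
  by rewrite ler_peMl ?N_ge0.
have fB' d : (0 <= d)%N -> degree_norm nrm f d <= B * V (d - 0)%N by rewrite subn0 fB.
have := majorant_le K_char0 nrmP nilp C1 w1 wD V0 V_gt0 VD r_gt0 (M := D.+1) (J := J) (leqnn 0)
  (ltW eta_gt0) eta1 (le_var _ J) (@ordge0 _ _ f) B0 fB'.
rewrite expr0 mulr1 /majorant big_ord_recr /= subn0 => le_f.
rewrite exprVn [_^-1 * _]mulrC -ler_pdivrMr ?divr_gt0 ?exprn_gt0 // invf_div.
apply: le_trans le_f.
rewrite lerDr sumr_ge0 // => i _; rewrite mulr_ge0 // mulr_ge0 ?exprn_ge0 ?(ltW r_gt0) //.
by rewrite invr_ge0 ltW.
Qed.

Lemma exp_acts_pos : exp_acts (fps_derivation a) A.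
Proof.
move=> f fA; have [g gS gN] := exp_series_exists nrm f K_char0 nilp.
exists g => //; have [s gs le_s] := exp_derivation_growth fA.
apply: (mem_growth A_maj); apply: growth_le gs _ => D.
by have [J ->] := gN D.
Qed.

End ExponentialGrowth.

Theorem theorem4p1 (R : realType) (K : fieldType)
    (K_char0 : [pchar K] =i pred0)
    (nrm : K -> R) (nrmP : nontrivial_norm nrm)
    (n : nat) (A : {pred fps K n})
    (A_alg : GRing.subalg_closed A)
    (A_poly : forall p : {mpoly K[n]}, fps_of_mpoly p \in A)
    (A_diff : forall (i : 'I_n) (f : fps K n), f \in A -> fps_deriv i f \in A)
    (A_maj : majorization_closed nrm A)
    (A_ift : implicit_function_closed nrm A)
    (a : 'I_n -> fps K n) (aA : forall i, a i \in A)
    (xi_nilp : x_nilpotent (fps_derivation a)) :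
  exp_acts (fps_derivation a) A.
Proof.
case: n A A_alg A_poly A_diff A_maj A_ift a aA xi_nilp => [|n] A A_alg A_poly A_diff
  A_maj A_ift a aA nilp; last exact: (exp_acts_pos K_char0 nrmP).
(* Without variables there is no axis to carry rates, but all series are constants and majorized by
   0. *)
move=> f _; have [g gS _] := exp_series_exists nrm f K_char0 nilp.
exists g => //; apply: (A_maj _ _ (A_poly 0)); exists 1%N => d d0.
rewrite [leLHS](_ : _ = 0) ?(degree_norm_ge0 nrmP) //; apply/(degree_norm0P nrmP) => m md.
by rewrite -md mdegE big_ord0 in d0.
Qed.
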